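(* Suppose that a pair of smooth functions $(\phi,u):\overline{\Omega}\times[0,T]\to\mathbb{R}\times\mathbb{R}^2$ satisfies, in $\Omega\times(0,T)$, $$\frac{\partial\phi}{\partial t}+\nabla\cdot(\phi u)=0,$$ $$\rho\phi\Bigl[\frac{\partial u}{\partial t}+(u\cdot\nabla)u\Bigr]-2\mu\nabla\cdot(\phi D(u))+\rho g\phi\nabla\eta=0,$$ $$\phi=\eta+\zeta.$$ Then $$\frac{d}{dt}E(t)=I_1(t;\Gamma)+I_2(t;\Gamma)+I_3(t;\Gamma)+I_4(t;\Omega).$$
   Context: Let $\Omega\subset\mathbb{R}^2$ be a bounded domain with boundary $\Gamma=\partial\Omega$ and unit outward normal vector $n$, and let $T$ be a positive constant. Here $\phi$ is the total height of wave, $u=(u_1,u_2)^T$ is the velocity, and $\eta:\overline{\Omega}\times[0,T]\to\mathbb{R}$ is the water level from the reference height. The constants $\rho$ (density), $\mu$ (viscosity) and $g$ (gravity) are positive, and $\zeta\in C^1(\overline{\Omega})$ is a given depth function with $\zeta(x)>0$ for $x\in\overline{\Omega}$. The strain-rate tensor is $D(u)=\frac12(\nabla u+(\nabla u)^T)$, and $|A|^2=\sum_{i,j=1}^2A_{ij}^2$ for a $2\times2$ matrix $A$. The total energy at time $t\in[0,T]$ is $$E(t)=\int_\Omega\frac{\rho}{2}\phi|u|^2\,dx+\int_\Omega\frac{\rho g|\eta|^2}{2}\,dx.$$ For $t\in[0,T]$, with all integrands evaluated at time $t$, $$I_1(t;\Gamma)=-\frac{\rho}{2}\int_\Gamma\phi|u|^2\,u\cdot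 n\,ds,\qquad I_2(t;\Gamma)=-\rho g\int_\Gamma\phi\,\eta\,u\cdot n\,ds,$$ $$I_3(t;\Gamma)=2\mu\int_\Gamma\phi\,[D(u)n]\cdot u\,ds,\qquad I_4(t;\Omega)=-2\mu\int_\Omega\phi|D(u)|^2\,dx.$$ *)

(* Defs.v *)
From HB Require Import structures.
From mathcomp Require Import all_boot all_order all_algebra.
From mathcomp Require Import all_classical all_reals all_analysis.

Set Implicit Arguments.
Unset Strict Implicit.
Unset Printing Implicit Defensive.

Import Order.TTheory GRing.Theory Num.Theory.
Import numFieldNormedType.Exports.
Local Open Scope classical_set_scope.
Local Open Scope ring_scope.

(* Points of the plane are pairs in R * R (whose norm in the library is the
   sup norm, hence [enorm] below); points of space-time are ((x1, x2), t). *)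

Section Plane.
Variable R : realType.

Definition coord (i : 'I_2) (x : R * R) : R := if i == 0 then x.1 else x.2.

Definition dot (x y : R * R) : R := \sum_(i < 2) coord i x * coord i y.

Definition enorm (x : R * R) : R := Num.sqrt (dot x x).

Definition mxapp (A : 'M[R]_2) (x : R * R) : R * R :=
  (\sum_(j < 2) A 0 j * coord j x, \sum_(j < 2) A 1 j * coord j x).

Definition mxnorm2 (A : 'M[R]_2) : R := \sum_(i < 2) \sum_(j < 2) A i j ^+ 2.

Definition leb2 := (@lebesgue_measure R \x @lebesgue_measure R)%E.

End Plane.

Section ClosureRegularity.
Variables (R : realType) (V W : normedModType R).

Definition iterD (s : seq V) (f : V -> W) : V -> W :=
  foldr (fun v h => 'D_v h) f s.

(* C^k of the closure of the open set U: f is continuous on the closure, all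
   its derivatives of order at most k exist in U, and each of them has a
   continuous extension to the closure. Values of f off the closure are
   irrelevant. *)
Definition Ck_closure (k : nat) (U : set V) (f : V -> W) : Prop :=
  {within closure U, continuous f} /\
  forall s : seq V, (size s <= k)%N ->
    (forall x v, U x -> (size s < k)%N -> derivable (iterD s f) x v) /\
    (exists2 h : V -> W, {within closure U, continuous h} &
       forall x, U x -> h x = iterD s f x).

Definition smooth_closure (U : set V) (f : V -> W) : Prop :=
  forall k, Ck_closure k U f.

(* The continuous extension of f from U to its closure: it is f itself at the
   points of U where f is continuous. *)
Definition cont_ext (U : set V) (f : V -> W) (z : V) : W :=
  lim (f w @[w --> within U (nbhs z)]).

End ClosureRegularity.

Section Domain.
Variable R : realType.

Definition boundary (Om : set (R * R)) : set (R * R) :=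
  closure Om `\` interior Om.

Definition bounded_domain (Om : set (R * R)) : Prop :=
  [/\ open Om, connected Om, Om !=set0 & bounded_set Om].

(* [gam] parametrises the boundary of Om by finitely many regular C^1 arcs on
   [0, 1], injective and meeting only at endpoints, and n is the unit outward
   normal at the interior points of the arcs. The finitely many endpoints may
   be corners; n is unconstrained there. A closed curve may be a single arc. *)
Definition piecewise_C1_boundary (Om : set (R * R)) (m : nat)
    (gam : 'I_m -> R -> R * R) (n : R * R -> R * R) : Prop :=
  [/\ boundary Om = \bigcup_(i in [set: 'I_m]) (gam i @` `[0, 1]),
      (forall i, Ck_closure 1 (`]0, 1[ : set R) (gam i)),
      (forall i t, 0 < t < 1 -> derive1 (gam i) t != 0),
      (forall i j s t, 0 < s < 1 -> 0 <= t <= 1 ->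
         gam i s = gam j t -> i = j /\ s = t) &
      (forall i t, 0 < t < 1 ->
         let p := gam i t in
         [/\ enorm (n p) = 1,
             dot (n p) (derive1 (gam i) t) = 0 &
             \forall r \near 0^'+,
               Om (p - r *: n p) /\ ~ closure Om (p + r *: n p)])].

Definition line_integral (m : nat) (gam : 'I_m -> R -> R * R)
    (f : R * R -> R) : R :=
  \sum_(i < m) \int[@lebesgue_measure R]_(t in `[0, 1])
    (f (gam i t) * enorm (derive1 (gam i) t)).

End Domain.

Section SpaceTime.
Variable R : realType.

Definition cylinder (Om : set (R * R)) (T : R) : set (R * R * R) :=
  [set z | Om z.1 /\ 0 < z.2 < T].

Definition tdir : R * R * R := ((0, 0), 1).

Definition xdir (i : 'I_2) : R * R * R := (((i == 0)%:R, (i == 1)%:R), 0).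

Definition dt (W : normedModType R) (f : R * R * R -> W) := 'D_tdir f.

Definition dx (W : normedModType R) (i : 'I_2) (f : R * R * R -> W) :=
  'D_(xdir i) f.

Definition grad (f : R * R * R -> R) (z : R * R * R) : R * R :=
  (dx 0 f z, dx 1 f z).

Definition divg (F : R * R * R -> R * R) (z : R * R * R) : R :=
  \sum_(i < 2) dx i (fun w => coord i (F w)) z.

(* row-wise divergence *)
Definition divgM (A : R * R * R -> 'M[R]_2) (z : R * R * R) : R * R :=
  (\sum_(j < 2) dx j (fun w => A w 0 j) z,
   \sum_(j < 2) dx j (fun w => A w 1 j) z).

Definition convect (u : R * R * R -> R * R) (z : R * R * R) : R * R :=
  \sum_(j < 2) coord j (u z) *: dx j u z.

Definition strain (u : R * R * R -> R * R) (z : R * R * R) : 'M[R]_2 :=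
  \matrix_(i, j) (2^-1 * (coord i (dx j u z) + coord j (dx i u z))).

(* D(u) on the closed cylinder *)
Definition strain_ext (Om : set (R * R)) (T : R) (u : R * R * R -> R * R)
    (z : R * R * R) : 'M[R]_2 :=
  \matrix_(i, j) cont_ext (cylinder Om T) (fun w => strain u w i j) z.

End SpaceTime.

Section Energy.
Variables (R : realType) (Om : set (R * R)) (T rho mu g : R).
Variables (phi eta : R * R * R -> R) (u : R * R * R -> R * R).
Variables (m : nat) (gam : 'I_m -> R -> R * R) (n : R * R -> R * R).

Definition energy (t : R) : R :=
  \int[@leb2 R]_(x in Om)
     (rho / 2 * phi (x, t) * enorm (u (x, t)) ^+ 2) +
  \int[@leb2 R]_(x in Om) (rho * g * `|eta (x, t)| ^+ 2 / 2).

Definition I1 (t : R) : R :=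
  - (rho / 2) * line_integral gam (fun x =>
      phi (x, t) * enorm (u (x, t)) ^+ 2 * dot (u (x, t)) (n x)).

Definition I2 (t : R) : R :=
  - (rho * g) * line_integral gam (fun x =>
      phi (x, t) * eta (x, t) * dot (u (x, t)) (n x)).

Definition I3 (t : R) : R :=
  2 * mu * line_integral gam (fun x =>
      phi (x, t) * dot (mxapp (strain_ext Om T u (x, t)) (n x)) (u (x, t))).

Definition I4 (t : R) : R :=
  - (2 * mu) * \int[@leb2 R]_(x in Om)
      (phi (x, t) * mxnorm2 (strain_ext Om T u (x, t))).

End Energy.

(* Main.v *)
(* The equations give the local balance [d_t e = div V - 2 mu phi |D(u)|^2] in
   the open cylinder, where [e] is the energy density and [V] collects the
   integrands of I1, I2, I3. Integrating over Om needs the divergence theorem on a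
   domain whose boundary consists of C^1 arcs with possible corners and no
   assumption on their position. It is proved slice by slice: a horizontal line
   meets Om in an open set, and the fundamental theorem of calculus on its
   components turns the integral of [d_1 F] into a sum of [+-F] over the boundary
   points of the line, the sign telling on which side Om lies. This is valid when
   the line avoids the endpoints of the arcs and meets them at points where the
   second coordinate has non-zero derivative; by the one-dimensional Sard lemma
   these are almost all lines. The sum is integrated in the height by the change
   of variables formula on each monotone piece of each arc, countably many, with
   dominated convergence; the sign times the modulus of the derivative of the
   second coordinate is [n_1] times the speed. Exchanging the coordinates gives
   the second component. Differentiation under the integral sign yields dE/dt
   inside (0, T); at the end times, E and the rate are continuous on [0, T], and
   the mean value theorem gives the one-sided derivatives. *)
Require Import Defs.
From HB Require Import structures.
From mathcomp Require Import ring lra measurable_realfun lebesgue_integral_under.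
From mathcomp Require Import all_boot all_order all_algebra.
From mathcomp Require Import all_classical all_reals all_analysis.

Set Implicit Arguments.
Unset Strict Implicit.
Unset Printing Implicit Defensive.

Import Order.TTheory GRing.Theory Num.Theory.
Import numFieldNormedType.Exports.
Local Open Scope classical_set_scope.
Local Open Scope ring_scope.


(** * Integration and continuity *)

(** A C^1 arc may oscillate: its height can have infinitely many monotone pieces, and the normal is
    given pointwise, with no continuity or measurability. Two choices answer this. The sign in the
    slice formula is defined topologically, by asking whether [Om] lies just to the left of the
    point, and is shown to be locally constant where the height has non-zero derivative;
    measurability and bounds of the normal times the speed are then consequences. The sum over the
    pieces is dominated by a multiple of the number of preimages of a height (the Banach
    indicatrix), whose integral is the total variation of the height; at a regular height
    compactness leaves finitely many pieces, so the partial sums are eventually constant. A second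
    obstacle is that derivatives exist only in the open cylinder, whereas compactness arguments,
    boundary integrals and end times need its closure. Every derivative is therefore carried
    together with a continuous extension, and [cont_ext] in I3 and I4 is identified with that
    extension. *)

Lemma within_comp (X Y Z : topologicalType) (A : set X) (B : set Y) (f : X -> Y) (g : Y -> Z) :
  (forall x, A x -> B (f x)) -> {within A, continuous f} -> {within B, continuous g} ->
  {within A, continuous (g \o f)}.
Proof.
move=> AB /subspace_continuousP cf /subspace_continuousP cg.
apply/subspace_continuousP => x Ax U /= /(cg _ (AB _ Ax)) /= gU.
have /= := cf _ Ax _ gU.
rewrite /nbhs/= /within/= => fU.
by move: fU; apply: filterS => y /= H Ay; apply: H => //; exact: AB.
Qed.

(** [f] has no sign, so countable additivity comes from dominated convergence of the restrictions of
    [f] to finite unions, with bound [|f|]. *)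
Lemma Rintegral_bigcup_cvg d (T : measurableType d) (R : realType) (mu : {measure set T -> \bar R})
    (F : nat -> set T) (f : T -> R) :
  trivIset setT F -> (forall k, measurable (F k)) -> mu.-integrable (\bigcup_k F k) (EFin \o f) ->
  (\sum_(0 <= k < n) \int[mu]_(x in F k) f x) @[n --> \oo] --> \int[mu]_(x in \bigcup_k F k) f x.
Proof.
move=> tF mF fi.
have mU : measurable (\bigcup_k F k) by exact: bigcup_measurable.
pose B n := \big[setU/set0]_(k < n) F k.
have mB n : measurable (B n) by exact: bigsetU_measurable.
have BU n : B n `<=` \bigcup_k F k by exact: bigsetU_bigcup.
have sumE n : \sum_(0 <= k < n) \int[mu]_(x in F k) f x = \int[mu]_(x in \bigcup_k F k) (f \_ (B n)) x.
  rewrite [RHS]Rintegral_mkcond -patch_setI setIC setIidl// -Rintegral_mkcond.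
  elim: n => [|n IH]; first by rewrite big_nil /B big_ord0 Rintegral_set0.
  rewrite big_nat_recr//= IH /B big_ord_recr/= Rintegral_setU//.
  - exact: mB.
  - by have := integrableS mU (mB n.+1) (@BU n.+1) fi; rewrite /B big_ord_recr.
  - apply/disj_set2P; apply: (@trivIset_bigsetUI _ xpredT) => //.
    by rewrite [X in trivIset X _](_ : _ = [set: nat])//; exact/seteqP.
under eq_fun do rewrite sumE.
have mf : measurable_fun (\bigcup_k F k) (EFin \o f) := measurable_int _ fi.
have mfB n : measurable_fun (\bigcup_k F k) (fun x => ((f \_ (B n)) x)%:E).
  apply/measurable_EFinP/measurable_restrict => //.
  by apply: measurable_funS mU _ _ => [x []//|]; exact/measurable_EFinP.
have [] := @dominated_convergence _ _ _ mu _ mU (fun n x => ((f \_ (B n)) x)%:E) (EFin \o f)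
   (abse \o (EFin \o f)) mfB mf.
- apply: aeW => x [k _ Fkx]; apply: cvg_near_cst.
  near=> n; rewrite /= patchE ifT// inE; rewrite /B -bigcup_mkord; exists k => //=.
  by near: n; exact: nbhs_infty_gt.
- exact: integrable_abse.
- apply: aeW => x n _ /=; rewrite patchE; case: ifPn => _ //; rewrite lee_fin normr0 normr_ge0//.
- move=> _ _ H; rewrite /Rintegral; move: H => /=; rewrite -[X in _ --> X -> _]fineK; last exact: integrable_fin_num.
  by move=> /fine_cvg.
Unshelve. all: by end_near. Qed.

Lemma integrable_le_cst d (T : measurableType d) (R : realType) (mu : {measure set T -> \bar R})
    (A : set T) (f : T -> R) (M : R) :
  measurable A -> (mu A < +oo)%E -> measurable_fun A f -> (forall x, A x -> `|f x| <= M) ->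
  mu.-integrable A (EFin \o f).
Proof.
move=> mA Afin mf fM; apply: measurable_bounded_integrable => //.
exists M; split; first exact: num_real.
by move=> y My x Ax; apply: le_trans (fM x Ax) (ltW My).
Qed.

Lemma compact_within_bounded (R : realType) (T : topologicalType) (A : set T) (f : T -> R) :
  compact A -> {within A, continuous f} -> exists2 M, 0 < M & forall x, A x -> `|f x| <= M.
Proof.
move=> cA cf.
have /compact_bounded[M [_ bM]] := continuous_compact cf cA.
exists (`|M| + 1); first by have := normr_ge0 M; lra.
move=> x Ax; apply: (bM (`|M| + 1)); first by have := ler_norm M; lra.
by exists x.
Qed.

(** * One-dimensional slices *)

Section Slice.
Variable R : realType.
Notation mu := (@lebesgue_measure R).

Definition leftin (S : set R) (x : R) := \forall r \near 0^'+, S (x - r).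
Definition rightin (S : set R) (x : R) := \forall r \near 0^'+, S (x + r).
(** At an end of a component of [S] this is the sign that the fundamental theorem of calculus gives
    to the value there: upper ends count positively, lower ends negatively. *)
Definition side (S : set R) (x : R) : R := if `[< leftin S x >] then 1 else -1.

Lemma near0_right_ex (P : set R) : (\forall r \near 0^'+, P r) -> 
  forall e, 0 < e -> exists2 r, 0 < r < e & P r.
Proof.
move=> nP e e0.
have : \forall r \near (0:R)^'+, [/\ 0 < r, r < e & P r].
  near=> r; split; [by near: r; exact: nbhs_right_gt | by near: r; exact: nbhs_right_lt | by near: r].
by move=> /filter_ex [r [r0 re Pr]]; exists r; rewrite ?r0.
Unshelve. all: by end_near. Qed.

Lemma rightin_itv (S : set R) a b : a < b -> (forall x, a < x < b -> S x) -> rightin S a.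
Proof.
move=> ab Sab; rewrite /rightin; near=> r; apply: Sab.
have r0 : 0 < r by near: r; exact: nbhs_right_gt.
have : r < b - a by near: r; apply: nbhs_right_lt; rewrite subr_gt0.
by move=> ?; apply/andP; split; lra.
Unshelve. all: by end_near. Qed.

Lemma leftin_itv (S : set R) a b : a < b -> (forall x, a < x < b -> S x) -> leftin S b.
Proof.
move=> ab Sab; rewrite /leftin; near=> r; apply: Sab.
have r0 : 0 < r by near: r; exact: nbhs_right_gt.
have : r < b - a by near: r; apply: nbhs_right_lt; rewrite subr_gt0.
by move=> ?; apply/andP; split; lra.
Unshelve. all: by end_near. Qed.

Lemma not_rightin_itv (S : set R) a b : a < b -> (forall x, a < x < b -> ~ S x) -> ~ rightin S a.
Proof.
move=> ab Sab /near0_right_ex /(_ (b - a)); rewrite subr_gt0 => /(_ ab)[r r0]; apply: Sab; lra.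
Qed.

Lemma not_leftin_itv (S : set R) a b : a < b -> (forall x, a < x < b -> ~ S x) -> ~ leftin S b.
Proof.
move=> ab Sab /near0_right_ex /(_ (b - a)); rewrite subr_gt0 => /(_ ab)[r r0]; apply: Sab; lra.
Qed.

Variables (S : set R) (P : seq R) (F H : R -> R) (M : R).
Hypothesis mS : measurable S.
Hypothesis iH : mu.-integrable S (EFin \o H).
Hypothesis bS : forall x, S x -> `|x| < M.
Hypothesis PS : forall x, x \in P -> ~ S x.
Hypothesis dichS : forall a b, a < b -> (forall x, a < x < b -> x \notin P) ->
  (forall x, a < x < b -> S x) \/ (forall x, a < x < b -> ~ S x).
Hypothesis sideS : forall x, x \in P -> leftin S x <-> ~ rightin S x.
Hypothesis ftcS : forall a b, a < b -> (forall x, a < x < b -> S x) ->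
  \int[mu]_(x in `]a, b[) H x = F b - F a.

(* Induction from left to right; the last term is the lower endpoint of the component
   of S, if any, that starts at a. *)
Lemma slice_tail s a : path <%R a s ->
  (forall x, a < x -> x \in P -> x \in s) -> {subset s <= P} ->
  \int[mu]_(x in S `&` `]a, +oo[) H x =
  \sum_(x <- s) side S x * F x - (if `[< rightin S a >] then F a else 0).
Proof.
elim: s a => [|b s IH] a /=.
  move=> _ Ps _; rewrite big_nil sub0r.
  have noS : forall x, a < x -> ~ S x.
    (* No point of [P] is left above [a], so [S] would contain all of []a, b + 1[]; [b] is chosen
       above [x] and beyond the bound [M]. *)
    move=> x ax Sx; pose b := Num.max x `|M| + 1.
    have xb : x < b by rewrite /b ltr_pwDr// le_max lexx.
    have Mb : `|M| + 1 <= b by rewrite /b lerD2r le_max lexx orbT.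
    have ab : a < b by exact: lt_trans xb.
    have [] := @dichS a (b+1).
    - lra.
    - by move=> y /andP[ay _]; apply/negP => /(Ps _ ay).
    - move=> /(_ b); have ab1 : a < b < b + 1 by lra.
      move=> /(_ ab1) /bS; rewrite ltNge => /negP; apply.
      have := ler_norm b; have := ler_norm M; lra.
    - by move=> /(_ x); apply => //; lra.
  rewrite asboolF; last by apply: (@not_rightin_itv _ _ (a + 1)) => [|x /andP[ax _]]; [lra|exact: noS].
  rewrite oppr0 (_ : S `&` _ = set0) ?Rintegral_set0//.
  apply/seteqP; split => x //= -[Sx]; rewrite in_itv/= andbT => ax.
  exact: noS ax Sx.
move=> /andP[ab bs] Ps sP.
have bP : b \in P by apply: sP; rewrite inE eqxx.
have nSb := PS bP.
have -> : S `&` `]a, +oo[ = (S `&` `]a, b[) `|` (S `&` `]b, +oo[).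
  apply/seteqP; split => x /=; rewrite !in_itv/= !andbT.
    move=> [Sx ax]; case: (ltgtP x b) => xb; [by left; rewrite ax|by right|].
    by rewrite xb in Sx.
  case=> -[Sx]; first by move=> /andP[].
  by move=> bx; split => //; lra.
rewrite Rintegral_setU//=; last 4 first.
- by apply: measurableI.
- by apply: measurableI.
- by apply: integrableS iH => //; [apply: measurableU; apply: measurableI|by move=> ? [][]].
- by apply/disj_setPS => x /=; rewrite !in_itv/= => -[[_ ?] [_ ?]]; lra.
rewrite (IH b)//; last 2 first.
- move=> x bx xP; have := Ps x (lt_trans ab bx) xP; rewrite inE => /orP[/eqP xb|//]; lra.
- by move=> x xs; apply: sP; rewrite inE xs orbT.
rewrite big_cons.
have nPab : forall x, a < x < b -> x \notin P.
  move=> x /andP[ax xb]; apply/negP => /(Ps _ ax); rewrite inE => /orP[/eqP|]; first lra.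
  move=> xs; have := order_path_min (@lt_trans _ _) bs => /allP /(_ _ xs); lra.
have lr := sideS bP.
have [Sab|Sab] := dichS ab nPab.
- have la := leftin_itv ab Sab; have ra := rightin_itv ab Sab.
  have nr : ~ rightin S b by exact/lr.
  have -> : side S b = 1 by rewrite /side asboolT.
  rewrite (asboolF nr) (asboolT ra) (_ : S `&` `]a, b[ = `]a, b[%classic) ?ftcS//; last first.
    by apply/setIidPr => x /=; rewrite in_itv/= => /Sab.
  ring.
- have la := not_leftin_itv ab Sab; have ra := not_rightin_itv ab Sab.
  have nr : rightin S b by apply: contrapT => /lr.
  have -> : side S b = -1 by rewrite /side asboolF.
  rewrite (asboolT nr) (asboolF ra) (_ : S `&` `]a, b[ = set0) ?Rintegral_set0//; last first.
    by apply/seteqP; split => x //= -[Sx]; rewrite in_itv/= => /Sab.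
  ring.
Qed.

Lemma slice_sum : uniq P -> \int[mu]_(x in S) H x = \sum_(x <- P) side S x * F x.
Proof.
move=> uP.
pose Q := sort <=%R P.
have pQ : perm_eq Q P by rewrite perm_sort.
have sQ : sorted <%R Q by rewrite lt_sorted_uniq_le sort_uniq uP/= sort_le_sorted.
rewrite -(perm_big _ pQ)/=.
(* [a] lies below [P] and below [S], so starting the induction at [a - 1] covers all of [S] and
   leaves no term for a component in progress. *)
pose B := \big[Num.max/`|M|]_(x <- P) `|x|; pose a := - B - 1.
have aP x : x \in P -> a < x.
  move=> xP; have : `|x| <= B by exact: le_bigmax_seq.
  have := ler_norm (- x); rewrite normrN /a; lra.
have aS x : S x -> a < x.
  move=> /bS xM; have : `|M| <= B by exact: bigmax_ge_id.
  have := ler_norm (- x); rewrite normrN; have := ler_norm M; rewrite /a; lra.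
have paQ : path <%R a Q.
  rewrite path_min_sorted//; apply/allP => x; rewrite (perm_mem pQ); exact: aP.
have nra : ~ rightin S (a - 1).
  by apply: (@not_rightin_itv _ _ a) => [|x /andP[_ xa] /aS]; lra.
have := @slice_tail Q (a - 1).
rewrite asboolF// subr0 => <-.
- congr Rintegral; apply/esym/setIidPl => x /aS ax /=; rewrite in_itv/= andbT; lra.
- by move: paQ; case: (Q) => //= y t /andP[ay ->]; rewrite andbT; lra.
- by move=> x _; rewrite (perm_mem pQ).
- by move=> x; rewrite (perm_mem pQ).
Qed.

End Slice.

(** * Change of variables along an arc *)

Section Piece.
Variable R : realType.
Notation mu := (@lebesgue_measure R).
Variables (h dh : R -> R) (a b : R).
Hypothesis ab : a < b.
Hypothesis ch : {within `[a, b], continuous h}.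
Hypothesis cdh : {within `[a, b], continuous dh}.
Hypothesis hdh : forall t, a < t < b -> is_derive t 1 h (dh t).
Hypothesis dh0 : forall t, a < t < b -> dh t != 0.

Lemma piece_inj : {in `[a, b] &, injective h}.
Proof.
have H s t : s \in `[a, b] -> t \in `[a, b] -> s < t -> h s <> h t.
  rewrite !in_itv/= => /andP[as_ sb] /andP[at_ tb] st hst.
  have [] := @MVT R h dh s t st.
  - by move=> x; rewrite in_itv/= => /andP[sx xt]; apply: hdh; lra.
  - apply: continuous_subspaceW ch => x /=; rewrite !in_itv/=; lra.
  - move=> c; rewrite in_itv/= hst subrr => /andP[sc ct] /esym/eqP.
    rewrite mulf_eq0 subr_eq0 (gt_eqF st) orbF; apply/negP/dh0; lra.
move=> s t sI tI hst; case: (ltgtP s t) => // st; exfalso; [exact: (H s t)|exact: (H t s)].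
Qed.

Lemma piece_derive1 t : a < t < b -> derive1 h t = dh t.
Proof. by move=> /hdh ht; rewrite derive1E; apply: derive_val. Qed.

Lemma piece_near_dh (l : R) (F : set_system R) : Filter F -> (\forall t \near F, a < t < b) ->
  dh x @[x --> F] --> l -> derive1 h x @[x --> F] --> l.
Proof.
move=> FF Fab; apply: cvg_trans; apply: near_eq_cvg.
by apply: filterS Fab => t /piece_derive1 ->.
Qed.

Lemma near_right_itv : \forall t \near a^'+, a < t < b.
Proof.
near=> t; apply/andP; split; first by near: t; exact: nbhs_right_gt.
by near: t; exact: nbhs_right_lt.
Unshelve. all: by end_near. Qed.

Lemma near_left_itv : \forall t \near b^'-, a < t < b.
Proof.
near=> t; apply/andP; split; first by near: t; exact: nbhs_left_gt.
by near: t; exact: nbhs_left_lt.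
Unshelve. all: by end_near. Qed.

Lemma piece_LR : derivable_oo_LRcontinuous h a b.
Proof.
have [_ ha hb] := (continuous_within_itvP _ ab).1 ch.
split => // t; rewrite in_itv/= => /hdh ht; exact: ex_derive.
Qed.

Lemma piece_cdh : [/\ {in `]a, b[, continuous (derive1 h : R -> R)},
  cvg (derive1 h x @[x --> a^'+]) & cvg (derive1 h x @[x --> b^'-])].
Proof.
have [co ca cb] := (continuous_within_itvP _ ab).1 cdh.
split.
- move=> t /[dup] tab; rewrite in_itv/= => tab'.
  rewrite /continuous_at piece_derive1//; apply: piece_near_dh; last exact: co.
  by near=> x; have : x \in `]a, b[ by near: x; exact: near_in_itvoo.
- by apply/cvg_ex; exists (dh a); apply: piece_near_dh => //; exact: near_right_itv.
- by apply/cvg_ex; exists (dh b); apply: piece_near_dh => //; exact: near_left_itv.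
Unshelve. all: by end_near. Qed.

Variable g : R -> R.
Hypothesis cg : {within `[a, b], continuous g}.

(** [G] is [g] composed with the inverse of [h], extended by zero. The modulus of [dh] absorbs the
    orientation, so increasing and decreasing [h] share one statement. *)
Lemma piece_push : exists G : R -> R,
  [/\ mu.-integrable setT (EFin \o G),
     forall t, a < t < b -> G (h t) = g t,
     forall y, (forall t, a < t < b -> h t <> y) -> G y = 0 &
     \int[mu]_y G y = \int[mu]_(t in `]a, b[) (g t * `|dh t|)].
Proof.
(* A choice of preimage: by injectivity it inverts [h] on [[a, b]], and the default [a] is not
   reached on the image of [h]. *)
pose T y := xget a [set t | t \in `[a, b] /\ h t = y].
have hK : {in `[a, b], cancel h T}.
  move=> t tab; rewrite /T; case: xgetP => [_ -> [tab' /piece_inj -> //]|/(_ t)]//.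
  by case.
have [icdh icva icvb] := piece_cdh.
have itv_sub : `]a, b[%classic `<=` `[a, b]%classic by apply: subset_itv_oo_cc.
have mgd : measurable_fun `]a, b[ (fun t => g t * `|dh t|).
  apply: measurable_funM.
    by apply: measurable_funS (subspace_continuous_measurable_fun _ cg).
  apply: measurableT_comp => //.
  by apply: measurable_funS (subspace_continuous_measurable_fun _ cdh).
(* The two monotone cases differ only in the order of [h a] and [h b]; [c] and [d] are these values,
   sorted. *)
have common c d : c < d -> h @` `]a, b[ = `]c, d[%classic -> {within `[c, d], continuous T} ->
    (forall y, y \in `[c, d] -> T y \in `[a, b]) ->
    (\int[mu]_(y in `[c, d]) (g (T y))%:E = \int[mu]_(t in `]a, b[) (g t * `|dh t|)%:E)%E ->
    exists G : R -> R,
  [/\ mu.-integrable setT (EFin \o G),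
     forall t, a < t < b -> G (h t) = g t,
     forall y, (forall t, a < t < b -> h t <> y) -> G y = 0 &
     \int[mu]_y G y = \int[mu]_(t in `]a, b[) (g t * `|dh t|)].
  move=> cd him cT Tab intE.
  have cgT : {within `[c, d], continuous (g \o T)}.
    exact: (@within_comp _ _ _ `[c, d]%classic `[a, b]%classic T g Tab cT cg).
  have igT : mu.-integrable `[c, d] (EFin \o (g \o T)).
    by apply: continuous_compact_integrable => //; exact: segment_compact.
  exists ((g \o T) \_ `]c, d[); split.
  - rewrite -restrict_EFin; apply/integrable_restrict => //=; rewrite setTI.
    by apply: integrableS igT => //; exact: subset_itv_oo_cc.
  - move=> t tab; rewrite patchE ifT ?inE/=; last first.
      by have : (h @` `]a, b[) (h t) by [exists t]; rewrite him.
    by rewrite hK//; apply: itv_sub.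
  - move=> y ny; rewrite patchE ifF//; apply/negbTE/negP; rewrite inE -him => -[t tab].
    exact: ny.
  - rewrite -Rintegral_mkcond /Rintegral -intE [in RHS]integral_itv_bndoo//.
    by apply: measurable_funS (measurable_int _ igT) => //; exact: subset_itv_oo_cc.
have last_eq f : (forall t, t \in `]a, b[ -> f t = g t * `|dh t|) ->
   (\int[mu]_(t in `[a, b]) (f t)%:E = \int[mu]_(t in `]a, b[) (g t * `|dh t|)%:E)%E.
  move=> fE; rewrite integral_itv_bndoo.
    by apply: eq_integral => t; rewrite inE/= => /fE ->.
  apply/measurable_EFinP; apply: eq_measurable_fun mgd => t; by rewrite inE/= => /fE ->.
have [hab|hab] := leP (h a) (h b).
- have mono := segment_continuous_inj_le hab ch piece_inj.
  have smono := leW_mono_in mono.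
  have aI : a \in `[a, b] by rewrite in_itv/= lexx ltW.
  have bI : b \in `[a, b] by rewrite in_itv/= lexx ltW.
  have hab' : h a < h b by rewrite smono.
  have hmin : Num.min (h a) (h b) = h a by exact: min_l.
  have hmax : Num.max (h a) (h b) = h b by exact: max_r.
  have hm : {in `[a, b] &, {homo h : x y / x < y}} by move=> x y xI yI; rewrite smono.
  apply: (common (h a) (h b)) => //.
  + apply/seteqP; split; first by apply: increasing_image_oo => // x y xI yI; rewrite smono.
    move=> y /=; rewrite in_itv/= => /andP[ay yb].
    have [] := @IVT R h a b y (ltW ab) ch.
      by rewrite hmin hmax (ltW ay) (ltW yb).
    move=> t; rewrite in_itv/= => /andP[]; rewrite !le_eqVlt => /orP[/eqP<- _ yE|aT]; first lra.
    move=> /orP[/eqP-> yE|tb yE]; first lra.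
    by exists t => //; rewrite /= in_itv/= aT.
  + exact: (segment_can_le_continuous (ltW ab) ch hK).
  + move=> y; rewrite in_itv/= => /andP[ay yb].
    have [] := @IVT R h a b y (ltW ab) ch; first by rewrite hmin hmax ay yb.
    by move=> t tI <-; rewrite hK.
  + rewrite (@integration_by_substitution_increasing _ h (g \o T) a b (ltW ab) hm icdh icva icvb piece_LR); last first.
    * apply: (@within_comp _ _ _ _ `[a, b]%classic T g _ (segment_can_le_continuous (ltW ab) ch hK) cg) => y.
      rewrite /= in_itv/= => /andP[ay yb].
      have [] := @IVT R h a b y (ltW ab) ch; first by rewrite hmin hmax ay yb.
      by move=> t tI <-; rewrite hK.
    * apply: last_eq => t tI; have tI' : t \in `[a, b] by apply: itv_sub.
      rewrite ?fctE /= hK// ?piece_derive1; last by rewrite in_itv in tI.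
      congr (_ * _).
      (* The sign of [dh] for increasing [h] is read off [- h], which is decreasing. *)
      rewrite ger0_norm// -oppr_le0 -piece_derive1; last by rewrite in_itv in tI.
      have hN x : x \in `]a, b[ -> is_derive x 1 (\- h) (- dh x).
        rewrite in_itv/= => /hdh hx; exact: is_deriveN.
      have := @decr_derive1_le0_itv R (\- h) true false a b t.
      rewrite (derive1E (\- h)) (@derive_val _ _ _ _ _ _ _ (hN t tI)) piece_derive1; last by rewrite in_itv in tI.
      apply.
      + by move=> x /set_mem xI; have := hN x xI => -[].
      + by move=> x y xI yI xy; rewrite ltrN2; exact: hm.
      + by [].
- have mono := segment_continuous_inj_ge (ltW hab) ch piece_inj.
  have smono := leW_nmono_in mono.
  have hmin : Num.min (h a) (h b) = h b by apply: min_r; exact: ltW.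
  have hmax : Num.max (h a) (h b) = h a by apply: max_l; exact: ltW.
  have Tab y : y \in `[h b, h a] -> T y \in `[a, b].
    rewrite in_itv/= => yI.
    have [] := @IVT R h a b y (ltW ab) ch; first by rewrite hmin hmax.
    by move=> t tI <-; rewrite hK.
  have hm : {in `[a, b] &, {homo h : x y /~ x < y}} by move=> x y xI yI; rewrite smono.
  apply: (common (h b) (h a)) => //.
  + apply/seteqP; split; first by apply: decreasing_image_oo => // x y xI yI; rewrite smono.
    move=> y /=; rewrite in_itv/= => /andP[ay yb].
    have [] := @IVT R h a b y (ltW ab) ch.
      by rewrite hmin hmax (ltW ay) (ltW yb).
    move=> t; rewrite in_itv/= => /andP[]; rewrite !le_eqVlt => /orP[/eqP<- _ yE|aT]; first lra.
    move=> /orP[/eqP-> yE|tb yE]; first lra.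
    by exists t => //; rewrite /= in_itv/= aT.
  + exact: (segment_can_ge_continuous (ltW ab) ch hK).
  + rewrite (@integration_by_substitution_decreasing _ h (g \o T) a b (ltW ab) hm icdh icva icvb piece_LR); last first.
    * exact: (@within_comp _ _ _ _ `[a, b]%classic T g Tab (segment_can_ge_continuous (ltW ab) ch hK) cg).
    * apply: last_eq => t tI; have tI' : t \in `[a, b] by apply: itv_sub.
      rewrite ?fctE /= hK// ?piece_derive1; last by rewrite in_itv in tI.
      congr (_ * _).
      rewrite ler0_norm// -piece_derive1; last by rewrite in_itv in tI.
      have := @decr_derive1_le0_itv R h true false a b t; apply.
      + by move=> x /set_mem; rewrite /= in_itv/= => /hdh [].
      + by move=> x y xI yI xy; exact: hm.
      + by [].
Qed.
End Piece.

Lemma open_itv_shape (R : realType) (J : set R) : open J -> is_interval J -> J !=set0 -> bounded_set J ->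
  exists a b, a < b /\ J = `]a, b[%classic.
Proof.
move=> oJ iJ [c Jc] [M [_ bJ]].
have JM x : J x -> `|x| <= M + 1 by move=> Jx; apply: (bJ (M+1)) => //; rewrite ltrDl.
have J0 : J !=set0 by exists c.
have ubJ : has_ubound J by exists (M+1) => x /JM; have := ler_norm x; lra.
have lbJ : has_lbound J by exists (- (M+1)) => x /JM; have := ler_norm (- x); rewrite normrN; lra.
have gt x : J x -> exists2 y, J y & x < y.
  move=> Jx; have /nbhs_ballP[e /= e0 eJ] := open_nbhs_nbhs (conj oJ Jx).
  exists (x + e / 2); last lra.
  by apply: eJ; rewrite /ball/= opprD addNKr normrN gtr0_norm; lra.
have lt x : J x -> exists2 y, J y & y < x.
  move=> Jx; have /nbhs_ballP[e /= e0 eJ] := open_nbhs_nbhs (conj oJ Jx).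
  exists (x - e / 2); last lra.
  by apply: eJ; rewrite /ball/= opprB addrC subrK gtr0_norm; lra.
have JE : J = `]inf J, sup J[%classic.
  apply/seteqP; split => x /=; rewrite in_itv/=.
    move=> Jx; have [y Jy xy] := gt _ Jx; have [z Jz zx] := lt _ Jx.
    apply/andP; split; first by apply: le_lt_trans zx; exact: ge_inf.
    by apply: lt_le_trans xy _; exact: ub_le_sup.
  move=> /andP[/(inf_lt J0)[y Jy yx] /(sup_gt J0)[z Jz xz]].
  by apply: (iJ _ _ Jy Jz); rewrite !ltW.
exists (inf J), (sup J); split => //.
by move: Jc; rewrite {1}JE /= in_itv/= => /andP[]; exact: lt_trans.
Qed.

(** The indicator of [s x <> s t] is continuous and takes only the values 0 and 1; if it took both,
    the intermediate value theorem would give it the value 1/2. *)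
Lemma locally_constant_interval (R : realType) (J : set R) (s : R -> R) : is_interval J ->
  (forall t, J t -> \forall x \near t, s x = s t) -> forall t u, J t -> J u -> s t = s u.
Proof.
move=> iJ ls.
have H t u : J t -> J u -> t < u -> s t = s u.
  move=> Jt Ju tu; apply: contrapT => tus.
  pose f x : R := if s x == s t then 0 else 1.
  have tuJ x : t <= x <= u -> J x by exact: (iJ _ _ Jt Ju).
  have cf : {within `[t, u], continuous f}.
    apply: continuous_in_subspaceT => x; rewrite inE/= in_itv/= => /tuJ Jx.
    apply: cvg_near_cst.
    by have := ls _ Jx; apply: filterS => y; rewrite /f => ->.
  have ft : f t = 0 by rewrite /f eqxx.
  have fu : f u = 1 by rewrite /f ifF//; apply/eqP => /esym.
  have [] := @IVT R f t u (1/2) (ltW tu) cf.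
    by rewrite ft fu min_l// max_r//; lra.
  by move=> x _; rewrite /f; case: ifP => _; lra.
by move=> t u Jt Ju; case: (ltgtP t u) => [|/H ut|->//]; [exact: H|by rewrite ut].
Qed.

(** * The one-dimensional Sard lemma and the monotone pieces of an arc *)

Section Arc.
Variable R : realType.
Notation mu := (@lebesgue_measure R).
Variables (h dh : R -> R).
Hypothesis ch : {within `[0, 1], continuous h}.
Hypothesis cdh : {within `[0, 1], continuous dh}.
Hypothesis hdh : forall t : R, 0 < t < 1 -> is_derive t 1 h (dh t).

Lemma open_derivative_preimage (P : set R) : open P -> open [set t : R | 0 < t < 1 /\ P (dh t)].
Proof.
move=> oP.
have cdh' : {in (`]0, 1[%classic : set R), continuous dh}.
  have [+ _ _] := (continuous_within_itvP _ ltr01).1 cdh.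
  by move=> H t /set_mem; exact: H.
have -> : [set t : R | 0 < t < 1 /\ P (dh t)] = `]0, 1[%classic `&` dh @^-1` P.
  by apply/seteqP; split => t /=; rewrite in_itv/=.
have /continuous_inP := cdh'.
by apply => //; exact: interval_open.
Qed.

Lemma arc_mvt (J : set R) : is_interval J -> J `<=` `]0, 1[ -> forall s t, J s -> J t -> 
  exists2 c, J c & h t - h s = dh c * (t - s).
Proof.
move=> iJ J01.
have H s t : J s -> J t -> s < t -> exists2 c, J c & h t - h s = dh c * (t - s).
  move=> Js Jt st.
  have := J01 _ Js; have := J01 _ Jt; rewrite /= !in_itv/= => /andP[? ?] /andP[? ?].
  have [] := @MVT R h dh s t st.
  - by move=> x; rewrite in_itv/= => /andP[sx xt]; apply: hdh; lra.
  - by apply: continuous_subspaceW ch => x /=; rewrite !in_itv/=; lra.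
  - move=> c; rewrite in_itv/= => /andP[sc ct] ->; exists c => //.
    by apply: (iJ _ _ Js Jt); lra.
move=> s t Js Jt; case: (ltgtP s t) => [|ts|<-]; first exact: H.
  have [c Jc e] := H _ _ Jt Js ts; exists c => //; lra.
by exists s => //; rewrite !subrr mulr0.
Qed.

Lemma lebesgue_measure_interval_ge (J : set R) s t : open J -> is_interval J -> J s -> J t -> (`|s - t|%:E <= mu J)%E.
Proof.
move=> oJ iJ.
have mJ : measurable J by exact: open_measurable.
have H s' t' : J s' -> J t' -> s' <= t' -> (`|s' - t'|%:E <= mu J)%E.
  move=> Js Jt st.
  have : (mu `[s', t']%classic <= mu J)%E.
    by apply: le_measure; rewrite ?inE// => x /=; rewrite in_itv/=; exact: (iJ _ _ Js Jt).
  apply: le_trans; rewrite lebesgue_measure_itv/= lte_fin.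
  move: st; rewrite le_eqVlt => /predU1P[->|st]; first by rewrite ltxx subrr normr0.
  by rewrite st -EFinB lee_fin distrC gtr0_norm ?subr_gt0.
by move=> Js Jt; case: (leP s t) => [|/ltW] st; [|rewrite distrC]; exact: H.
Qed.

(* The set where |dh| < e is a disjoint union of intervals I, and h(I) has length at most 2 e |I|. *)
Lemma sard_eps (e : R) : 0 < e -> exists2 B : set R, measurable B &
  h @` [set t : R | 0 < t < 1 /\ dh t = 0] `<=` B /\ (mu B <= (2 * e)%:E)%E.
Proof.
move=> e0.
have oV : open [set t : R | 0 < t < 1 /\ ball 0 e (dh t)] by apply: open_derivative_preimage; exact: ball_open.
set V := [set t | _] in oV.
pose I := open_disjoint_itv oV.
have IV k : I k `<=` V by move=> x Ix; rewrite (open_disjoint_itv_bigcup oV); exists k.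
have I01 k : I k `<=` `]0, 1[%classic by move=> x /IV[].
have oI k : open (I k) by exact: open_disjoint_itv_open.
have iI k : is_interval (I k) by exact: open_disjoint_itv_is_interval.
have mI k : measurable (I k) by exact: open_measurable.
have muI k : (mu (I k) < +oo)%E.
  apply: (@le_lt_trans _ _ (mu `]0, 1[%classic)).
    by apply: le_measure; rewrite ?inE; [exact: mI|exact: measurable_itv|exact: I01].
  by rewrite lebesgue_measure_itv/= lte_fin ltr01 -EFinB ltry.
pose r k := fine (mu (I k)).
have rE k : (r k)%:E = mu (I k) by rewrite fineK// ge0_fin_numE.
have r0 k : 0 <= r k by rewrite fine_ge0.
pose C k : set R := [set y | exists2 c, I k c & `|y - h c| <= e * r k].
pose c k := xget 0 (I k).
(* Some of the intervals [I k] may be empty: they get an empty [B k], so the default [0] in [c k] is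
   harmless. Otherwise the mean value theorem with [|dh| < e] puts the image of [I k] within
   [e * r k] of [h (c k)]. *)
pose B k : set R := if pselect (I k !=set0) then `[h (c k) - e * r k, h (c k) + e * r k]%classic else set0.
have mB k : measurable (B k).
  by rewrite /B; case: (pselect (I k !=set0)) => ?; [exact: measurable_itv|exact: measurable0].
exists (\bigcup_k B k); first exact: bigcup_measurable.
split.
  move=> _ [t [t01 dt0] <-].
  have : V t by split => //; rewrite dt0; exact: ballxx.
  rewrite (open_disjoint_itv_bigcup oV) => -[k _ It]; exists k => //.
  rewrite /B; case: (pselect (I k !=set0)) => [I0|[]]; last by exists t.
  have Ic : I k (c k) by rewrite /c; case: xgetP => [x -> //|/(_ t)].
  have [d Id hd] := arc_mvt (@iI k) (@I01 k) Ic It.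
  have : `|h t - h (c k)| <= e * r k.
    rewrite hd normrM; apply: ler_pM => //.
      by have [_] := IV _ _ Id; rewrite /ball/= sub0r normrN => /ltW.
    by rewrite -lee_fin rE; exact: lebesgue_measure_interval_ge.
  by rewrite ler_norml /= in_itv/=; lra.
apply: (@le_trans _ _ (\sum_(k <oo) mu (B k))%E).
  by apply: measure_sigma_subadditive => //; apply: bigcup_measurable => k _; exact: mB.
apply: (@le_trans _ _ (\sum_(k <oo) ((2 * e)%:E * mu (I k)))%E).
  apply: lee_nneseries => // k _.
  rewrite /B; case: (pselect (I k !=set0)) => [I0|nI]; last by rewrite measure0 mule_ge0// lee_fin; lra.
  rewrite lebesgue_measure_itv/= lte_fin -rE -EFinM.
  case: ifP => _; last by rewrite lee_fin mulr_ge0//; lra.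
  by rewrite -EFinB lee_fin; lra.
rewrite nneseriesZl//.
rewrite -[leRHS]mule1; apply: lee_wpmul2l; first by rewrite lee_fin; lra.
have -> : (\sum_(k <oo) mu (I k) = mu (\bigcup_k I k))%E.
  rewrite measure_bigcup; [|by move=> i _; exact: mI|exact: open_disjoint_itv_trivIset].
  by apply: eq_eseriesl => i; rewrite in_setT.
apply: (@le_trans _ _ (mu `]0, 1[%classic)).
  by apply: le_measure; rewrite ?inE; [by apply: bigcup_measurable => k _; exact: mI|
    exact: measurable_itv|move=> x [k _ /I01]].
by rewrite lebesgue_measure_itv/= lte_fin ltr01 -EFinB lee_fin subr0.
Qed.

Lemma sard : mu.-negligible (h @` [set t : R | 0 < t < 1 /\ dh t = 0]).
Proof.
have e0 n : 0 < n.+1%:R^-1 :> R by [].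
pose B n := projT1 (cid2 (sard_eps (e0 n))).
have mB n : measurable (B n) by rewrite /B; case: cid2.
have sB n : h @` [set t : R | 0 < t < 1 /\ dh t = 0] `<=` B n /\ (mu (B n) <= (2 * n.+1%:R^-1)%:E)%E.
  by rewrite /B; case: cid2.
exists (\bigcap_n B n); split.
- by apply: bigcap_measurable => [|k _]; [exists 0%N|exact: mB].
- apply/eqP; rewrite eq_le measure_ge0 andbT.
  apply/lee_addgt0Pr => e egt0; rewrite add0e.
  (* This makes [2 / (n + 1) <= e], [sard_eps] having been applied with [1 / (n + 1)]. *)
  pose n := Num.truncn (2 / e).
  apply: (@le_trans _ _ (mu (B n))).
    by apply: le_measure; rewrite ?inE; [by apply: bigcap_measurable => [|k _]; [exists 0%N|exact: mB]|
      exact: mB|move=> x; exact].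
  apply: (le_trans (sB n).2); rewrite lee_fin.
  rewrite ler_pdivrMr// mulrC -ler_pdivrMr//.
  by apply: ltW; rewrite /n; apply: truncnS_gt.
- by move=> x hx n _; exact: (sB n).1.
Qed.
End Arc.

Section ArcPieces.
Variable R : realType.
Notation mu := (@lebesgue_measure R).
Variables (h dh g s : R -> R).
Hypothesis ch : {within `[0, 1], continuous h}.
Hypothesis cdh : {within `[0, 1], continuous dh}.
Hypothesis hdh : forall t : R, 0 < t < 1 -> is_derive t 1 h (dh t).
Hypothesis cg : {within `[0, 1], continuous g}.
Hypothesis s1 : forall t, `|s t| <= 1.
Hypothesis ls : forall t, 0 < t < 1 -> dh t != 0 -> \forall x \near t, s x = s t.

Let U := [set t : R | 0 < t < 1 /\ dh t != 0].

(** On an interval inside [U] the locally constant [s] is constant, so [s * g] is continuous there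
    and can be pushed forward. The second function, the push-forward of 1, is the indicator of the
    image of [J], kept for domination. The pair lets one use of [choice] produce both sequences. *)
Lemma open_piece (J : set R) : open J -> is_interval J -> J `<=` U ->
  (forall t u, J t -> J u -> h t = h u -> t = u) /\
  exists GC : (R -> R) * (R -> R), [/\
    mu.-integrable setT (EFin \o GC.1) /\ mu.-integrable setT (EFin \o GC.2),
    forall t, J t -> GC.1 (h t) = s t * g t /\ GC.2 (h t) = 1,
    forall y, (forall t, J t -> h t <> y) -> GC.1 y = 0 /\ GC.2 y = 0,
    \int[mu]_y GC.1 y = \int[mu]_(t in J) (s t * g t * `|dh t|) /\
    \int[mu]_y GC.2 y = \int[mu]_(t in J) `|dh t| &
    measurable_fun J (fun t => s t * g t * `|dh t|)].
Proof.
move=> oJ iJ JU.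
have [J0|/set0P/negP/negPn/eqP J0] := pselect (J !=set0); last first.
  rewrite J0; split=> //; exists (fun=> 0, fun=> 0); split => //=.
  - by split; exact: integrable0.
  - by rewrite !Rintegral_set0 /Rintegral !integral0.
  - exact: measurable_fun_set0.
have bJ : bounded_set J.
  exists 1; split; first exact: num_real.
  by move=> x x1 t /= /JU[t01 _]; rewrite gtr0_norm; lra.
have [a [b [ab JE]]] := open_itv_shape oJ iJ J0 bJ.
have Jab t : a < t < b -> 0 < t < 1 /\ dh t != 0 by move=> tab; apply: JU; rewrite JE/= in_itv.
have a0 : 0 <= a.
  (* If [a < 0], this point of []a, b[] is negative. *)
  rewrite leNgt; apply/negP => a0; have [] := Jab (Num.min ((a + b) / 2) (a / 2)).
    by rewrite lt_min gt_min; lra.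
  by rewrite lt_min; lra.
have b1 : b <= 1.
  rewrite leNgt; apply/negP => b1; have [] := Jab (Num.max ((a + b) / 2) ((b + 1) / 2)).
    by rewrite gt_max lt_max; lra.
  by rewrite gt_max; lra.
have sub01 : `[a, b]%classic `<=` `[0, 1]%classic.
  by move=> x /=; rewrite !in_itv/=; lra.
have chab := continuous_subspaceW sub01 ch.
have cdhab := continuous_subspaceW sub01 cdh.
have cgab := continuous_subspaceW sub01 cg.
have hdhab t : a < t < b -> is_derive t 1 h (dh t) by move=> /Jab[/hdh].
have dh0ab t : a < t < b -> dh t != 0 by move=> /Jab[].
have [t0 Jt0] := J0.
have sE t : J t -> s t = s t0.
  move=> Jt; apply: (locally_constant_interval iJ) => // u /JU[u01 du0]; exact: ls.
have oocc : `]a, b[%classic `<=` `[a, b]%classic by exact: subset_itv_oo_cc.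
split.
  move=> t u Jt Ju; apply: (piece_inj chab hdhab dh0ab).
    by apply: oocc; rewrite -JE.
  by apply: oocc; rewrite -JE.
have csg : {within `[a, b], continuous (fun t => s t0 * g t)}.
  by move=> x; apply: continuousM; [exact: cvg_cst|exact: cgab].
have c1 : {within `[a, b], continuous (fun=> 1 : R)} by move=> x; exact: cvg_cst.
have [G [iG Gh G0 GI]] := piece_push ab chab cdhab hdhab dh0ab csg.
have [C [iC Ch C0 CI]] := piece_push ab chab cdhab hdhab dh0ab c1.
have abJ t : J t = (a < t < b) :> Prop by rewrite JE/= in_itv.
exists (G, C); split => /=.
- by [].
- by move=> t Jt; rewrite sE//; move: Jt; rewrite abJ => tab; rewrite Gh// Ch.
- move=> y Jy; split; [apply: G0|apply: C0] => t; rewrite -abJ; exact: Jy.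
- rewrite GI CI JE; split; apply: eq_Rintegral => t; rewrite -JE inE => Jt.
    by rewrite sE.
  by rewrite mul1r.
- apply: (@eq_measurable_fun _ _ _ _ _ (fun t => s t0 * g t * `|dh t|)).
    by move=> t; rewrite inE => Jt; rewrite sE.
  rewrite JE; apply: measurable_funM.
    by apply: measurable_funS (subspace_continuous_measurable_fun _ csg).
  apply: measurableT_comp => //.
  by apply: measurable_funS (subspace_continuous_measurable_fun _ cdhab).
Qed.

(** The components of [U] can be infinitely many, so the sums over pieces need a common bound [N]
    for the later limit. [N] has extended real values because a height may have infinitely many
    preimages. *)
Lemma arc_pieces : exists J : nat -> set R, exists G : nat -> R -> R, exists N : R -> \bar R,
  [/\ [/\ trivIset setT J, U = \bigcup_k J k & forall k, open (J k)],
      (forall k t u, J k t -> J k u -> h t = h u -> t = u),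
      (forall k, mu.-integrable setT (EFin \o G k)) /\
      (forall k t, J k t -> G k (h t) = s t * g t) /\
      (forall k y, (forall t, J k t -> h t <> y) -> G k y = 0),
      mu.-integrable setT N /\ (forall n y, (`|\sum_(0 <= k < n) G k y|%:E <= N y)%E) &
      (\sum_(0 <= k < n) \int[mu]_y G k y) @[n --> \oo] -->
         \int[mu]_(t in `]0, 1[) (s t * g t * `|dh t|) /\
      measurable_fun (`]0, 1[%classic : set R) (fun t => s t * g t * `|dh t|)].
Proof.
have oU : open U by apply: (open_derivative_preimage cdh (P := [set x | x != 0])); exact: open_neq.
pose J := open_disjoint_itv oU.
have UE : U = \bigcup_k J k := open_disjoint_itv_bigcup oU.
have JU k : J k `<=` U by move=> x Jx; rewrite UE; exists k.
have oJ k : open (J k) by exact: open_disjoint_itv_open.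
have iJ k : is_interval (J k) by exact: open_disjoint_itv_is_interval.
have mJ k : measurable (J k) by exact: open_measurable.
have tJ : trivIset setT J by exact: open_disjoint_itv_trivIset.
have [GC GCP] := choice (fun k => (open_piece (oJ k) (@iJ k) (@JU k)).2).
have Jinj k := (open_piece (oJ k) (@iJ k) (@JU k)).1.
pose G k := (GC k).1; pose C k := (GC k).2.
have [M M0 gM] := compact_within_bounded (@segment_compact R 0 1) cg.
have [D D0 dD] := compact_within_bounded (@segment_compact R 0 1) cdh.
have U01 t : U t -> `[0, 1]%classic t by move=> [? _]; rewrite /= in_itv/=; lra.
have C01 k y : 0 <= C k y <= 1 /\ `|G k y| <= M * C k y.
  have [[t [Jt <-]]|nt] := pselect (exists t, J k t /\ h t = y).
    have [_ /(_ t Jt)[E1 E2] _ _ _] := GCP k; rewrite /G /C E1 E2.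
    split; first lra.
    rewrite mulr1 normrM -[leRHS]mul1r; apply: ler_pM => //; apply: gM; apply: U01; exact: (JU k).
  have [_ _ H _ _] := GCP k; have [|E1 E2] := H y; first by move=> t Jt hty; apply: nt; exists t.
  by rewrite /G /C E1 E2 normr0; lra.
have mU : measurable U by exact: open_measurable.
have muU : (mu U < +oo)%E.
  apply: (@le_lt_trans _ _ (mu `[0, 1]%classic)).
    by apply: le_measure; rewrite ?inE; [exact: mU|exact: measurable_itv|exact: U01].
  by rewrite lebesgue_measure_itv/= lte_fin ltr01 -EFinB ltry.
have mdh : measurable_fun U (fun t => `|dh t|).
  apply: measurableT_comp => //.
  by apply: measurable_funS (subspace_continuous_measurable_fun _ cdh).
have mf : measurable_fun U (fun t => s t * g t * `|dh t|).
  by rewrite UE; apply/measurable_fun_bigcup => // k; have [] := GCP k.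
have idh : mu.-integrable U (EFin \o (fun t => `|dh t|)).
  by apply: (integrable_le_cst (M := D)) => // x /U01 /dD; rewrite normr_id.
have if_ : mu.-integrable U (EFin \o (fun t => s t * g t * `|dh t|)).
  apply: (integrable_le_cst (M := M * D)) => // x /U01 xU.
  rewrite normrM normr_id; apply: ler_pM => //; last exact: dD.
  rewrite normrM -[leRHS]mul1r; apply: ler_pM => //; exact: gM.
(* C k is the indicator of h(J k); by the change of variables the sum of the C k, which
   counts preimages, has integral the total variation of h. *)
pose N y := (M%:E * \sum_(k <oo) (C k y)%:E)%E.
have mC k : measurable_fun setT (EFin \o C k) by have [[_ /measurable_int]] := GCP k.
have C0 k y : (0 <= (C k y)%:E)%E by rewrite lee_fin; have [/andP[]] := C01 k y.
exists J, G, N; split => //.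
- split; first by move=> k; have [[]] := GCP k.
  split => k.
    by move=> t Jt; have [_ /(_ t Jt)[]] := GCP k.
  by move=> y ny; have [_ _ /(_ y ny)[]] := GCP k.
- split.
    apply: integrableZl => //.
    apply/integrableP; split.
      by apply: ge0_emeasurable_sum => [k x _ _|k _]; [exact: C0|exact: mC].
    under eq_integral => y _ do rewrite gee0_abs ?nneseries_ge0//.
    rewrite integral_nneseries//.
    apply: (@le_lt_trans _ _ (\sum_(k <oo) \int[mu]_(t in J k) `|dh t|%:E)%E).
      apply: lee_nneseries => [k _ _|k _]; first by apply: integral_ge0 => y _; exact: C0.
      have [[_ iC] _ _ [_ CE] _] := GCP k.
      rewrite -(fineK (integrable_fin_num _ iC))//.
      rewrite -[leRHS]fineK//; first by rewrite lee_fin -/(Rintegral _ _ _) CE.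
      apply: integrable_fin_num; first exact: mJ.
      by apply: (@integrableS _ _ _ mu U); [exact: mU|exact: mJ|exact: JU|exact: idh].
    have <- := @ge0_integral_bigcup _ _ _ mu J (fun t => `|dh t|%:E) mJ; last 3 first.
    + by rewrite -UE; apply/measurable_EFinP.
    + by move=> t _; rewrite lee_fin.
    + exact: tJ.
    rewrite -UE; have /integrableP[_] := idh.
    apply: le_lt_trans; rewrite le_eqVlt; apply/orP; left; apply/eqP.
    by apply: eq_integral => t _; rewrite /= normr_id.
  move=> n y; rewrite /N.
  apply: (@le_trans _ _ (M%:E * (\sum_(0 <= k < n) (C k y))%:E)%E).
    rewrite -EFinM lee_fin mulr_sumr; apply: le_trans (ler_norm_sum _ _ _) _.
    by apply: ler_sum => k _; have [] := C01 k y.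
  apply: lee_wpmul2l; first by rewrite lee_fin ltW.
  by rewrite -sumEFin; apply: nneseries_lim_ge.
(* Off [U] the factor [|dh|] vanishes, so the values of [s] there influence neither measurability
   nor the integral. *)
- have fE t : t \in `]0, 1[ -> s t * g t * `|dh t| = ((fun t => s t * g t * `|dh t|) \_ U) t.
    rewrite in_itv/= patchE => t01; case: ifPn => // /negP tU.
    have [->|dt0] := eqVneq (dh t) 0; first by rewrite normr0 mulr0.
    by exfalso; apply: tU; rewrite inE.
  split; last first.
    apply: (@eq_measurable_fun _ _ _ _ _ ((fun t => s t * g t * `|dh t|) \_ U)).
      by move=> t; rewrite inE/= => /fE.
    by apply/measurable_restrict => //; apply: measurable_funS mf => // t [].
  have := @Rintegral_bigcup_cvg _ _ _ mu J (fun t => s t * g t * `|dh t|) tJ mJ.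
  rewrite -UE => /(_ if_).
  have -> : \int[mu]_(x in U) (s x * g x * `|dh x|) = \int[mu]_(t in `]0, 1[) (s t * g t * `|dh t|).
    rewrite Rintegral_mkcond [RHS]Rintegral_mkcond.
    congr Rintegral; apply/funext => t; rewrite [RHS]patchE; case: ifPn => [|/negP nt].
      by rewrite inE/= => /fE.
    rewrite patchE ifF//; apply/negbTE/negP; rewrite inE => -[t01 _].
    by apply: nt; rewrite inE/= in_itv.
  by under eq_fun do under eq_bigr => k _ do [have [_ _ _ [<- _] _] := GCP k].
Qed.
End ArcPieces.

(** * Geometry of the boundary *)

Section PairDerive.
Variables (R : realType) (V : normedModType R).

Lemma cvg_fst_pair (T : Type) (F : set_system T) {FF : Filter F} (f : T -> R * R) (l : R * R) :
  f @ F --> l -> (fst \o f) @ F --> l.1.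
Proof.
move=> fl; have : @fst R R @ nbhs l --> l.1 by case: l {fl} => a b; exact: cvg_fst.
exact: cvg_comp fl.
Qed.

Lemma cvg_snd_pair (T : Type) (F : set_system T) {FF : Filter F} (f : T -> R * R) (l : R * R) :
  f @ F --> l -> (snd \o f) @ F --> l.2.
Proof.
move=> fl; have : @snd R R @ nbhs l --> l.2 by case: l {fl} => a b; exact: cvg_snd.
exact: cvg_comp fl.
Qed.

Lemma is_derive_fst (f : V -> R * R) (x v : V) df :
  is_derive x v f df -> is_derive x v (fst \o f) df.1.
Proof.
move=> [dfx dfE]; have /cvg_fst_pair : (fun h => h^-1 *: ((f \o shift x) (h *: v) - f x)) @ 0^' --> df.
  by rewrite -dfE; exact: dfx.
by move=> H; split; [exact: cvgP H|exact: (cvg_lim _ H)].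
Qed.

Lemma is_derive_snd (f : V -> R * R) (x v : V) df :
  is_derive x v f df -> is_derive x v (snd \o f) df.2.
Proof.
move=> [dfx dfE]; have /cvg_snd_pair : (fun h => h^-1 *: ((f \o shift x) (h *: v) - f x)) @ 0^' --> df.
  by rewrite -dfE; exact: dfx.
by move=> H; split; [exact: cvgP H|exact: (cvg_lim _ H)].
Qed.
End PairDerive.

Lemma within_fst (R : realType) (T : topologicalType) (A : set T) (f : T -> R * R) :
  {within A, continuous f} -> {within A, continuous (fun t => (f t).1)}.
Proof. by move=> cf x; apply: cvg_fst_pair; exact: cf. Qed.

Lemma within_snd (R : realType) (T : topologicalType) (A : set T) (f : T -> R * R) :
  {within A, continuous f} -> {within A, continuous (fun t => (f t).2)}.
Proof. by move=> cf x; apply: cvg_snd_pair; exact: cf. Qed.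

Lemma closure_itv01 (R : realType) : closure (`]0, 1[%classic : set R) = `[0, 1]%classic.
Proof.
apply/seteqP; split; first exact: itv_closure.
move=> x /=; rewrite in_itv/= => x01 B /nbhs_ballP[e /= e0 eB].
(* [x] is moved towards the centre [1/2], by a fraction at most [1/2] and small enough to stay in
   the ball. *)
pose y : R := x + (1/2 - x) * Num.min (e / 2) (1/2).
have m0 : 0 < Num.min (e/2) (1/2) by rewrite lt_min; lra.
have me : Num.min (e/2) (1/2) <= e/2 by rewrite ge_min lexx.
have m1 : Num.min (e/2) (1/2) <= 1/2 by rewrite ge_min lexx orbT.
exists y; split; first by rewrite /= in_itv/= /y; nra.
apply: eB; rewrite /ball/= /y opprD addNKr normrN normrM (gtr0_norm m0).
have : `|1/2 - x| <= 1/2 by rewrite ler_norml; lra.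
have := normr_ge0 (1/2-x); nra.
Qed.

Lemma near_linear_approximation (R : realType) (f : R -> R) (t a e : R) : 0 < e -> is_derive t 1 f a ->
  \forall s \near t, `|f s - f t - a * (s - t)| <= e * `|s - t|.
Proof.
move=> e0 [df dE].
have H : (fun h => h^-1 *: ((f \o shift t) (h *: 1) - f t)) @ 0^' --> a by rewrite -dE; exact: df.
move/cvgrPdist_le : H => /(_ e e0) [d /= d0 Hd].
exists d => //= s sd.
have [->|st] := eqVneq s t; first by rewrite !subrr mulr0 subrr normr0 mulr0.
have := Hd (s - t); rewrite /= sub0r normrN distrC => /(_ sd).
rewrite subr_eq0 => /(_ st); rewrite /shift /= scaler1 subrK.
have st0 : s - t != 0 by rewrite subr_eq0.
move=> H; have -> : f s - f t - a * (s - t) = - (a - (s - t)^-1 * (f s - f t)) * (s - t) by field.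
by rewrite normrM normrN; apply: ler_pM => //; rewrite distrC.
Qed.

Section Boundary.
Variable R : realType.
Variables (Om : set (R * R)) (m : nat) (gam : 'I_m -> R -> R * R) (n : R * R -> R * R).
Hypothesis bnd : piecewise_C1_boundary Om gam n.
Hypothesis oOm : open Om.

Lemma arc_continuous i : {within `[0, 1], continuous (gam i)}.
Proof. by case: bnd => _ /(_ i)[+ _] _ _ _; rewrite closure_itv01. Qed.

(** At 0 and 1 the arc need not be differentiable; [dX] and [dY] take there the values of the
    continuous extension of the derivative, hence are bounded on the compact [[0, 1]]. *)
Lemma arc_derivatives : exists dX dY : 'I_m -> R -> R, forall i,
  [/\ {within `[0, 1], continuous (dX i)}, {within `[0, 1], continuous (dY i)} &
   forall t : R, 0 < t < 1 -> [/\ is_derive t 1 (fun t => (gam i t).1) (dX i t),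
    is_derive t 1 (fun t => (gam i t).2) (dY i t) & derive1 (gam i) t = (dX i t, dY i t)]].
Proof.
have H i : exists h : R -> R * R, {within `[0, 1], continuous h} /\ 
   forall t : R, 0 < t < 1 -> is_derive t 1 (gam i) (h t).
  case: bnd => _ /(_ i)[_ C] _ _ _.
  have [_ [h ch hE]] := C [:: 1] isT.
  have [d _] := C [::] isT.
  rewrite closure_itv01 in ch.
  exists h; split => // t t01; rewrite hE/= ?in_itv//.
  by apply: derivableP; apply: d => //=; rewrite in_itv.
have [h hP] := choice H.
exists (fun i t => (h i t).1), (fun i t => (h i t).2) => i.
have [ch dh] := hP i; split; [exact: within_fst|exact: within_snd|].
move=> t /dh hd; split.
- exact: (is_derive_fst hd).
- exact: (is_derive_snd hd).
- by rewrite derive1E -surjective_pairing; exact: derive_val.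
Qed.

(** Parameters on another arc, or at distance at least [d] from [t0] on the same arc, form compact
    sets. Their images are closed and miss [gam i t0], because interior points of arcs are simple;
    the common complement is the neighbourhood. *)
Lemma arc_isolated i (t0 d : R) : 0 < t0 < 1 -> 0 < d ->
  \forall z \near gam i t0, forall j t, 0 <= t <= 1 -> gam j t = z -> j = i /\ `|t - t0| < d.
Proof.
move=> t01 d0.
pose K j : set R := `[0, 1]%classic `&` [set t | j != i \/ d <= `|t - t0|].
have cK j : compact (K j).
  apply: subclosed_compact (@segment_compact R 0 1) _; last by move=> x [].
  apply: closedI; first exact: interval_closed.
  have [ji|ji] := boolP (j != i).
    have -> : [set t | true \/ d <= `|t - t0|] = setT by apply/seteqP; split => // x _; left.
    exact: closedT.
  have -> : [set t | false \/ d <= `|t - t0|] = (fun t => `|t - t0|) @^-1` [set x | d <= x].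
    by apply/seteqP; split => x /=; [move=> []|right].
  apply: closed_comp; last exact: closed_ge.
  by move=> x _; apply: cvg_norm; apply: cvgB; [exact: cvg_id|exact: cvg_cst].
have cgK j : closed (gam j @` K j).
  apply: compact_closed; first exact: norm_hausdorff.
  apply: continuous_compact => //; apply: continuous_subspaceW (@arc_continuous j) => x [].
  by [].
have H j : \forall z \near gam i t0, ~ (gam j @` K j) z.
  apply: open_nbhs_nbhs; split; first exact: closed_openC.
  move=> [t [tI tK] gt].
  case: bnd => _ _ _ inj _.
  have tI' : 0 <= t <= 1 by move: tI; rewrite /= in_itv.
  have [ij tt] := inj i j t0 t t01 tI' (esym gt).
  case: tK; first by rewrite ij eqxx.
  by rewrite tt subrr normr0 leNgt d0.
have Hf := filter_forall (nbhs_filter _) H; apply: filterS Hf => z Hz j t tI gz.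
apply: contrapT => nt; apply: (Hz j); exists t => //; split; first by rewrite /= in_itv.
have [ji|ji] := eqVneq j i; last by left.
by right; rewrite leNgt; apply/negP => ?; apply: nt.
Qed.

(** Off its boundary the plane is the disjoint union of the open sets [Om] and [~ closure Om], so
    membership in [Om] is locally constant along the path. *)
Lemma segment_noboundary (z w : R -> R) : continuous z -> continuous w ->
  (forall a : R, 0 <= a <= 1 -> ~ boundary Om (z a, w a)) ->
  (Om (z 0, w 0) -> Om (z 1, w 1)) /\ (~ closure Om (z 0, w 0) -> ~ closure Om (z 1, w 1)).
Proof.
move=> cz cw nb.
pose f (a : R) : R := if `[< Om (z a, w a) >] then 0 else 1.
have fO (a : R) : f a = 0 -> Om (z a, w a).
  by rewrite /f; case: asboolP => // _ /eqP; rewrite oner_eq0.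
have nbO (a : R) : 0 <= a <= 1 -> ~ Om (z a, w a) -> ~ closure Om (z a, w a).
  by move=> /nb H nO cO; apply: H; split => //; rewrite ((interior_id _).1 oOm).
have cf (a : R) : `[0, 1]%classic a -> \forall b \near a, f b = f a.
  rewrite /= in_itv/= => a01.
  have czw : (fun b => (z b, w b)) @ a --> (z a, w a) by exact: (cvg_pair (cz a) (cw a)).
  rewrite [f a]/f; case: asboolP => Oa.
    have : \forall b \near a, Om (z b, w b) := czw _ (open_nbhs_nbhs (conj oOm Oa)).
    by apply: filterS => b /= Ob; rewrite /f asboolT.
  have oC : open (~` closure Om) by exact/closed_openC/closed_closure.
  have : \forall b \near a, ~ closure Om (z b, w b) := czw _ (open_nbhs_nbhs (conj oC (nbO _ a01 Oa))).
  apply: filterS => b /= Ob; rewrite /f asboolF//.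
  by move=> /subset_closure.
have i01 : is_interval (`[0, 1]%classic : set R) by exact: interval_is_interval.
have f01 : f 0 = f 1.
  by apply: (locally_constant_interval i01 cf); rewrite /= in_itv/= ?lexx ?ler01.
split.
  by move=> O0; apply: fO; rewrite -f01 /f asboolT.
move=> nO0; apply: nbO; first lra.
move=> O1; apply: nO0; apply: subset_closure; apply: fO; by rewrite f01 /f asboolT.
Qed.
End Boundary.

Section Dot.
Variable R : realType.
Implicit Types x y : R * R.

Lemma dotE x y : dot x y = x.1 * y.1 + x.2 * y.2.
Proof. by rewrite /dot 2!big_ord_recl big_ord0 addr0. Qed.

Lemma enorm_ge0 x : 0 <= enorm x.
Proof. exact: sqrtr_ge0. Qed.

Lemma enormE2 x : enorm x ^+ 2 = x.1 ^+ 2 + x.2 ^+ 2.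
Proof. by rewrite /enorm dotE -!expr2 sqr_sqrtr ?addr_ge0 ?sqr_ge0. Qed.
End Dot.

Lemma affine_continuous (R : realType) (k l : R) : continuous (fun a : R => k + a * l).
Proof. by move=> a; apply: cvgD; [exact: cvg_cst|apply: cvgM; [exact: cvg_id|exact: cvg_cst]]. Qed.

Lemma near0_right_itv (R : realType) (d : R) (P : set R) : 0 < d ->
  (forall r, 0 < r < d -> P r) -> \forall r \near 0^'+, P r.
Proof.
move=> d0 H; near=> r; apply: H; apply/andP; split.
  by near: r; exact: nbhs_right_gt.
by near: r; exact: nbhs_right_lt.
Unshelve. all: by end_near. Qed.

Lemma near0_right_wit (R : realType) (P : set R) : (\forall r \near 0^'+, P r) ->
  exists2 d, 0 < d & forall r, 0 < r < d -> P r.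
Proof.
move=> [d /= d0 H]; exists d => // r /andP[r0 rd]; apply: H => //=.
by rewrite sub0r normrN gtr0_norm.
Qed.

Lemma convex_comb_bound (R : realDomainType) (x u v B : R) : 0 <= x <= 1 -> `|u| <= B -> `|v| <= B ->
  `|(1 - x) * u + x * v| <= B.
Proof.
move=> /andP[x0 x1] uB vB; apply: le_trans (ler_normD _ _) _.
have x1' : 0 <= 1 - x by rewrite subr_ge0.
rewrite !normrM (ger0_norm x0) (ger0_norm x1').
have Q1 : 0 <= (1 - x) * (B - `|u|) by rewrite mulr_ge0 ?subr_ge0.
have Q2 : 0 <= x * (B - `|v|) by rewrite mulr_ge0 ?subr_ge0.
lra.
Qed.

(** The arithmetic of the cone argument. [D] is the parameter distance of a supposed boundary point
    on the segment. Its normal offset is at least [r * c] yet at most [e * D], while the tangential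
    estimate gives [A * D <= 2 * r * C]; with [e = c * A / (4 * C)] this leaves
    [r * c <= r * c / 2]. *)
Lemma cone_absurd (R : realFieldType) (x r A C D c e W : R) :
  0 <= x <= 1 -> 0 < r -> 0 < C -> 0 < c -> c <= 1 -> c <= W -> e * (4 * C) = c * A ->
  r * `|(1 - x) * 1 + x * W| <= e * D -> A * D <= r * C + A / 2 * D -> False.
Proof.
move=> /andP[x0 x1] r0 C0 c0 c1 cW eE h1 h2.
have Q1 : 0 <= (1 - x) * (1 - c) by rewrite mulr_ge0 ?subr_ge0.
have Q2 : 0 <= x * (W - c) by rewrite mulr_ge0 ?subr_ge0.
have k1 : c <= `|(1 - x) * 1 + x * W| by apply: le_trans (ler_norm _); lra.
have h4 : r * c <= e * D by apply: le_trans h1; rewrite ler_pM2l.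
have h5 : r * c * (4 * C) <= c * (A * D).
  have -> : c * (A * D) = e * D * (4 * C) by rewrite mulrA -eE; ring.
  by rewrite ler_pM2r// mulr_gt0.
have h6 : A * D <= 2 * (r * C) by lra.
have h7 : c * (A * D) <= c * (2 * (r * C)) by rewrite ler_pM2l.
have : 0 < r * c * C by rewrite !mulr_gt0.
lra.
Qed.

(** * The side of the domain along an arc *)

Section Sides.
Variable R : realType.
Variables (Om : set (R * R)) (m : nat) (gam : 'I_m -> R -> R * R) (n : R * R -> R * R).
Variables (dX dY : 'I_m -> R -> R).
Hypothesis bnd : piecewise_C1_boundary Om gam n.
Hypothesis oOm : open Om.
Hypothesis arcD : forall i,
  [/\ {within `[0, 1], continuous (dX i)}, {within `[0, 1], continuous (dY i)} &
   forall t : R, 0 < t < 1 -> [/\ is_derive t 1 (fun t => (gam i t).1) (dX i t),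
    is_derive t 1 (fun t => (gam i t).2) (dY i t) & derive1 (gam i) t = (dX i t, dY i t)]].

Lemma normal_coords i (t : R) : 0 < t < 1 -> let p := gam i t in
  [/\ (n p).1 ^+ 2 + (n p).2 ^+ 2 = 1, (n p).1 * dX i t + (n p).2 * dY i t = 0,
    0 < dX i t ^+ 2 + dY i t ^+ 2 &
    \forall r \near 0^'+, Om (p.1 - r * (n p).1, p.2 - r * (n p).2) /\
      ~ closure Om (p.1 + r * (n p).1, p.2 + r * (n p).2)].
Proof.
move=> t01 p; have [_ _ /(_ _ t01)[_ _ dE]] := arcD i.
case: bnd => _ _ reg _ /(_ i t t01)[n1 n0 nr]; split.
- by rewrite -enormE2 n1 expr1n.
- by rewrite -n0 dE dotE.
- have := reg i t t01; rewrite dE; apply: contraR; rewrite -leNgt => H.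
  have := sqr_ge0 (dX i t); have := sqr_ge0 (dY i t) => Y0 X0.
  have : dX i t ^+ 2 = 0 by lra.
  have : dY i t ^+ 2 = 0 by lra.
  by move=> /eqP; rewrite sqrf_eq0 => /eqP -> /eqP; rewrite sqrf_eq0 => /eqP ->.
- exact: nr.
Qed.

(* The segments from p -+ r n(p) to p -+ r w avoid the boundary for small r: near p it is
   a single arc tangent to n(p)^perp. *)
Lemma transversal_cone i (t w1 w2 : R) : 0 < t < 1 -> let p := gam i t in
  0 < w1 * (n p).1 + w2 * (n p).2 ->
  \forall r \near 0^'+, Om (p.1 - r * w1, p.2 - r * w2) /\ ~ closure Om (p.1 + r * w1, p.2 + r * w2).
Proof.
move=> t01 p wn.
have [n1 n0 A0 nr] := normal_coords i t01.
have [_ _ /(_ _ t01)[dXt dYt _]] := arcD i.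
rewrite -/p in n1 n0 A0 nr.
set N1 := (n p).1 in n1 n0 nr wn; set N2 := (n p).2 in n1 n0 nr wn.
set a := dX i t in n0 A0 dXt; set b := dY i t in n0 A0 dYt.
pose A := a ^+ 2 + b ^+ 2; pose C := `|w1 * a + w2 * b| + 1.
have C0 : 0 < C by rewrite ltr_wpDl.
pose c := Num.min 1 (w1 * N1 + w2 * N2).
have c0 : 0 < c by rewrite lt_min ltr01.
have c1 : c <= 1 by rewrite ge_min lexx.
have cw : c <= w1 * N1 + w2 * N2 by rewrite ge_min lexx orbT.
pose e := c * A / (4 * C).
have eE : e * (4 * C) = c * A by rewrite /e; field; rewrite gt_eqF.
have e0 : 0 < e by rewrite divr_gt0// mulr_gt0.
(* [psi] and [chi] follow the arc along the normal and along the tangent [(a, b)]: the first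
   coordinate has zero speed at [t], the second has speed [A]. *)
have psi : is_derive t 1 (fun s => N1 * (gam i s).1 + N2 * (gam i s).2) 0.
  rewrite -n0; apply: is_deriveD; exact: is_deriveZ.
have chi : is_derive t 1 (fun s => a * (gam i s).1 + b * (gam i s).2) A.
  rewrite /A !expr2; apply: is_deriveD; exact: is_deriveZ.
have A20 : 0 < A / 2 by rewrite divr_gt0.
have [d1 /= d10 H1] := near_linear_approximation e0 psi.
have [d2 /= d20 H2] := near_linear_approximation A20 chi.
pose d := Num.min d1 d2.
have d0 : 0 < d by rewrite lt_min d10.
have /nbhs_ballP[eta /= eta0 box] := arc_isolated bnd i t01 d0.
(* A common bound for the coordinates of [n p] and [w]: the segments then lie within [r * B < eta]
   of [p] in the sup norm. *)
pose B := 1 + `|w1| + `|w2|.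
have w1B : `|w1| <= B by rewrite /B addrAC lerDr addr_ge0.
have w2B : `|w2| <= B by rewrite /B lerDr addr_ge0.
have B1 : 1 <= B by rewrite /B -addrA lerDl addr_ge0.
have B0 : 0 < B := lt_le_trans ltr01 B1.
have [d3 d30 nr'] := near0_right_wit nr.
apply: (@near0_right_itv _ (Num.min d3 (eta / B))); first by rewrite lt_min d30 divr_gt0.
move=> r; rewrite lt_min => /andP[r0 /andP[rd3 reta]].
have rB : r * B < eta by rewrite -ltr_pdivlMr.
have sqb (u v : R) : u ^+ 2 + v ^+ 2 = 1 -> `|u| <= B.
  move=> uv; apply: le_trans B1; rewrite -ler_sqr ?nnegrE// expr1n real_normK ?num_real//.
  by rewrite -uv lerDl sqr_ge0.
have N1B := sqb _ _ n1; have N2B : `|N2| <= B by apply: (sqb N2 N1); rewrite addrC.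
(* [sg = 1] treats the inner segment, from [p - r n] to [p - r w], and [sg = -1] the outer one. *)
have free (sg : R) : `|sg| = 1 -> forall x : R, 0 <= x <= 1 ->
    ~ boundary Om (p.1 - sg * r * N1 + x * (sg * r * (N1 - w1)), p.2 - sg * r * N2 + x * (sg * r * (N2 - w2))).
  move=> sg1 x x01 bd.
  have bdE : boundary Om = \bigcup_(i in [set: 'I_m]) (gam i @` `[0, 1]) by case: bnd.
  rewrite bdE in bd; case: bd => j _ [s /=]; rewrite in_itv/= => s01 gs.
  have mixb (u v : R) : `|u| <= B -> `|v| <= B -> `|sg * r * ((1 - x) * u + x * v)| < eta.
    move=> uB vB; rewrite normrM normrM sg1 mul1r (gtr0_norm r0).
    by apply: le_lt_trans rB; rewrite ler_pM2l//; exact: convex_comb_bound.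
  have inb : ball p eta (gam j s).
    rewrite gs; split => /=.
      rewrite /ball/= (_ : _ - _ = sg * r * ((1 - x) * N1 + x * w1)); last by ring.
      exact: mixb.
    rewrite /ball/= (_ : _ - _ = sg * r * ((1 - x) * N2 + x * w2)); last by ring.
    exact: mixb.
  have [ji std] := box _ inb j s s01 erefl.
  subst j.
  have sd1 : `|t - s| < d1 by rewrite distrC; apply: lt_le_trans std _; rewrite ge_min lexx.
  have sd2 : `|t - s| < d2 by rewrite distrC; apply: lt_le_trans std _; rewrite ge_min lexx orbT.
  have h2 : `|- (sg * r * x * (w1 * a + w2 * b)) - A * (s - t)| <= A / 2 * `|s - t|.
    have := H2 s sd2; rewrite -/p gs/=; congr (`|_ - _| <= _).
    transitivity (- (sg * r * x * (w1 * a + w2 * b)) - sg * r * (1 - x) * (N1 * a + N2 * b));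
      last by rewrite n0 mulr0 subr0.
    by clearbody N1 N2 a b; move: (p.1) (p.2) => p1 p2; ring.
  have h1 : r * `|(1 - x) * 1 + x * (w1 * N1 + w2 * N2)| <= e * `|s - t|.
    have := H1 s sd1; rewrite -/p gs/= mul0r subr0; congr (_ <= _).
    have -> : N1 * (p.1 - sg * r * N1 + x * (sg * r * (N1 - w1))) +
      N2 * (p.2 - sg * r * N2 + x * (sg * r * (N2 - w2))) - (N1 * p.1 + N2 * p.2) =
      - (sg * r * ((1 - x) * (N1 ^+ 2 + N2 ^+ 2) + x * (w1 * N1 + w2 * N2))).
      by clearbody N1 N2 a b; move: (p.1) (p.2) => p1 p2; ring.
    by rewrite n1 normrN !normrM sg1 mul1r (gtr0_norm r0).
  apply: (cone_absurd x01 r0 C0 c0 c1 cw eE h1).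
  have -> : A * `|s - t| = `|A * (s - t)| by rewrite normrM gtr0_norm.
  have -> : A * (s - t) =
    - (sg * r * x * (w1 * a + w2 * b)) - (- (sg * r * x * (w1 * a + w2 * b)) - A * (s - t)) by ring.
  apply: le_trans (ler_normB _ _) _; apply: lerD => //.
  move/andP : x01 => [x0 x1].
  rewrite normrN !normrM sg1 mul1r (gtr0_norm r0) -mulrA ler_pM2l// (ger0_norm x0).
  by apply: (@le_trans _ _ `|w1 * a + w2 * b|); [exact: ler_piMl|rewrite /C lerDl].
have [nO nC] := nr' r (introT andP (conj r0 rd3)).
have one : `|1 : R| = 1 by rewrite normr1.
have mone : `|-1 : R| = 1 by rewrite normrN1.
split.
  have [+ _] := segment_noboundary oOm (@affine_continuous _ _ _) (@affine_continuous _ _ _) (free 1 one).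
  rewrite !mul0r !addr0 !mul1r => /(_ nO).
  congr (Om (_, _)); ring.
have [_ +] := segment_noboundary oOm (@affine_continuous _ _ _) (@affine_continuous _ _ _) (free (-1) mone).
rewrite !mul0r !addr0 !mul1r !mulN1r !mulNr !opprK => /(_ nC) H1'.
by move=> H2'; apply: H1'; move: H2'; congr (closure Om (_, _)); ring.
Qed.

Definition sideX (z : R * R) := side [set x | Om (x, z.2)] z.1.

(** [dY <> 0] makes the horizontal direction transversal to the arc, so the cone applies with
    [w = (1, 0)] or [w = (-1, 0)], according to the sign of [n_1]. *)
Lemma side_normal i (t : R) : 0 < t < 1 -> dY i t != 0 -> let p := gam i t in
  (leftin [set x | Om (x, p.2)] p.1 <-> ~ rightin [set x | Om (x, p.2)] p.1) /\
  (n p).1 * enorm (derive1 (gam i) t) = sideX p * `|dY i t|.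
Proof.
move=> t01 dY0 p.
have [n1 n0 A0 _] := normal_coords i t01.
rewrite -/p in n1 n0.
have [_ _ /(_ _ t01)[_ _ dE]] := arcD i.
have cl z : Om z -> closure Om z by exact: subset_closure.
(* By orthogonality [n_1 dX = - n_2 dY], hence [n_1^2 (dX^2 + dY^2) = dY^2], as [n] is a unit
   vector. *)
have nE : `|(n p).1| * enorm (derive1 (gam i) t) = `|dY i t|.
  apply/eqP; rewrite -(@eqrXn2 _ 2)// ?mulr_ge0 ?enorm_ge0//.
  rewrite exprMn enormE2 dE/= -!normrX !ger0_norm ?sqr_ge0//; apply/eqP.
  have E : (n p).1 * dX i t = - ((n p).2 * dY i t) by apply/eqP; rewrite -addr_eq0 n0.
  rewrite -[RHS]mulr1 -n1 mulrDr -exprMn E.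
  by ring.
have n10 : (n p).1 != 0.
  by apply/eqP => E; move: nE; rewrite E normr0 mul0r => /esym/normr0_eq0/eqP; rewrite (negbTE dY0).
rewrite /sideX /side; case: (ltgtP (n p).1 0) n10 => // sn _.
- have := @transversal_cone i t (-1) 0 t01; cbv zeta; rewrite -/p mul0r addr0 mulN1r oppr_gt0 => /(_ sn) H.
  have ri : rightin [set x | Om (x, p.2)] p.1.
    by apply: filterS H => r /= [+ _]; rewrite mulr0 subr0 mulrN1 opprK.
  have nle : ~ leftin [set x | Om (x, p.2)] p.1.
    move=> le; have [d d0 Hd] := near0_right_wit H.
    have [r rd /= /cl] := near0_right_ex le d0; have [_] := Hd r rd.
    by rewrite mulr0 addr0 mulrN1.
  rewrite asboolF// mulN1r -nE ltr0_norm// mulNr opprK; split => //.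
- have := @transversal_cone i t 1 0 t01; cbv zeta; rewrite -/p mul0r addr0 mul1r => /(_ sn) H.
  have le : leftin [set x | Om (x, p.2)] p.1.
    by apply: filterS H => r /= [+ _]; rewrite mulr0 subr0 mulr1.
  have nri : ~ rightin [set x | Om (x, p.2)] p.1.
    move=> ri; have [d d0 Hd] := near0_right_wit H.
    have [r rd /= /cl] := near0_right_ex ri d0; have [_] := Hd r rd.
    by rewrite mulr0 addr0 mulr1.
  by rewrite asboolT// mul1r -nE gtr0_norm.
Qed.
End Sides.

Section SideConst.
Variable R : realType.
Variables (Om : set (R * R)) (m : nat) (gam : 'I_m -> R -> R * R) (n : R * R -> R * R).
Variables (dX dY : 'I_m -> R -> R).
Hypothesis bnd : piecewise_C1_boundary Om gam n.
Hypothesis oOm : open Om.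
Hypothesis arcD : forall i,
  [/\ {within `[0, 1], continuous (dX i)}, {within `[0, 1], continuous (dY i)} &
   forall t : R, 0 < t < 1 -> [/\ is_derive t 1 (fun t => (gam i t).1) (dX i t),
    is_derive t 1 (fun t => (gam i t).2) (dY i t) & derive1 (gam i) t = (dX i t, dY i t)]].

Lemma arc_continuous_at i (t : R) : 0 < t < 1 -> gam i x @[x --> t] --> gam i t.
Proof.
move=> t01; have := @arc_continuous _ _ _ _ _ bnd i.
move/continuous_subspaceW => /(_ `]0, 1[%classic) H.
have {H} : {within `]0, 1[, continuous (gam i)} by apply: H; exact: subset_itv_oo_cc.
rewrite continuous_open_subspace; last exact: interval_open.
by apply; rewrite inE/= in_itv.
Qed.

(* Where dY <> 0 the arc near t0 meets each horizontal line at most once, so the horizontal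
   segment from gam t to a fixed interior point stays in Om. *)
Lemma side_propagate i (t0 e : R) : 0 < t0 < 1 -> dY i t0 != 0 -> `|e| = 1 ->
  (\forall r \near 0^'+, Om ((gam i t0).1 + e * r, (gam i t0).2)) ->
  \forall t \near t0, \forall r \near 0^'+, Om ((gam i t).1 + e * r, (gam i t).2).
Proof.
move=> t01 dY0 e1 H0.
have [_ cdY dg] := arcD i.
have cY : {within `[0, 1], continuous (fun t => (gam i t).2)} := within_snd (@arc_continuous _ _ _ _ _ bnd i).
have hdY (t : R) : 0 < t < 1 -> is_derive t 1 (fun t => (gam i t).2) (dY i t) by move=> /dg[].
have oU : open [set t : R | 0 < t < 1 /\ dY i t != 0].
  by apply: (open_derivative_preimage cdY (P := [set x | x != 0])); exact: open_neq.
have /nbhs_ballP[d /= d0 dU] := open_nbhs_nbhs (conj oU (conj t01 dY0) : open_nbhs t0 _).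
have [eta /= eta0 box] := (nbhs_ballP _ _).1 (arc_isolated bnd i t01 d0).
have Yinj s t : `|s - t0| < d -> `|t - t0| < d -> (gam i s).2 = (gam i t).2 -> s = t.
  pose J := `]t0 - d, t0 + d[%classic : set R.
  have JE x : `|x - t0| < d -> J x by rewrite ltr_distl /J /= in_itv/=.
  have JU : J `<=` [set t : R | 0 < t < 1 /\ dY i t != 0].
    by move=> x; rewrite /J /= in_itv/= -ltr_distl distrC => /dU.
  have J01 : J `<=` `]0, 1[%classic by move=> x /JU[]; rewrite /= in_itv.
  move=> /JE Js /JE Jt Yst.
  have [c /JU[_ dYc]] := arc_mvt cY hdY (@interval_is_interval _ _) J01 Js Jt.
  by move/eqP; rewrite Yst subrr eq_sym mulf_eq0 (negbTE dYc)/= subr_eq0 => /eqP.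
have e20 : 0 < eta / 2 by rewrite divr_gt0.
(* With [r0 < eta / 2] and [gam t] within [eta / 2] of [gam t0], the horizontal segment stays in the
   ball where the boundary is this arc near [t0]. *)
have [r0 /andP[r00 r0e] Or0] := near0_right_ex H0 e20.
have cg := @arc_continuous_at i _ t01.
have near1 : \forall t \near t0, ball (gam i t0) (eta / 2) (gam i t).
  by apply: cg; exact: nbhsx_ballx.
have near2 : \forall t \near t0, Om ((gam i t).1 + e * r0, (gam i t).2).
  have : (fun t => ((gam i t).1 + e * r0, (gam i t).2)) @ t0 --> ((gam i t0).1 + e * r0, (gam i t0).2).
    have c1 : (fun t => (gam i t).1 + e * r0) @ t0 --> (gam i t0).1 + e * r0.
      by apply: cvgD; [exact: (cvg_fst_pair cg)|exact: cvg_cst].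
    exact: (cvg_pair c1 (cvg_snd_pair cg)).
  by apply; apply: open_nbhs_nbhs.
have near3 : \forall t \near t0, `|t - t0| < d.
  have := nbhsx_ballx t0 d d0; apply: filterS => t; rewrite /ball/= distrC.
  by [].
near=> t.
have bt : ball (gam i t0) (eta / 2) (gam i t) by near: t.
have Ot : Om ((gam i t).1 + e * r0, (gam i t).2) by near: t.
have td : `|t - t0| < d by near: t.
apply: (near0_right_itv r00) => r /andP[rpos rr0].
have free x : 0 <= x <= 1 -> ~ boundary Om ((gam i t).1 + e * r0 + x * (e * (r - r0)), (gam i t).2 + x * 0).
  move=> /andP[x0 x1] bd.
  have bdE : boundary Om = \bigcup_(i in [set: 'I_m]) (gam i @` `[0, 1]) by case: bnd.
  rewrite bdE in bd; case: bd => j _ [s /=]; rewrite in_itv/= mulr0 addr0 => s01 gs.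
  pose q := r0 + x * (r - r0).
  have qE : (gam i t).1 + e * r0 + x * (e * (r - r0)) = (gam i t).1 + e * q by rewrite /q; ring.
  have q0 : 0 < q.
    have : q = (1 - x) * r0 + x * r by rewrite /q; ring.
    move=> ->; rewrite -[X in X < _]addr0.
    have [->|xn0] := eqVneq x 0; first by rewrite subr0 mul1r mul0r !addr0.
    by rewrite ler_ltD// ?mulr_ge0 ?subr_ge0 ?(ltW r00)// mulr_gt0// lt_def xn0.
  have qr0 : q <= r0 by rewrite /q gerDl mulr_ge0_le0// subr_le0 ltW.
  rewrite qE in gs.
  have inb : ball (gam i t0) eta (gam j s).
    rewrite gs; case: bt => /= b1 b2; split => /=; last first.
      by apply: lt_trans b2 _; rewrite ltr_pdivrMr// ltr_pMr// ltr1n.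
    rewrite /ball/= opprD addrA; apply: le_lt_trans (ler_normB _ _) _.
    rewrite [eta]splitr; apply: ltrD; first exact: b1.
    by rewrite normrM e1 mul1r gtr0_norm//; exact: le_lt_trans qr0 r0e.
  have [ji std] := box _ inb j s s01 erefl.
  subst j.
  have st : s = t by apply: Yinj => //; rewrite gs.
  have : (gam i s).1 = (gam i t).1 + e * q by rewrite gs.
  rewrite st => /eqP; rewrite -subr_eq0 opprD addNKr oppr_eq0 mulf_eq0 (gt_eqF q0) orbF.
  by rewrite -normr_eq0 e1 oner_eq0.
have [+ _] := segment_noboundary oOm (@affine_continuous _ _ _) (@affine_continuous _ _ _) free.
rewrite !(mul0r, mul1r, addr0) => /(_ Ot).
by rewrite -addrA -mulrDr [r0 + _]addrC subrK.
Unshelve. all: by end_near. Qed.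

(** Where [dY <> 0] exactly one horizontal side belongs to [Om]; whichever it is at [t0] propagates
    to nearby points and excludes the other side there. *)
Lemma side_locally_constant i (t0 : R) : 0 < t0 < 1 -> dY i t0 != 0 ->
  \forall t \near t0, sideX Om (gam i t) = sideX Om (gam i t0).
Proof.
move=> t01 dY0.
have [_ cdY _] := arcD i.
have oU : open [set t : R | 0 < t < 1 /\ dY i t != 0].
  by apply: (open_derivative_preimage cdY (P := [set x | x != 0])); exact: open_neq.
have nU := open_nbhs_nbhs (conj oU (conj t01 dY0) : open_nbhs t0 _).
have [lr0 _] := side_normal bnd oOm arcD t01 dY0.
have [le|nle] := pselect (leftin [set x | Om (x, (gam i t0).2)] (gam i t0).1).
  have E : sideX Om (gam i t0) = 1 by rewrite /sideX /side asboolT.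
  have : \forall t \near t0, \forall r \near 0^'+, Om ((gam i t).1 + -1 * r, (gam i t).2).
    apply: side_propagate => //; first by rewrite normrN1.
    by apply: filterS le => r /=; rewrite mulN1r.
  apply: filterS => t let_; rewrite E /sideX /side asboolT//.
  by apply: filterS let_ => r /=; rewrite mulN1r.
have E : sideX Om (gam i t0) = -1 by rewrite /sideX /side asboolF.
have ri : rightin [set x | Om (x, (gam i t0).2)] (gam i t0).1 by apply: contrapT => /lr0.
have : \forall t \near t0, \forall r \near 0^'+, Om ((gam i t).1 + 1 * r, (gam i t).2).
  apply: side_propagate => //; first by rewrite normr1.
  by apply: filterS ri => r /=; rewrite mul1r.
move=> H; near=> t.
have [t01' dYt] : 0 < t < 1 /\ dY i t != 0 by near: t.
have [lrt _] := side_normal bnd oOm arcD t01' dYt.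
rewrite E /sideX /side asboolF// => /lrt; apply.
have : \forall r \near 0^'+, Om ((gam i t).1 + 1 * r, (gam i t).2) by near: t.
by apply: filterS => r /=; rewrite mul1r.
Unshelve. all: by end_near. Qed.
End SideConst.

(** * The divergence theorem *)

(** Measurability here refers to the product sigma-algebra; an open set is a countable union of
    boxes with rational ends. *)
Lemma open_measurable_prod (R : realType) (A : set (R * R)) :
  open A -> @measurable _ (measurableTypeR R * measurableTypeR R)%type A.
Proof.
move=> oA.
pose box (q : (rat * rat) * (rat * rat)) : set (R * R) :=
  `]ratr q.1.1, ratr q.1.2[%classic `*` `]ratr q.2.1, ratr q.2.2[%classic.
pose F q := if `[< box q `<=` A >] then box q else set0.
have -> : A = \bigcup_q F q.
  apply/seteqP; split => [[x y] Axy|z [q _]]; last first.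
    by rewrite /F; case: asboolP => // qA /qA.
  have /nbhs_ballP[e /= e0 eA] := open_nbhs_nbhs (conj oA Axy).
  have rt (u : R) : exists ab : rat * rat, [/\ ratr ab.1 < u, u < ratr ab.2, u - e < ratr ab.1 & ratr ab.2 < u + e].
    have ue : u - e < u by lra.
    have eu : u < u + e by lra.
    have [a] := rat_in_itvoo ue; have [b] := rat_in_itvoo eu.
    by rewrite !in_itv/= => /andP[? ?] /andP[? ?]; exists (a, b).
  have [a [a1 a2 a3 a4]] := rt x; have [b [b1 b2 b3 b4]] := rt y.
  exists (a, b) => //; rewrite /F asboolT.
    by split; rewrite /= in_itv/=; apply/andP.
  move=> [u v] /= [] /=; rewrite !in_itv/= => /andP[? ?] /andP[? ?].
  by apply: eA; split; rewrite /ball/= ltr_distlC; lra.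
apply: countable_bigcupT_measurable => // q.
rewrite /F; case: asboolP => _; last exact: measurable0.
by apply: measurableX; exact: measurable_itv.
Qed.

Lemma continuous_measurable_prod (R : realType) (A : set (R * R)) (f : R * R -> R) :
  open A -> {in A, continuous f} ->
  @measurable_fun _ _ (measurableTypeR R * measurableTypeR R)%type (measurableTypeR R) A f.
Proof.
move=> oA cf; apply: (measurability _ (RGenOpens.measurableE R)).
move=> _ [_ [a [b ->] <-]].
by apply: open_measurable_prod; move/continuous_inP : cf => /(_ oA); apply; exact: interval_open.
Qed.

Lemma bounded_closure_compact (R : realType) (A : set (R * R)) :
  bounded_set A -> compact (closure A).
Proof.
move=> [M [_ bM]].
have c1 := @segment_compact R (- (M + 1)) (M + 1).
pose K := `[- (M + 1), M + 1]%classic `*` `[- (M + 1), M + 1]%classic : set (R * R).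
have cK : compact K by exact: compact_setX.
apply: (subclosed_compact _ cK); first exact: closed_closure.
have clK : closed K by apply: compact_closed => //; exact: norm_hausdorff.
rewrite (closure_id K).1//; apply: closure_subset => z Az.
have M1 : M < M + 1 by rewrite ltrDl.
have := bM _ M1 z Az; rewrite /= prod_normE ge_max => /andP[z1 z2].
by split; rewrite /= in_itv/= -ler_norml.
Qed.

Section SliceRegular.
Variable R : realType.
Notation mu := (@lebesgue_measure R).
Variables (Om : set (R * R)) (m : nat) (gam : 'I_m -> R -> R * R) (n : R * R -> R * R).
Variables (dX dY : 'I_m -> R -> R).
Hypothesis bnd : piecewise_C1_boundary Om gam n.
Hypothesis oOm : open Om.
Hypothesis bOm : bounded_set Om.
Hypothesis arcD : forall i,
  [/\ {within `[0, 1], continuous (dX i)}, {within `[0, 1], continuous (dY i)} &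
   forall t : R, 0 < t < 1 -> [/\ is_derive t 1 (fun t => (gam i t).1) (dX i t),
    is_derive t 1 (fun t => (gam i t).2) (dY i t) & derive1 (gam i) t = (dX i t, dY i t)]].
Variables F H : R * R -> R.
Hypothesis cF : {within closure Om, continuous F}.
Hypothesis cH : {within closure Om, continuous H}.
Hypothesis dF : forall z, Om z -> is_derive z (1, 0) F (H z).

Let slice (y : R) := [set x | Om (x, y)].

Lemma pairl_continuous (y : R) : continuous (fun x : R => (x, y)).
Proof.
move=> x; have c1 : (fun x : R => x) @ x --> x by exact: cvg_id.
have c2 : (fun _ : R => y) @ x --> y by exact: cvg_cst.
exact: (cvg_pair c1 c2).
Qed.

Lemma slice_open y : open (slice y).
Proof. by apply: (open_comp (f := fun x : R => (x, y))) => // x _; exact: pairl_continuous. Qed.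

Lemma slice_bounded : exists2 M, 0 < M & forall y x, slice y x -> `|x| < M.
Proof.
have [M [_ bM]] := bOm.
have MM : M < `|M| + 1 by have := ler_norm M; lra.
exists (`|M| + 2); first by have := normr_ge0 M; lra.
move=> y x /(bM _ MM); rewrite /= prod_normE ge_max => /andP[+ _]; lra.
Qed.

Lemma slice_closure (a b y : R) : a < b -> (forall x, a < x < b -> Om (x, y)) ->
  forall x, a <= x <= b -> closure Om (x, y).
Proof.
move=> ab Oab x xab B /nbhs_ballP[e /= e0 eB].
pose c := (a + b) / 2.
pose m0 := Num.min (e / 2 / (b - a)) (1/2).
have ba : 0 < b - a by lra.
have m0p : 0 < m0 by rewrite lt_min !divr_gt0//=; lra.
have m1 : m0 <= 1/2 by rewrite ge_min lexx orbT.
have me : m0 * (b - a) <= e / 2 by rewrite -ler_pdivlMr// ge_min lexx.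
pose x' := x + m0 * (c - x).
have cb : `|c - x| <= b - a by rewrite ler_norml /c; lra.
exists (x', y); split.
  apply: Oab; have q1 : 0 <= (1 - m0) * (x - a) by rewrite mulr_ge0//; lra.
  have q2 : 0 <= (1 - m0) * (b - x) by rewrite mulr_ge0//; lra.
  have q3 : 0 < m0 * (b - a) by rewrite mulr_gt0.
  by rewrite /x' /c; lra.
apply: eB; split => /=; last exact: ballxx.
rewrite /ball/= /x' opprD addNKr normrN normrM (gtr0_norm m0p).
have : m0 * `|c - x| <= m0 * (b - a) by rewrite ler_pM2l.
lra.
Qed.

Lemma slice_ftc (a b y : R) : a < b -> (forall x, a < x < b -> slice y x) ->
  \int[mu]_(x in `]a, b[) H (x, y) = F (b, y) - F (a, y).
Proof.
move=> ab Oab.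
have cab x : `[a, b]%classic x -> closure Om (x, y).
  by rewrite /= in_itv/=; exact: (slice_closure ab Oab).
have cy : {within `[a, b], continuous (fun x : R => (x, y))}.
  by apply: continuous_subspaceT; exact: pairl_continuous.
have cHy : {within `[a, b], continuous (fun x => H (x, y))} := within_comp cab cy cH.
have cFy : {within `[a, b], continuous (fun x => F (x, y))} := within_comp cab cy cF.
have dFy x : a < x < b -> is_derive x 1 (fun x => F (x, y)) (H (x, y)).
  move=> /Oab /dF [d dE].
  have E : (fun h : R => h^-1 *: ((F \o shift (x, y)) (h *: (1, 0)) - F (x, y))) =
      (fun h : R => h^-1 *: (((fun x => F (x, y)) \o shift x) (h *: 1) - F (x, y))).
    apply/funext => h /=; congr (_ *: (F _ - _)).
    by transitivity (h * 1 + x, h * 0 + y); [|rewrite mulr0 add0r].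
  by split; [move: d|move: dE]; rewrite /derivable /derive E.
have := @continuous_FTC2 R (fun x => H (x, y)) (fun x => F (x, y)) a b ab cHy.
have [_ ca cb] := (continuous_within_itvP _ ab).1 cFy.
rewrite integral_itv_bndoo; last first.
  apply/measurable_EFinP; apply: measurable_funS (subspace_continuous_measurable_fun _ cHy) => //.
  exact: subset_itv_oo_cc.
rewrite /Rintegral => ->//.
- by split => // x; rewrite in_itv/= => /dFy [].
- by move=> x; rewrite in_itv/= => /dFy ?; rewrite derive1E derive_val.
Qed.

Lemma slice_integrable y : mu.-integrable (slice y) (EFin \o (fun x => H (x, y))).
Proof.
have [M M0 HM] := compact_within_bounded (bounded_closure_compact bOm) cH.
have [D D0 bD] := slice_bounded.
apply: (integrable_le_cst (M := M)).
- by apply: open_measurable; exact: slice_open.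
- apply: (@le_lt_trans _ _ (mu `[-D, D]%classic)).
    apply: le_measure; rewrite ?inE; [by apply: open_measurable; exact: slice_open|exact: measurable_itv|].
    by move=> x /bD; rewrite /= in_itv/= -ler_norml => /ltW.
  by rewrite lebesgue_measure_itv/=; case: ifP => _; rewrite -?EFinB ltry.
- apply: open_continuous_measurable_fun; first exact: slice_open.
  move=> x /set_mem Ox.
  have cHx : {for (x, y), continuous H}.
    have := continuous_subspaceW (@subset_closure _ Om) cH.
    by rewrite continuous_open_subspace//; apply; rewrite inE.
  by apply: (@continuous_comp _ _ _ (fun x : R => (x, y)) H x) => //; exact: pairl_continuous.
- by move=> x Ox; apply: HM; exact: subset_closure.
Qed.

Variables (J : 'I_m -> nat -> set R) (G : 'I_m -> nat -> R -> R).
Hypothesis tJ : forall i, trivIset setT (J i).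
Hypothesis JE : forall i, [set t : R | 0 < t < 1 /\ dY i t != 0] = \bigcup_k J i k.
Hypothesis Jinj : forall i k t u, J i k t -> J i k u -> (gam i t).2 = (gam i u).2 -> t = u.
Hypothesis oJ : forall i k, open (J i k).
Hypothesis GJ : forall i k t, J i k t -> G i k (gam i t).2 = sideX Om (gam i t) * F (gam i t).
Hypothesis G0 : forall i k y, (forall t, J i k t -> (gam i t).2 <> y) -> G i k y = 0.

(** The arc parameters at a regular height form a compact set covered by the open pieces [J i k],
    hence by finitely many of them. Beyond some [N] the sum no longer changes, and the pieces that
    meet the line correspond one to one to the boundary points on it. *)
Lemma slice_regular y : (forall i t, 0 <= t <= 1 -> (gam i t).2 = y -> 0 < t < 1 /\ dY i t != 0) ->
  \forall N \near \oo, \sum_i \sum_(0 <= k < N) G i k y = \int[mu]_(x in slice y) H (x, y).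
Proof.
move=> reg.
have bdE : boundary Om = \bigcup_(i in [set: 'I_m]) (gam i @` `[0, 1]) by case: bnd.
have bdO z : boundary Om z -> ~ Om z by rewrite /boundary ((interior_id _).1 oOm) => -[].
(* Compactness in near-covering form: around a parameter at height [y] a single piece suffices, and
   around any other parameter the height stays different from [y]. *)
have cov i : \forall N \near \oo, `[0, 1]%classic `<=`
    [set t : R | 0 <= t <= 1 -> (gam i t).2 = y -> exists2 k, (k < N)%N & J i k t].
  have := @segment_compact R 0 1; rewrite compact_near_coveringP; apply => t.
  rewrite /= in_itv/= => t01.
  have [yt|yt] := pselect ((gam i t).2 = y).
    have : (\bigcup_k J i k) t by rewrite -JE; exact: reg.
    move=> [k _ Jt]; exists (J i k, [set N | (k < N)%N]) => /=.
      by split; [exact: open_nbhs_nbhs|exact: nbhs_infty_gt].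
    by move=> [t' N] [/= Jt' kN] _ _; exists k.
  have /subspace_continuousP/(_ t) cY := within_snd (@arc_continuous _ _ _ _ _ bnd i).
  have yn : nbhs (gam i t).2 [set x | x != y] by apply: open_nbhs_nbhs; split; [exact: open_neq|exact/eqP].
  have near_t : \forall t' \near t, `[0, 1]%classic t' -> (gam i t').2 != y.
    by apply: (cY _ _ yn); rewrite /= in_itv.
  exists ([set t' | `[0, 1]%classic t' -> (gam i t').2 != y], setT) => /=.
    by split; [exact: near_t|exact: filterT].
  move=> [t' N] [/= H' _] t01' yt'; have := H'; rewrite in_itv/= => /(_ t01') /eqP.
  by [].
near=> N.
have covN i t : 0 <= t <= 1 -> (gam i t).2 = y -> exists k : 'I_N, J i k t.
  move=> t01 yt.
  have /(_ t) : `[0, 1]%classic `<=`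
    [set t : R | 0 <= t <= 1 -> (gam i t).2 = y -> exists2 k, (k < N)%N & J i k t].
    by move: i {t t01 yt}; near: N; apply: filter_forall => i; exact: cov.
  by rewrite /= in_itv/= => /(_ t01 t01 yt)[k kN Jt]; exists (Ordinal kN).
have J01 i k t : J i k t -> 0 < t < 1 /\ dY i t != 0.
  by move=> Jt; have : (\bigcup_k J i k) t; [exists k|rewrite -JE].
(* [A] selects the pairs of an arc and a piece that meet the line; [tt] is the parameter where they
   do, unique because the height is injective on a piece, and [xx] is its abscissa. *)
pose tt (p : 'I_m * 'I_N) := xget 0 [set t | J p.1 p.2 t /\ (gam p.1 t).2 = y].
pose A (p : 'I_m * 'I_N) := `[< exists t, J p.1 p.2 t /\ (gam p.1 t).2 = y >].
have ttP p : A p -> J p.1 p.2 (tt p) /\ (gam p.1 (tt p)).2 = y.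
  by move=> /asboolP[t Ht]; rewrite /tt; case: xgetP => [x -> //|/(_ t)].
pose xx p := (gam p.1 (tt p)).1.
have gE p : A p -> gam p.1 (tt p) = (xx p, y).
  by move=> /ttP[_ <-]; rewrite -surjective_pairing.
pose P := [seq xx p | p <- enum A].
have PP x : x \in P -> exists2 p, A p & x = xx p.
  by move=> /mapP[p]; rewrite mem_enum => Ap ->; exists p.
have inP p : A p -> xx p \in P by move=> Ap; apply/mapP; exists p => //; rewrite mem_enum.
have bP x : boundary Om (x, y) -> x \in P.
  rewrite bdE => -[i _ [t /=]]; rewrite in_itv/= => t01 gt.
  have yt : (gam i t).2 = y by rewrite gt.
  have [k Jt] := covN i t t01 yt.
  have Ap : A (i, k) by apply/asboolP; exists t.
  have [Jtt ytt] := ttP _ Ap.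
  have E : tt (i, k) = t by apply: (Jinj Jtt Jt); rewrite ytt yt.
  by have := inP _ Ap; rewrite /xx E /= gt.
have bxx p : A p -> boundary Om (xx p, y).
  move=> Ap; rewrite bdE; exists p.1 => //; exists (tt p); last exact: gE.
  by have [/J01[+ _] _] := ttP _ Ap; rewrite /= in_itv/= => /andP[/ltW -> /ltW ->].
(* An interior point of an arc has no other parameter, and the pieces of one arc are disjoint, so
   distinct pairs give distinct abscissae. *)
have uP : uniq P.
  rewrite map_inj_in_uniq ?enum_uniq// => p q; rewrite !mem_enum => Ap Aq xE.
  have [Jp yp] := ttP _ Ap; have [Jq yq] := ttP _ Aq.
  have [p01 _] := J01 _ _ _ Jp; have [/andP[q0 q1] _] := J01 _ _ _ Jq.
  case: bnd => _ _ _ inj _.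
  have q01 : 0 <= tt q <= 1 by rewrite (ltW q0) (ltW q1).
  have gpq : gam p.1 (tt p) = gam q.1 (tt q) by rewrite !gE// xE.
  have [ipq tpq] := inj p.1 q.1 (tt p) (tt q) p01 q01 gpq.
  case: p q ipq tpq Jp Jq {Ap Aq xE yp yq p01 q0 q1 q01 gpq} => [i k] [j l] /= -> -> Jk Jl.
  congr (_, _); apply/val_inj.
  by apply: (@tJ j k l) => //; exists (tt (j, l)).
have [M M0 bM] := slice_bounded.
transitivity (\sum_(x <- P) side (slice y) x * F (x, y)); last first.
  symmetry; apply: (slice_sum (M := M) (F := fun x => F (x, y))) => //.
  - by apply: open_measurable; exact: slice_open.
  - exact: slice_integrable.
  - exact: bM.
  - by move=> x /PP[p Ap ->]; apply: bdO; exact: bxx.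
  (* With no boundary point in between, a single point of the slice spreads along segments to the
     whole interval. *)
  - move=> a b ab nP.
    have nb x : a < x < b -> ~ boundary Om (x, y) by move=> /nP xP /bP; rewrite (negbTE xP).
    have [[x0 x0ab Sx0]|nS] := pselect (exists2 x, a < x < b & slice y x); last first.
      by right => x xab Sx; apply: nS; exists x.
    left => x xab.
    have free (c : R) : 0 <= c <= 1 -> ~ boundary Om (x0 + c * (x - x0), y + c * 0).
      move=> /andP[c0 c1]; rewrite mulr0 addr0; apply: nb.
      have -> : x0 + c * (x - x0) = (1 - c) * x0 + c * x by ring.
      move/andP: x0ab => [? ?]; move/andP: xab => [? ?].
      have [->|cn1] := eqVneq c 1; first by rewrite subrr mul0r add0r mul1r; apply/andP.
      have c1' : 0 < 1 - c by rewrite subr_gt0 lt_def eq_sym cn1.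
      have q1 : 0 < (1 - c) * (x0 - a) by rewrite mulr_gt0// subr_gt0.
      have q2 : 0 < (1 - c) * (b - x0) by rewrite mulr_gt0// subr_gt0.
      have q3 : 0 <= c * (x - a) by rewrite mulr_ge0 ?subr_ge0// ltW.
      have q4 : 0 <= c * (b - x) by rewrite mulr_ge0 ?subr_ge0// ltW.
      by apply/andP; lra.
    have [+ _] := segment_noboundary oOm (@affine_continuous _ _ _) (@affine_continuous _ _ _) free.
    by rewrite !(mul0r, mul1r, addr0) => /(_ Sx0); rewrite addrC subrK.
  - move=> x /PP[p Ap ->].
    have [Jp yp] := ttP _ Ap; have [p01 dYp] := J01 _ _ _ Jp.
    by have [] := side_normal bnd oOm arcD p01 dYp; rewrite gE.
  - by move=> a b; exact: slice_ftc.
rewrite /P big_map big_enum/= (eq_bigl A)//.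
transitivity (\sum_(p : 'I_m * 'I_N) G p.1 p.2 y).
  by rewrite -(pair_big xpredT xpredT (fun i k => G i (val k) y))/=; apply: eq_bigr => i _; rewrite big_mkord.
rewrite (bigID A)/= [X in _ + X]big1 ?addr0; last first.
  move=> p nA; apply: G0 => t Jt yt.
  by move/negP : nA; apply; apply/asboolP; exists t.
apply: eq_bigr => p Ap; have [Jp yp] := ttP _ Ap.
by rewrite -{1}yp GJ// gE.
Unshelve. all: by end_near. Qed.
End SliceRegular.

Lemma cvg_seq_sum (K : numFieldType) (T : Type) (I : Type) (F : set_system T) {FF : Filter F} (s : seq I)
    (f : I -> T -> K) (l : I -> K) :
  (forall i, f i x @[x --> F] --> l i) -> \sum_(i <- s) f i x @[x --> F] --> \sum_(i <- s) l i.
Proof.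
move=> fl; elim: s => [|i s IH].
  by rewrite big_nil; under eq_fun do rewrite big_nil; exact: cvg_cst.
by rewrite big_cons; under eq_fun do rewrite big_cons; exact: cvgD.
Qed.

Section Green.
Variable R : realType.
Notation mu := (@lebesgue_measure R).
Notation mu2 := (@lebesgue_measure R \x @lebesgue_measure R)%E.

Lemma plane_measure_lty (A : set (R * R)) : open A -> bounded_set A -> (mu2 A < +oo)%E.
Proof.
move=> oA [M [_ bM]].
pose D := `|M| + 1.
have MD : M < D by rewrite /D; have := ler_norm M; lra.
pose I : set R := `[- D, D]%classic.
have mI : @measurable _ (measurableTypeR R) I by exact: measurable_itv.
have muI : (mu I < +oo)%E.
  by rewrite lebesgue_measure_itv/=; case: ifP => _; rewrite -?EFinB ltry.
apply: (@le_lt_trans _ _ (mu2 (I `*` I))).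
  apply: le_measure; rewrite ?inE; [exact: open_measurable_prod|exact: measurableX|].
  move=> z /(bM _ MD); rewrite /= prod_normE ge_max => /andP[z1 z2].
  by split; rewrite /I /= in_itv/= -ler_norml.
have -> : mu2 (I `*` I) = (mu I * mu I)%E by exact: product_measure1E.
by rewrite lte_mul_pinfty// ge0_fin_numE.
Qed.

Lemma plane_integrable (A : set (R * R)) (f : R * R -> R) (M : R) : open A -> bounded_set A ->
  {in A, continuous f} -> (forall z, A z -> `|f z| <= M) -> mu2.-integrable A (EFin \o f).
Proof.
move=> oA bA cf fM; apply: (integrable_le_cst (M := M)) => //.
- exact: open_measurable_prod.
- exact: plane_measure_lty.
- exact: continuous_measurable_prod.
Qed.

Lemma within_closure_continuous (T U : topologicalType) (A : set T) (f : T -> U) :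
  open A -> {within closure A, continuous f} -> {in A, continuous f}.
Proof.
move=> oA /(continuous_subspaceW (@subset_closure _ A)).
by rewrite continuous_open_subspace.
Qed.

Variables (Om : set (R * R)) (m : nat) (gam : 'I_m -> R -> R * R) (n : R * R -> R * R).
Hypothesis bnd : piecewise_C1_boundary Om gam n.
Hypothesis oOm : open Om.
Hypothesis bOm : bounded_set Om.
Variables F H : R * R -> R.
Hypothesis cF : {within closure Om, continuous F}.
Hypothesis cH : {within closure Om, continuous H}.
Hypothesis dF : forall z, Om z -> is_derive z (1, 0) F (H z).

Lemma green_x : \int[mu2]_(z in Om) H z = line_integral gam (fun z => F z * (n z).1).
Proof.
have [dX [dY arcD]] := arc_derivatives bnd.
have [M M0 HM] := compact_within_bounded (bounded_closure_compact bOm) cH.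
have bdE : boundary Om = \bigcup_(i in [set: 'I_m]) (gam i @` `[0, 1]) by case: bnd.
have g01 i t : `[0, 1]%classic t -> closure Om (gam i t).
  move=> t01; have : boundary Om (gam i t) by rewrite bdE; exists i => //; exists t.
  by case.
have cY i : {within `[0, 1], continuous (fun t => (gam i t).2)} := within_snd (@arc_continuous _ _ _ _ _ bnd i).
have hdY i (t : R) : 0 < t < 1 -> is_derive t 1 (fun t => (gam i t).2) (dY i t).
  by have [_ _ dg] := arcD i; move=> /dg[].
have cFg i : {within `[0, 1], continuous (fun t => F (gam i t))}.
  exact: within_comp (g01 i) (@arc_continuous _ _ _ _ _ bnd i) cF.
have s1 i t : `|sideX Om (gam i t)| <= 1.
  by rewrite /sideX /side; case: ifP => _; rewrite ?normrN normr1.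
have cdY i : {within `[0, 1], continuous (dY i)} by have [] := arcD i.
have [J JP] := choice (fun i => @arc_pieces R (fun t => (gam i t).2) (dY i) (fun t => F (gam i t))
  (fun t => sideX Om (gam i t)) (cY i) (cdY i) (hdY i) (cFg i) (s1 i)
    (@side_locally_constant _ _ _ _ _ _ _ bnd oOm arcD i)).
have [G {}JP] := choice JP.
have [N {}JP] := choice JP.
pose L i := \int[mu]_(t in `]0, 1[) (sideX Om (gam i t) * F (gam i t) * `|dY i t|).
have LE i : L i = \int[mu]_(t in `[0, 1]) (F (gam i t) * (n (gam i t)).1 * enorm (derive1 (gam i) t)).
  have [_ _ _ _ [_ mf]] := JP i.
  have fE t : t \in `]0, 1[ -> sideX Om (gam i t) * F (gam i t) * `|dY i t| =
      F (gam i t) * (n (gam i t)).1 * enorm (derive1 (gam i) t).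
    rewrite in_itv/= => t01; rewrite -mulrA -mulrA mulrCA; congr (_ * _).
    (* If [dY = 0] the tangent is horizontal and non-zero, so [n_1 = 0] and both sides vanish. *)
    have [dY0|dY0] := eqVneq (dY i t) 0; last by have [_ ->] := side_normal bnd oOm arcD t01 dY0.
    have [_ nn dd _] := normal_coords bnd arcD i t01.
    move: nn dd; rewrite dY0 normr0 !mulr0 addr0 expr0n/= addr0 => /eqP.
    rewrite mulf_eq0 => /orP[/eqP->|/eqP->]; first by rewrite mul0r.
    by rewrite expr0n/= ltxx.
  rewrite /L /Rintegral; congr fine; rewrite [RHS]integral_itv_bndoo; last first.
    by apply/measurable_EFinP; apply: eq_measurable_fun mf => t; rewrite inE/= => /fE.
  by apply: eq_integral => t; rewrite inE/= => /fE ->.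
transitivity (\sum_i L i); last by apply: eq_bigr => i _.
pose f (z : R * R) := ((H \_ Om) z)%:E.
pose Phi y := \int[mu]_(x in [set x | Om (x, y)]) H (x, y).
have intH : mu2.-integrable Om (EFin \o H).
  apply: (plane_integrable (M := M)) => //; first exact: within_closure_continuous.
  by move=> z Oz; apply: HM; exact: subset_closure.
have mOm : @measurable _ (measurableTypeR R * measurableTypeR R)%type Om by exact: open_measurable_prod.
have intf : mu2.-integrable setT f.
  have := (integrable_restrict mu2 mOm measurableT (EFin \o H)).1.
  by rewrite setTI restrict_EFin; apply.
have fPhi y : (\int[mu]_x f (x, y) = (Phi y)%:E)%E.
  have -> : (fun x => f (x, y)) = (EFin \o (fun x => H (x, y))) \_ [set x | Om (x, y)].
    rewrite restrict_EFin; apply/funext => x; rewrite /f /= !patchE.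
    by congr (if _ then _ else _)%:E.
  rewrite -integral_mkcond /Phi /Rintegral fineK//.
  apply: integrable_fin_num; last exact: (slice_integrable oOm bOm cH).
  by apply: open_measurable; exact: (slice_open oOm).
have mPhi : measurable_fun setT (fun y => (Phi y)%:E).
  have := measurable_fubini_G intf.
  by apply: eq_measurable_fun => y _; rewrite -fPhi.
have -> : \int[mu2]_(z in Om) H z = \int[mu]_y Phi y.
  rewrite Rintegral_mkcond /Rintegral; congr fine.
  rewrite -(integral21_prod_meas1 intf).
  by apply: eq_integral => y _; exact: fPhi.
pose Psi k y := \sum_i \sum_(0 <= j < k) G i j y.
have intG i k : mu.-integrable setT (EFin \o G i k) by have [_ _ [+ _] _ _] := JP i; apply.
have intPsi k : mu.-integrable setT (EFin \o Psi k).
  rewrite /Psi (_ : _ \o _ = (fun y => \sum_(i <- index_enum 'I_m) \sum_(j <- index_iota 0 k) (G i j y)%:E)%E).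
    by apply: integrable_sum => // i _; apply: integrable_sum => // j _; exact: intG.
  by apply/funext => y /=; rewrite -sumEFin; apply: eq_bigr => i _; rewrite -sumEFin.
have PsiE k : \int[mu]_y Psi k y = \sum_i \sum_(0 <= j < k) \int[mu]_y G i j y.
  rewrite /Rintegral -[RHS]/(fine (_%:E)) -sumEFin; congr fine.
  transitivity (\int[mu]_y \sum_(i <- index_enum 'I_m) \sum_(j <- index_iota 0 k) (G i j y)%:E)%E.
    by apply: eq_integral => y _; rewrite /Psi -sumEFin; apply: eq_bigr => i _; rewrite -sumEFin.
  rewrite integral_sum//; last by move=> i; apply: integrable_sum => // j _; exact: intG.
  apply: eq_bigr => i _; rewrite integral_sum//; last by move=> j; exact: intG.
  rewrite -sumEFin; apply: eq_bigr => j _; rewrite fineK//.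
  by apply: integrable_fin_num => //; exact: intG.
(* Off these null sets every parameter at the given height is interior to its arc and has [dY <> 0],
   as [slice_regular] requires. *)
pose Z i := (fun t => (gam i t).2) @` [set t : R | 0 < t < 1 /\ dY i t = 0] `|` [set (gam i 0).2; (gam i 1).2].
have negZ i : mu.-negligible (Z i).
  apply: negligibleU; first exact: (sard (cY i) (cdY i) (hdY i)).
  have neg1 (a : R) : mu.-negligible [set a].
    by exists [set a]; split; [exact: measurable_set1|exact: lebesgue_measure_set1|].
  by apply: negligibleU; exact: neg1.
have conv : {ae mu, forall y, setT y -> (Psi k y)%:E @[k --> \oo] --> (Phi y)%:E}.
  have : mu.-negligible (\big[setU/set0]_(i <- index_enum 'I_m) Z i).
    by apply: (big_ind (fun A => mu.-negligible A)) => [|A B|i _]; [exact: negligible_set0|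
      exact: negligibleU|exact: negZ].
  apply: negligibleS => y; rewrite /= -bigcup_seq => ny; apply: contrapT => nZ.
  apply: ny => _.
  have reg i t : 0 <= t <= 1 -> (gam i t).2 = y -> 0 < t < 1 /\ dY i t != 0.
    move=> /andP[t0 t1] yt.
    have nZi : ~ Z i y by move=> Zi; apply: nZ; exists i => //=; rewrite mem_index_enum.
    have t01 : 0 < t < 1.
      rewrite !lt_neqAle t0 t1 !andbT; apply/andP; split; apply/eqP => E; apply: nZi; right.
        by left; rewrite -yt -E.
      by right; rewrite -yt E.
    split => //; apply/eqP => dY0; apply: nZi; left.
    by exists t.
  have tJ i : trivIset setT (J i) by have [[]] := JP i.
  have UJ i : [set t : R | 0 < t < 1 /\ dY i t != 0] = \bigcup_k J i k by have [[]] := JP i.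
  have Jinj i k t u : J i k t -> J i k u -> (gam i t).2 = (gam i u).2 -> t = u.
    by have [_ + _ _ _] := JP i; apply.
  have oJ i k : open (J i k) by have [[]] := JP i.
  have GJ i k t : J i k t -> G i k (gam i t).2 = sideX Om (gam i t) * F (gam i t).
    by have [_ _ [_ [+ _]] _ _] := JP i; apply.
  have G0 i k y' : (forall t, J i k t -> (gam i t).2 <> y') -> G i k y' = 0.
    by have [_ _ [_ [_ +]] _ _] := JP i; apply.
  have [k0 _ Hk] := slice_regular bnd oOm bOm arcD cF cH dF tJ UJ Jinj oJ GJ G0 reg.
  apply: cvg_near_cst; exists k0 => // k kk.
  by congr EFin; exact: (Hk k kk).
(* The bounds [N i] of the finitely many arcs add up to one integrable bound for all the partial
   sums. *)
have intN : mu.-integrable setT (fun y => \sum_(i <- index_enum 'I_m) N i y)%E.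
  by apply: integrable_sum => // i _; have [_ _ _ [+ _] _] := JP i.
have [] := @dominated_convergence _ _ _ mu setT measurableT (fun k y => (Psi k y)%:E) (fun y => (Phi y)%:E)
  (fun y => \sum_(i <- index_enum 'I_m) N i y)%E (fun k => measurable_int _ (intPsi k)) mPhi conv intN.
  apply: aeW => y k _; rewrite /= /Psi.
  apply: (@le_trans _ _ (\sum_(i <- index_enum 'I_m) (`|\sum_(0 <= j < k) G i j y|%:E))%E).
    by rewrite sumEFin lee_fin ler_norm_sum.
  by apply: lee_sum => i _; have [_ _ _ [_ +] _] := JP i; apply.
move=> iPhi _ cvI.
have c1 : \int[mu]_y Psi k y @[k --> \oo] --> \int[mu]_y Phi y.
  rewrite /Rintegral; move: cvI => /=; rewrite -[X in _ --> X -> _]fineK; last exact: integrable_fin_num.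
  by move=> /fine_cvg.
have c2 : \int[mu]_y Psi k y @[k --> \oo] --> \sum_i L i.
  under eq_fun do rewrite PsiE.
  by apply: cvg_seq_sum => i; have [_ _ _ _ [+ _]] := JP i.
exact: (cvg_unique _ c1 c2).
Qed.
End Green.

(** At the ends of an arc [n] is unconstrained and [derive1] may be a default value, so integrands
    along arcs are compared on the open interval only. *)
Lemma Rintegral_itvoo_eq (R : realType) (a b : R) (f g : R -> R) :
  measurable_fun (`]a, b[%classic : set R) f -> (forall t, a < t < b -> f t = g t) ->
  \int[@lebesgue_measure R]_(t in `[a, b]) f t = \int[@lebesgue_measure R]_(t in `[a, b]) g t.
Proof.
move=> mf fg; rewrite /Rintegral; congr fine.
have E t : t \in (`]a, b[%classic : set R) -> f t = g t by rewrite inE/= in_itv/=; exact: fg.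
rewrite integral_itv_bndoo; last exact/measurable_EFinP.
rewrite [RHS]integral_itv_bndoo; last first.
  by apply/measurable_EFinP; exact: eq_measurable_fun mf.
by apply: eq_integral => t /E ->.
Qed.

Section Weight.
Variable R : realType.
Notation mu := (@lebesgue_measure R).
Variables (Om : set (R * R)) (m : nat) (gam : 'I_m -> R -> R * R) (n : R * R -> R * R).
Hypothesis bnd : piecewise_C1_boundary Om gam n.
Hypothesis oOm : open Om.

(** Measurability of [n] along an arc has to be derived: [n_1] times the speed is [sideX] times
    [|dY|], which [arc_pieces] with [g = 1] shows to be measurable. The bound is that of [dY]. *)
Lemma weight_x : exists2 D, 0 < D & forall i,
  measurable_fun (`]0, 1[%classic : set R) (fun t => (n (gam i t)).1 * enorm (derive1 (gam i) t)) /\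
  forall t : R, 0 < t < 1 -> `|(n (gam i t)).1 * enorm (derive1 (gam i) t)| <= D.
Proof.
have [dX [dY arcD]] := arc_derivatives bnd.
have cY i : {within `[0, 1], continuous (fun t => (gam i t).2)} := within_snd (@arc_continuous _ _ _ _ _ bnd i).
have hdY i (t : R) : 0 < t < 1 -> is_derive t 1 (fun t => (gam i t).2) (dY i t).
  by have [_ _ dg] := arcD i; move=> /dg[].
have s1 i t : `|sideX Om (gam i t)| <= 1.
  by rewrite /sideX /side; case: ifP => _; rewrite ?normrN normr1.
have cdY i : {within `[0, 1], continuous (dY i)} by have [] := arcD i.
have c1 : {within `[0, 1], continuous (fun _ : R => 1 : R)} by move=> x; exact: cvg_cst.
have E i t : 0 < t < 1 -> (n (gam i t)).1 * enorm (derive1 (gam i) t) = sideX Om (gam i t) * 1 * `|dY i t|.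
  move=> t01; rewrite mulr1.
  have [dY0|dY0] := eqVneq (dY i t) 0; last by have [_ ->] := side_normal bnd oOm arcD t01 dY0.
  have [_ nn dd _] := normal_coords bnd arcD i t01.
  move: nn dd; rewrite dY0 normr0 !mulr0 addr0 expr0n/= addr0 => /eqP.
  rewrite mulf_eq0 => /orP[/eqP->|/eqP->]; first by rewrite mul0r.
  by rewrite expr0n/= ltxx.
have bY i : exists b, 0 < b /\ forall t, `[0, 1]%classic t -> `|dY i t| <= b.
  by have [b] := compact_within_bounded (@segment_compact R 0 1) (cdY i); exists b.
have [B BP] := choice bY.
exists (1 + \sum_i B i).
  by rewrite ltr_pwDl// sumr_ge0// => i _; have [/ltW] := BP i.
move=> i; split.
  have [J [G [N [_ _ _ _ [_ mf]]]]] := @arc_pieces R (fun t => (gam i t).2) (dY i) (fun=> 1)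
    (fun t => sideX Om (gam i t)) (cY i) (cdY i) (hdY i) c1 (s1 i)
      (@side_locally_constant _ _ _ _ _ _ _ bnd oOm arcD i).
  by apply: eq_measurable_fun mf => t; rewrite inE/= in_itv/= => /E ->.
move=> t t01; rewrite E// mulr1 normrM normr_id.
have [B0 BD] := BP i.
apply: (@le_trans _ _ (B i)).
  rewrite -[leRHS]mul1r ler_pM//; apply: BD; rewrite /= in_itv/=.
  by move/andP : t01 => [/ltW -> /ltW ->].
rewrite (bigD1 i)//= addrCA lerDl addr_ge0// sumr_ge0// => j _.
by have [/ltW] := BP j.
Qed.
End Weight.

(** * Exchange of the two coordinates *)

Section Swap.
Variable R : realType.
Notation mu := (@lebesgue_measure R).
Notation mu2 := (@lebesgue_measure R \x @lebesgue_measure R)%E.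

Definition sw (z : R * R) : R * R := (z.2, z.1).

Lemma swK : involutive sw. Proof. by case. Qed.

Lemma cvg_sw (T : Type) (F : set_system T) {FF : Filter F} (f : T -> R * R) (l : R * R) :
  f @ F --> l -> (sw \o f) @ F --> sw l.
Proof. by move=> fl; exact: (cvg_pair (cvg_snd_pair fl) (cvg_fst_pair fl)). Qed.

Lemma sw_continuous : continuous sw.
Proof. by move=> z; apply: (cvg_sw (f := id)); exact: cvg_id. Qed.

Lemma closure_sw (A : set (R * R)) : closure (sw @^-1` A) = sw @^-1` closure A.
Proof.
have H B z : closure (sw @^-1` B) z -> closure B (sw z).
  move=> cz C nC; have /cz [w [Bw Cw]] : nbhs z (sw @^-1` C) := @sw_continuous z C nC.
  by exists (sw w).
apply/seteqP; split => [z|z]; first exact: H.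
move=> /= cz; rewrite -[z]swK; apply: H.
by rewrite -comp_preimage (_ : sw \o sw = id) //; apply/funext => w; exact: swK.
Qed.

Lemma open_sw (A : set (R * R)) : open A -> open (sw @^-1` A).
Proof. by move=> oA; apply: open_comp => // z _; exact: sw_continuous. Qed.

Lemma bounded_sw (A : set (R * R)) : bounded_set A -> bounded_set (sw @^-1` A).
Proof.
move=> [M [Mr bM]]; exists M; split => // x Mx z /= Az.
by have := bM x Mx _ Az; rewrite /= !prod_normE/= maxC.
Qed.

Lemma derivable_sw (V : normedModType R) (f : V -> R * R) x v : derivable f x v ->
  derivable (sw \o f) x v /\ 'D_v (sw \o f) x = sw ('D_v f x).
Proof.
move=> /cvg_sw H.
have E : sw \o (fun h => h^-1 *: ((f \o shift x) (h *: v) - f x)) =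
  (fun h => h^-1 *: (((sw \o f) \o shift x) (h *: v) - (sw \o f) x)) by apply/funext.
rewrite E in H.
split; first by apply/cvg_ex; eexists; exact: H.
by apply: cvg_lim; [exact: norm_hausdorff|exact: H].
Qed.

Lemma derive1_sw (f : R -> R * R) t : derivable f t 1 -> derive1 (sw \o f) t = sw (derive1 f t).
Proof. by move=> d; rewrite !derive1E; have [_ ->] := derivable_sw d. Qed.

Lemma enorm_sw z : enorm (sw z) = enorm z.
Proof. by rewrite /enorm !dotE addrC. Qed.

(** The description of the boundary refers to an outward normal and to no orientation of the arcs,
    so it survives a reflection. *)
Lemma boundary_sw (Om : set (R * R)) (m : nat) (gam : 'I_m -> R -> R * R) (n : R * R -> R * R) :
  open Om -> piecewise_C1_boundary Om gam n ->
  piecewise_C1_boundary (sw @^-1` Om) (fun i => sw \o gam i) (sw \o n \o sw).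
Proof.
move=> oOm [bdE C1 reg inj nor].
have dg i t v : 0 < t < 1 -> derivable (gam i) t v.
  move=> t01; have [_ Cg] := C1 i; have [d0 _] := Cg [::] isT.
  by apply: d0 => //=; rewrite in_itv.
split.
- rewrite /boundary closure_sw ((interior_id _).1 (open_sw oOm)).
  move: bdE; rewrite /boundary ((interior_id _).1 oOm) => bdE.
  rewrite (_ : _ `\` _ = sw @^-1` (closure Om `\` Om)) // bdE.
  apply/seteqP; split => z /=.
    by move=> [i _ [t t01 gt]]; exists i => //; exists t => //=; rewrite gt swK.
  by move=> [i _ [t t01 <-]]; exists i => //; exists t => //=; rewrite swK.
- move=> i; have [cg Cg] := C1 i; split.
    by move=> x; apply: cvg_sw; exact: cg.
  have d t v : `]0, 1[%classic t -> derivable (gam i) t v by rewrite /= in_itv; exact: dg.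
  case=> [_|v [|//] _]; split => //.
  + by move=> x v x01 _ /=; have [] := derivable_sw (d _ v x01).
  + have [_ [h ch hE]] := Cg [::] isT; exists (sw \o h).
      by move=> x; apply: cvg_sw; exact: ch.
    by move=> x /hE /= ->.
  + have [_ [h ch hE]] := Cg [:: v] isT; exists (sw \o h).
      by move=> x; apply: cvg_sw; exact: ch.
    move=> x /[dup] x01 /hE /= ->.
    by have [_ ->] := derivable_sw (d _ v x01).
- move=> i t t01; rewrite derive1_sw; last exact: dg.
  apply: contra (reg i t t01) => /eqP H.
  by rewrite -[derive1 _ _]swK H.
- move=> i j s t s01 t01 /= H; apply: inj => //.
  by rewrite -[gam i s]swK H swK.
- move=> i t t01 /=; rewrite swK; have [n1 n0 nr] := nor i t t01; split.
  + by rewrite enorm_sw.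
  + by rewrite derive1_sw; [rewrite -[RHS]n0 !dotE addrC|exact: dg].
  + by rewrite closure_sw; apply: filterS nr.
Qed.

(** By Fubini, both sides are iterated integrals of one function, taken in opposite orders. *)
Lemma integral_sw (A : set (R * R)) (f : R * R -> R) (M : R) : open A -> bounded_set A ->
  {in A, continuous f} -> (forall z, A z -> `|f z| <= M) ->
  \int[mu2]_(z in sw @^-1` A) f (sw z) = \int[mu2]_(z in A) f z.
Proof.
move=> oA bA cf fM.
have i1 := plane_integrable oA bA cf fM.
have i2 : mu2.-integrable (sw @^-1` A) (EFin \o (f \o sw)).
  apply: (plane_integrable (M := M)); [exact: open_sw|exact: bounded_sw| |by move=> z; exact: fM].
  move=> z /set_mem Az; apply: continuous_comp; first exact: sw_continuous.
  by apply: cf; rewrite inE.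
have mA := open_measurable_prod oA.
have mA' := open_measurable_prod (open_sw oA).
have := (integrable_restrict mu2 mA measurableT (EFin \o f)).1.
rewrite setTI restrict_EFin => /(_ i1) I1.
have := (integrable_restrict mu2 mA' measurableT (EFin \o (f \o sw))).1.
rewrite setTI restrict_EFin => /(_ i2) I2.
rewrite Rintegral_mkcond [RHS]Rintegral_mkcond /Rintegral; congr fine.
rewrite -(integral12_prod_meas1 I2) -(integral21_prod_meas1 I1).
by apply: eq_integral => x _; apply: eq_integral => y _; rewrite /= !patchE.
Qed.

Variables (Om : set (R * R)) (m : nat) (gam : 'I_m -> R -> R * R) (n : R * R -> R * R).
Hypothesis bnd : piecewise_C1_boundary Om gam n.
Hypothesis oOm : open Om.
Hypothesis bOm : bounded_set Om.

Lemma weight_y : exists2 D, 0 < D & forall i,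
  measurable_fun (`]0, 1[%classic : set R) (fun t => (n (gam i t)).2 * enorm (derive1 (gam i) t)) /\
  forall t : R, 0 < t < 1 -> `|(n (gam i t)).2 * enorm (derive1 (gam i) t)| <= D.
Proof.
have [D D0 H] := weight_x (boundary_sw oOm bnd) (open_sw oOm).
have dg i (t : R) : 0 < t < 1 -> derivable (gam i) t 1.
  move=> t01; case: bnd => _ C1 _ _ _; have [_ Cg] := C1 i; have [d0 _] := Cg [::] isT.
  by apply: d0 => //=; rewrite in_itv.
exists D; first exact: D0.
move=> i; have [mf b] := H i; split.
  apply: eq_measurable_fun mf => t; rewrite inE/= in_itv/= => t01.
  by rewrite swK derive1_sw ?enorm_sw//; exact: dg.
by move=> t t01; have := b t t01; rewrite /= swK derive1_sw ?enorm_sw//; exact: dg.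
Qed.

Variables F H : R * R -> R.
Hypothesis cF : {within closure Om, continuous F}.
Hypothesis cH : {within closure Om, continuous H}.
Hypothesis dF : forall z, Om z -> is_derive z (0, 1) F (H z).

Lemma green_y : \int[mu2]_(z in Om) H z = line_integral gam (fun z => F z * (n z).2).
Proof.
have [M M0 HM] := compact_within_bounded (bounded_closure_compact bOm) cH.
have csw : {within sw @^-1` closure Om, continuous sw}.
  by apply: continuous_subspaceT; exact: sw_continuous.
rewrite -(@integral_sw Om H M)//; last 2 first.
- exact: within_closure_continuous.
- by move=> z Oz; apply: HM; exact: subset_closure.
have cF' : {within closure (sw @^-1` Om), continuous (F \o sw)}.
  by rewrite closure_sw; apply: (within_comp _ csw cF).
have cH' : {within closure (sw @^-1` Om), continuous (H \o sw)}.
  by rewrite closure_sw; apply: (within_comp _ csw cH).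
have dF' z : (sw @^-1` Om) z -> is_derive z (1, 0) (F \o sw) ((H \o sw) z).
  move=> Oz; have [d dE] := dF Oz.
  have E : (fun h : R => h^-1 *: ((F \o shift (sw z)) (h *: (0, 1)) - F (sw z))) =
      (fun h : R => h^-1 *: (((F \o sw) \o shift z) (h *: (1, 0)) - (F \o sw) z)) by [].
  by split; [move: d|move: dE]; rewrite /derivable /derive E.
have gx := green_x (boundary_sw oOm bnd) (open_sw oOm) (bounded_sw bOm) cF' cH' dF'.
etransitivity; first exact: gx.
(* Comparison on the open interval suffices; there [gam i] is differentiable and [derive1] commutes
   with [sw]. *)
apply: eq_bigr => i _; apply/esym; apply: Rintegral_itvoo_eq.
  have [D _ /(_ i) [mw _]] := weight_y.
  apply: (@eq_measurable_fun _ _ _ _ _ (fun t => F (gam i t) * ((n (gam i t)).2 * enorm (derive1 (gam i) t)))).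
    by move=> t _; rewrite mulrA.
  apply: measurable_funM => //.
  have cFg : {within `[0, 1], continuous (fun t => F (gam i t))}.
    apply: (@within_comp _ _ _ _ (closure Om)) cF; last exact: (@arc_continuous _ _ _ _ _ bnd i).
    move=> t t01; have : boundary Om (gam i t) by case: bnd => -> _ _ _ _; exists i => //; exists t.
    by case.
  by apply: measurable_funS (subspace_continuous_measurable_fun _ cFg) => //; exact: subset_itv_oo_cc.
move=> t t01; have d : derivable (gam i) t 1.
  case: bnd => _ C1 _ _ _; have [_ Cg] := C1 i; have [d0 _] := Cg [::] isT.
  by apply: d0 => //=; rewrite in_itv.
by rewrite /= swK derive1_sw// enorm_sw.
Qed.
End Swap.

(** * Continuity up to the closure *)

Section ContExt.
Variables (R : realType) (V : normedModType R) (U : set V).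

(** [f] agrees along [U] with [h], which is continuous at [z], and the filter is proper since [z] is
    in the closure, so the limit is unique. This evaluates [strain_ext] on the closed cylinder. *)
Lemma cont_extE (f h : V -> R) z : {within closure U, continuous h} ->
  (forall x, U x -> h x = f x) -> closure U z -> cont_ext U f z = h z.
Proof.
move=> /subspace_continuousP ch hf cz.
have pf : ProperFilter (within U (nbhs z)).
  by apply: within_nbhs_proper.
apply: cvg_lim => //.
move=> B /(ch _ cz) /= hB; move: hB; rewrite /nbhs/= /within/=; apply: filterS => x H Ux.
by rewrite -hf//; apply: H => //; exact: subset_closure.
Qed.
End ContExt.

(** * One-sided derivatives at the ends of an interval *)

Section OneSided.
Variable R : realType.
Variables (f df : R -> R) (a b : R).
Hypothesis ab : a < b.
Hypothesis cf : {within `[a, b], continuous f}.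
Hypothesis cdf : {within `[a, b], continuous df}.
Hypothesis fdf : forall t, a < t < b -> is_derive t 1 f (df t).

Lemma right_derivative : (r^-1 * (f (a + r) - f a)) @[r --> 0^'+] --> df a.
Proof.
have [_ ca _] := (continuous_within_itvP _ ab).1 cdf.
apply/cvgrPdist_lt => e e0; move/cvgrPdist_lt : ca => /(_ e e0) [d /= d0 Hd].
apply: (@near0_right_itv _ (Num.min d (b - a))); first by rewrite lt_min d0 subr_gt0.
move=> r; rewrite lt_min => /andP[r0 /andP[rd rb]].
have aar : a < a + r by rewrite ltrDl.
have arb : a + r < b by rewrite addrC -ltrBrDr.
have [] := @MVT R f df a (a + r) aar.
- by move=> x; rewrite in_itv/= => /andP[ax xr]; apply: fdf; rewrite ax (lt_trans xr arb).
- apply: continuous_subspaceW cf => x /=; rewrite !in_itv/= => /andP[-> xr].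
  by rewrite (le_trans xr)// ltW.
move=> c; rewrite in_itv/= => /andP[ac cr] ->.
have -> : r^-1 * (df c * (a + r - a)) = df c by field; rewrite gt_eqF.
apply: Hd => //=; rewrite distrC gtr0_norm ?subr_gt0// ltrBlDl.
by apply: lt_trans cr _; rewrite ltrD2l.
Qed.

Lemma left_derivative : (r^-1 * (f (b + r) - f b)) @[r --> 0^'-] --> df b.
Proof.
have [_ _ cb] := (continuous_within_itvP _ ab).1 cdf.
apply/cvgrPdist_lt => e e0; move/cvgrPdist_lt : cb => /(_ e e0) [d /= d0 Hd].
exists (Num.min d (b - a)); first by rewrite /= lt_min d0 subr_gt0.
move=> r /=; rewrite sub0r normrN => rm r0; move: rm; rewrite ltr0_norm// lt_min => /andP[rd rb].
have bbr : b + r < b by rewrite gtrDl.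
have abr : a < b + r by rewrite -ltrBlDl; lra.
have [] := @MVT R f df (b + r) b bbr.
- by move=> x; rewrite in_itv/= => /andP[ax xr]; apply: fdf; rewrite xr (lt_trans abr ax).
- apply: continuous_subspaceW cf => x /=; rewrite !in_itv/= => /andP[bx ->].
  by rewrite (le_trans _ bx)// ltW.
move=> c; rewrite in_itv/= => /andP[rc cb] fE.
have -> : r^-1 * (f (b + r) - f b) = df c.
  by rewrite -opprB fE; field; rewrite lt_eqF.
by apply: Hd => //=; rewrite gtr0_norm ?subr_gt0//; lra.
Qed.
End OneSided.

Section Cylinder.
Variable R : realType.
Variables (Om : set (R * R)) (T : R).
Hypothesis T0 : 0 < T.

Lemma closure_cylinderP (z : R * R * R) :
  closure (cylinder Om T) z <-> closure Om z.1 /\ 0 <= z.2 <= T.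
Proof.
case: z => x t /=; split.
- move=> cz; split.
    move=> B nB; have : nbhs (x, t) (B `*` setT).
      by exists (B, setT) => //=; split => //; exact: filterT.
    by move=> /cz[[x' t'] [[/= Ox' _] [Bx' _]]]; exists x'.
  have H : closure (`]0, T[%classic : set R) t.
    move=> B nB; have : nbhs (x, t) (setT `*` B).
      by exists (setT, B) => //=; split => //; exact: filterT.
    by move=> /cz[[x' t'] [[/= _ t0T] [_ Bt']]]; exists t'; split => //=; rewrite in_itv.
  by have := itv_closure H; rewrite /= in_itv.
- move=> [cx t0T] B [[B1 B2] /= [n1 n2] sB].
  have [x' [Ox' B1x']] := cx _ n1.
  have ct : closure (`]0, T[%classic : set R) t.
    move=> D /nbhs_ballP[e /= e0 eD].
    pose m0 := Num.min (e / 2 / T) (1/2).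
    have m0p : 0 < m0 by rewrite lt_min !divr_gt0//=; lra.
    have m1 : m0 <= 1/2 by rewrite ge_min lexx orbT.
    have me : m0 * T <= e / 2 by rewrite -ler_pdivlMr// ge_min lexx.
    exists (t + m0 * (T / 2 - t)); move/andP: t0T => [t0 tT].
    have q1 : 0 <= (1 - m0) * t by rewrite mulr_ge0//; lra.
    have q2 : 0 <= (1 - m0) * (T - t) by rewrite mulr_ge0//; lra.
    have q3 : 0 < m0 * T by rewrite mulr_gt0.
    split; first by rewrite /= in_itv/=; apply/andP; lra.
    apply: eD; rewrite /ball/= opprD addNKr normrN normrM (gtr0_norm m0p).
    have : `|T / 2 - t| <= T by rewrite ler_norml; lra.
    move=> h; have : m0 * `|T / 2 - t| <= m0 * T by rewrite ler_pM2l.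
    lra.
  have [t' [t'T B2t']] := ct _ n2.
  exists (x', t'); split; first by split => //; move: t'T; rewrite /= in_itv.
  by apply: sB.
Qed.

Lemma cylinder_open : open Om -> open (cylinder Om T).
Proof.
move=> oOm.
have -> : cylinder Om T = (fst @^-1` Om) `&` (snd @^-1` `]0, T[%classic).
  by apply/seteqP; split => z /=; rewrite in_itv.
apply: openI; apply: open_comp.
- by move=> [x t] _; exact: cvg_fst.
- exact: oOm.
- by move=> [x t] _; exact: cvg_snd.
- exact: interval_open.
Qed.

Lemma compact_closure_cylinder : bounded_set Om -> compact (closure (cylinder Om T)).
Proof.
move=> bOm.
have -> : closure (cylinder Om T) = closure Om `*` `[0, T]%classic.
  apply/seteqP; split => z; first by move=> /closure_cylinderP[? ?]; split; rewrite /= ?in_itv.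
  by move=> [? zT]; apply/closure_cylinderP; split => //; move: zT; rewrite /= in_itv.
by apply: compact_setX; [exact: bounded_closure_compact|exact: segment_compact].
Qed.
End Cylinder.

(** * Continuity of integrals depending on time *)

Section Param.
Variable R : realType.
Variables (Om : set (R * R)) (T : R).
Hypothesis T0 : 0 < T.
Hypothesis bOm : bounded_set Om.
Variable K : R * R * R -> R.
Hypothesis cK : {within closure (cylinder Om T), continuous K}.

(* The library's continuity under the integral sign asks for an open interval of
   parameters; clamping extends the integrand beyond [0, T]. *)
Let clamp (s : R) : R := Num.max 0 (Num.min s T).

Lemma clamp_itv s : 0 <= clamp s <= T.
Proof. by rewrite /clamp le_max lexx ge_max (ltW T0) ge_min lexx orbT. Qed.

Lemma clamp_id s : 0 <= s <= T -> clamp s = s.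
Proof. by move=> /andP[s0 sT]; rewrite /clamp min_l// max_r. Qed.

Lemma clamp_continuous : continuous clamp.
Proof.
move=> s; apply: (@continuous_max _ _ (fun=> 0) (fun s => Num.min s T)); first exact: cvg_cst.
by apply: continuous_min; [exact: cvg_id|exact: cvg_cst].
Qed.

(** The map [p] and the weight [w] let one lemma serve two cases: arcs with a normal weight, and
    [Om] itself with weight 1. Domination is by a bound of [K] on the compact closed cylinder, times
    [|w|]. *)
Lemma param_continuous d (Y : measurableType d) (mu : {measure set Y -> \bar R})
    (D : set Y) (p : Y -> R * R) (w : Y -> R) :
  measurable D -> (forall y, D y -> closure Om (p y)) -> mu.-integrable D (EFin \o w) ->
  (forall t, 0 <= t <= T -> measurable_fun D (fun y => K (p y, t) * w y)) ->
  {within `[0, T], continuous (fun t => \int[mu]_(y in D) (K (p y, t) * w y))}.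
Proof.
move=> mD pD iw mK.
have [M M0 KM] := compact_within_bounded (compact_closure_cylinder T0 bOm) cK.
have inC y s : D y -> closure (cylinder Om T) (p y, clamp s).
  by move=> Dy; apply/(closure_cylinderP _ T0); split; [exact: pD|exact: clamp_itv].
pose f s y := K (p y, clamp s) * w y.
have bf s y : D y -> `|f s y| <= M * `|w y|.
  by move=> Dy; rewrite normrM ler_wpM2r//; apply: KM; exact: inC.
have iMw : mu.-integrable D (EFin \o (fun y => M * `|w y|)).
  have := integrableZl mD M (integrable_norm iw).
  by apply: eq_integrable => // y _.
have intf s : mu.-integrable D (EFin \o f s).
  apply: (le_integrable mD _ _ iMw).
    by apply/measurable_EFinP; apply: mK; exact: clamp_itv.
  move=> y Dy; rewrite /= lee_fin [leRHS]ger0_norm ?bf//.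
  by rewrite mulr_ge0// ltW.
have cont := @continuity_under_integral R d Y mu f D mD (-1) (T + 1) (fun s _ => intf s) _
  (fun y => M * `|w y|) iMw (fun s _ => aeW _ (bf s)).
have {}cont : {in `](-1), (T + 1)[%classic, continuous (fun s => \int[mu]_(y in D) f s y)}.
  apply: cont; apply: aeW => y Dy s _.
  have cpc : continuous (fun s : R => (p y, clamp s)).
    move=> r; have c1 : (fun _ : R => p y) @ r --> p y by exact: cvg_cst.
    exact: (cvg_pair c1 (@clamp_continuous r)).
  have cKs : {within setT, continuous (K \o (fun s : R => (p y, clamp s)))}.
    by apply: (@within_comp _ _ _ _ (closure (cylinder Om T))) cK; [move=> r _; exact: inC|exact: continuous_subspaceT].
  have {}cKs := (continuous_subspace_setT _).2 cKs.
  by apply: cvgM; [exact: cKs|exact: cvg_cst].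
apply: (@subspace_eq_continuous _ _ _ (fun s => \int[mu]_(y in D) f s y)).
  move=> t; rewrite inE/= in_itv/= => t0T; apply: eq_Rintegral => y _.
  by rewrite /f clamp_id.
apply: continuous_in_subspaceT => t; rewrite inE/= in_itv/= => /andP[t0 tT].
by apply: cont; rewrite inE/= in_itv/=; apply/andP; split; lra.
Qed.
End Param.

(** * Fluxes through the boundary *)

Section Flux.
Variable R : realType.
Notation mu := (@lebesgue_measure R).
Notation mu2 := (@lebesgue_measure R \x @lebesgue_measure R)%E.
Variables (Om : set (R * R)) (m : nat) (gam : 'I_m -> R -> R * R).
Hypothesis cgam : forall i, {within `[0, 1], continuous (gam i)}.
Hypothesis gcl : forall i t, `[0, 1]%classic t -> closure Om (gam i t).
Hypothesis bOm : bounded_set Om.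

Lemma lebesgue_itv01_lty : (mu `]0%R, 1%R[%classic < +oo)%E.
Proof. by rewrite lebesgue_measure_itv/= lte_fin ltr01 -EFinB ltry. Qed.

(** Meant for the boundary integral of [A] against one component of the normal: that component and
    the speed are put in [w], so that linearity and continuity in time ask of [A] only
    continuity. *)
Definition flux (w : 'I_m -> R -> R) (A : R * R -> R) : R :=
  \sum_i \int[mu]_(t in `]0, 1[) (A (gam i t) * w i t).

Variable w : 'I_m -> R -> R.
Hypothesis bw : exists2 D, 0 < D & forall i,
  measurable_fun (`]0, 1[%classic : set R) (w i) /\ forall t : R, 0 < t < 1 -> `|w i t| <= D.

Lemma flux_measurable (A : R * R -> R) i : {within closure Om, continuous A} ->
  measurable_fun (`]0, 1[%classic : set R) (fun t => A (gam i t) * w i t).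
Proof.
move=> cA; have [D _ /(_ i)[mw _]] := bw.
apply: measurable_funM => //.
have cAg : {within `[0, 1], continuous (fun t => A (gam i t))}.
  exact: (@within_comp _ _ _ _ (closure Om) _ _ (@gcl i) (@cgam i) cA).
by apply: measurable_funS (subspace_continuous_measurable_fun _ cAg) => //; exact: subset_itv_oo_cc.
Qed.

Lemma weight_integrable i : mu.-integrable `]0, 1[ (EFin \o w i).
Proof.
have [D _ /(_ i)[mw wD]] := bw.
apply: (integrable_le_cst (M := D)).
- exact: measurable_itv.
- exact: lebesgue_itv01_lty.
- exact: mw.
- by move=> t; rewrite /= in_itv/=; exact: wD.
Qed.

Lemma flux_integrable (A : R * R -> R) i : {within closure Om, continuous A} ->
  mu.-integrable `]0, 1[ (EFin \o (fun t => A (gam i t) * w i t)).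
Proof.
move=> cA; have [D _ /(_ i)[mw wD]] := bw.
have [M M0 AM] := compact_within_bounded (bounded_closure_compact bOm) cA.
apply: (integrable_le_cst (M := M * D)).
- exact: measurable_itv.
- exact: lebesgue_itv01_lty.
- exact: flux_measurable.
- move=> t /[dup] t01; rewrite /= in_itv/= => t01'; rewrite normrM ler_pM//; last exact: wD.
  by apply: AM; apply: gcl; exact: (subset_itv_oo_cc t01).
Qed.

Lemma fluxD (A B : R * R -> R) : {within closure Om, continuous A} -> {within closure Om, continuous B} ->
  flux w (fun z => A z + B z) = flux w A + flux w B.
Proof.
move=> cA cB; rewrite /flux -big_split/=; apply: eq_bigr => i _.
rewrite -RintegralD//; [|exact: flux_integrable|exact: flux_integrable].
by apply: eq_Rintegral => t _; rewrite mulrDl.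
Qed.

Lemma fluxZ (c : R) (A : R * R -> R) : {within closure Om, continuous A} -> flux w (fun z => c * A z) = c * flux w A.
Proof.
move=> cA; rewrite /flux mulr_sumr; apply: eq_bigr => i _.
rewrite -RintegralZl//; last exact: flux_integrable.
by apply: eq_Rintegral => t _; rewrite mulrA.
Qed.

Lemma flux_lin3 (c d e : R) (A B C : R * R -> R) : {within closure Om, continuous A} ->
  {within closure Om, continuous B} -> {within closure Om, continuous C} ->
  flux w (fun z => c * A z + d * B z + e * C z) = c * flux w A + d * flux w B + e * flux w C.
Proof.
move=> cA cB cC.
have cZ k (F : R * R -> R) : {within closure Om, continuous F} -> {within closure Om, continuous (fun z => k * F z)}.
  by move=> cF z; apply: cvgM; [exact: cvg_cst|exact: cF].
rewrite fluxD; [|by move=> z; apply: cvgD; [exact: (cZ c _ cA)|exact: (cZ d _ cB)]|exact: cZ].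
by rewrite fluxD; [rewrite !fluxZ|exact: cZ|exact: cZ].
Qed.

Lemma flux_continuous (T : R) (K : R * R * R -> R) : 0 < T ->
  {within closure (cylinder Om T), continuous K} ->
  {within `[0, T], continuous (fun t => flux w (fun z => K (z, t)))}.
Proof.
move=> T0 cK t; rewrite /flux.
apply: cvg_seq_sum => i.
apply: (@param_continuous R Om T T0 bOm K cK _ _ mu `]0, 1[%classic (gam i) (w i)) => //.
- by move=> s s01; apply: gcl; exact: (subset_itv_oo_cc s01).
- exact: weight_integrable.
- move=> s s0T; apply: (@flux_measurable (fun z => K (z, s))).
  apply: (@within_comp _ _ _ _ (closure (cylinder Om T)) (fun z : R * R => (z, s)) K) => //.
    by move=> z cz; apply/(closure_cylinderP _ T0).
  apply: continuous_subspaceT => z.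
  by have c1 : (fun _ : R * R => s) @ z --> s by [exact: cvg_cst]; exact: (cvg_pair (@cvg_id _ (nbhs z)) c1).
Qed.
End Flux.

Section Divergence.
Variable R : realType.
Notation mu := (@lebesgue_measure R).
Notation mu2 := (@lebesgue_measure R \x @lebesgue_measure R)%E.
Variables (Om : set (R * R)) (m : nat) (gam : 'I_m -> R -> R * R) (n : R * R -> R * R).
Hypothesis bnd : piecewise_C1_boundary Om gam n.
Hypothesis oOm : open Om.
Hypothesis bOm : bounded_set Om.

Definition normal_weight1 i t := (n (gam i t)).1 * enorm (derive1 (gam i) t).
Definition normal_weight2 i t := (n (gam i t)).2 * enorm (derive1 (gam i) t).

Lemma arc_closure i t : `[0, 1]%classic t -> closure Om (gam i t).
Proof.
move=> t01; have : boundary Om (gam i t) by case: bnd => -> _ _ _ _; exists i => //; exists t.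
by case.
Qed.

Lemma normal_weight1_bounded : exists2 D, 0 < D & forall i,
  measurable_fun (`]0, 1[%classic : set R) (normal_weight1 i) /\ forall t : R, 0 < t < 1 -> `|normal_weight1 i t| <= D.
Proof. exact: (weight_x bnd oOm). Qed.

Lemma normal_weight2_bounded : exists2 D, 0 < D & forall i,
  measurable_fun (`]0, 1[%classic : set R) (normal_weight2 i) /\ forall t : R, 0 < t < 1 -> `|normal_weight2 i t| <= D.
Proof. exact: (weight_y bnd oOm). Qed.

(** Expanding [f] along the two components of the normal moves [n] into the weights, where its
    measurability along the arcs is known. *)
Lemma line_integral_flux (f A B : R * R -> R) : {within closure Om, continuous A} ->
  {within closure Om, continuous B} -> (forall z, closure Om z -> f z = A z * (n z).1 + B z * (n z).2) ->
  line_integral gam f = flux gam normal_weight1 A + flux gam normal_weight2 B.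
Proof.
move=> cA cB fE; rewrite /line_integral /flux -big_split/=; apply: eq_bigr => i _.
have mX := flux_measurable (@arc_continuous _ _ _ _ _ bnd) arc_closure normal_weight1_bounded i cA.
have mY := flux_measurable (@arc_continuous _ _ _ _ _ bnd) arc_closure normal_weight2_bounded i cB.
rewrite -RintegralD//; [|exact: (flux_integrable (@arc_continuous _ _ _ _ _ bnd) arc_closure bOm normal_weight1_bounded)
  |exact: (flux_integrable (@arc_continuous _ _ _ _ _ bnd) arc_closure bOm normal_weight2_bounded)].
rewrite -(@Rintegral_itvoo_eq R 0 1 (fun t => A (gam i t) * normal_weight1 i t + B (gam i t) * normal_weight2 i t)).
- rewrite /Rintegral integral_itv_bndoo//; apply/measurable_EFinP.
  exact: measurable_funD.
- exact: measurable_funD.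
- move=> t /andP[t0 t1]; rewrite fE; first by rewrite /normal_weight1 /normal_weight2 mulrDl !mulrA.
  by apply: arc_closure; rewrite /= in_itv/= !ltW.
Qed.

Lemma divergence (F1 F2 H1 H2 : R * R -> R) :
  {within closure Om, continuous F1} -> {within closure Om, continuous F2} ->
  {within closure Om, continuous H1} -> {within closure Om, continuous H2} ->
  (forall z, Om z -> is_derive z (1, 0) F1 (H1 z)) -> (forall z, Om z -> is_derive z (0, 1) F2 (H2 z)) ->
  \int[mu2]_(z in Om) (H1 z + H2 z) = flux gam normal_weight1 F1 + flux gam normal_weight2 F2.
Proof.
move=> cF1 cF2 cH1 cH2 d1 d2.
have iH (H : R * R -> R) : {within closure Om, continuous H} -> mu2.-integrable Om (EFin \o H).
  move=> cH; have [M M0 HM] := compact_within_bounded (bounded_closure_compact bOm) cH.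
  apply: (plane_integrable (M := M)) => //; first exact: within_closure_continuous.
  by move=> z Oz; apply: HM; exact: subset_closure.
rewrite RintegralD//; [|exact: open_measurable_prod|exact: iH|exact: iH].
(* Each Green formula involves one component of the normal; the flux along the other is that of the
   zero function. *)
have c0 : {within closure Om, continuous (fun _ : R * R => 0 : R)} by move=> z; exact: cvg_cst.
have fl0 w' : flux gam w' (fun=> 0) = 0.
  rewrite /flux big1// => i _; rewrite (_ : (fun t => _) = cst 0) ?Rintegral_cst ?mul0r//.
  by apply/funext => t; rewrite mul0r.
congr (_ + _).
  rewrite (green_x bnd oOm bOm cF1 cH1 d1).
  by rewrite (line_integral_flux cF1 c0) ?fl0 ?addr0// => z _; rewrite mul0r addr0.
rewrite (green_y bnd oOm bOm cF2 cH2 d2).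
by rewrite (line_integral_flux c0 cF2) ?fl0 ?add0r// => z _; rewrite mul0r add0r.
Qed.
End Divergence.

(** * Calculus of functions with derivatives extending to the closure *)

Section C1D.
Variables (R : realType) (V : normedModType R) (U : set V).
Hypothesis oU : open U.

Definition extends_to_closure (W : normedModType R) (f : V -> W) : Prop :=
  exists2 h : V -> W, {within closure U, continuous h} & forall z, U z -> h z = f z.

(* df may be junk on the boundary (it comes from derivatives in U), so only an extension of it is continuous. *)
Definition C1D (W : normedModType R) (v : V) (f df : V -> W) : Prop :=
  [/\ {within closure U, continuous f}, forall z, U z -> is_derive z v f (df z) & extends_to_closure df].

Lemma extends_to_closure_within (W : normedModType R) (f : V -> W) : {within closure U, continuous f} ->
  extends_to_closure f.
Proof. by exists f. Qed.

Lemma extends_to_closure_eq (W : normedModType R) (f g : V -> W) :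
  (forall z, U z -> f z = g z) -> extends_to_closure f -> extends_to_closure g.
Proof. by move=> fg [h ch hf]; exists h => // z Uz; rewrite hf// fg. Qed.

Lemma extends_to_closureD (W : normedModType R) (f g : V -> W) : extends_to_closure f -> extends_to_closure g ->
  extends_to_closure (fun z => f z + g z).
Proof.
move=> [h ch hf] [k ck kg]; exists (fun z => h z + k z) => [z|z Uz].
  by apply: cvgD; [exact: ch|exact: ck].
by rewrite hf ?kg.
Qed.

Lemma extends_to_closureM (f g : V -> R) : extends_to_closure f -> extends_to_closure g ->
  extends_to_closure (fun z => f z * g z).
Proof.
move=> [h ch hf] [k ck kg]; exists (fun z => h z * k z) => [z|z Uz].
  by apply: cvgM; [exact: ch|exact: ck].
by rewrite hf ?kg.
Qed.

Lemma C1D_cst v (c : R) : C1D v (fun=> c) (fun=> 0).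
Proof.
split; first by move=> z; exact: cvg_cst.
  by move=> z _; exact: is_derive_cst.
by apply: extends_to_closure_within => z; exact: cvg_cst.
Qed.

Lemma C1D_add v (f df g dg : V -> R) : C1D v f df -> C1D v g dg ->
  C1D v (fun z => f z + g z) (fun z => df z + dg z).
Proof.
move=> [cf hf ef] [cg hg eg]; split.
- by move=> z; apply: cvgD; [exact: cf|exact: cg].
- by move=> z Uz; have hfz := hf z Uz; have hgz := hg z Uz; exact: is_deriveD.
- exact: extends_to_closureD.
Qed.

Lemma C1D_mul v (f df g dg : V -> R) : C1D v f df -> C1D v g dg ->
  C1D v (fun z => f z * g z) (fun z => df z * g z + f z * dg z).
Proof.
move=> [cf hf ef] [cg hg eg]; split.
- by move=> z; apply: cvgM; [exact: cf|exact: cg].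
- move=> z Uz; have hfz := hf z Uz; have hgz := hg z Uz.
  rewrite addrC [df z * _]mulrC; exact: is_deriveM.
- by apply: extends_to_closureD; apply: extends_to_closureM => //; exact: extends_to_closure_within.
Qed.

Lemma C1D_scale v (c : R) (f df : V -> R) : C1D v f df ->
  C1D v (fun z => c * f z) (fun z => c * df z).
Proof.
move=> hf; have [ch h e] := C1D_mul (C1D_cst v c) hf.
have E z : 0 * f z + c * df z = c * df z by rewrite mul0r add0r.
split => //; first by move=> z Uz; rewrite -E; exact: h.
by apply: extends_to_closure_eq e => z _; exact: E.
Qed.

Lemma C1D_fst v (f df : V -> R * R) : C1D v f df -> C1D v (fun z => (f z).1) (fun z => (df z).1).
Proof.
move=> [cf hf [h ch hE]]; split; first exact: within_fst.
  by move=> z Uz; have hfz := hf z Uz; exact: (is_derive_fst hfz).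
by exists (fun z => (h z).1); [exact: within_fst|move=> z /hE ->].
Qed.

Lemma C1D_snd v (f df : V -> R * R) : C1D v f df -> C1D v (fun z => (f z).2) (fun z => (df z).2).
Proof.
move=> [cf hf [h ch hE]]; split; first exact: within_snd.
  by move=> z Uz; have hfz := hf z Uz; exact: (is_derive_snd hfz).
by exists (fun z => (h z).2); [exact: within_snd|move=> z /hE ->].
Qed.

Lemma is_derive_eq_on (W : normedModType R) (f g : V -> W) z v df : U z ->
  (forall x, U x -> f x = g x) -> is_derive z v f df -> is_derive z v g df.
Proof.
move=> Uz fg; apply: near_eq_is_derive.
have nU : \forall x \near z, U x := open_nbhs_nbhs (conj oU Uz).
by apply: filterS nU => x; exact: fg.
Qed.

Lemma smooth_C1D (W : normedModType R) v (f : V -> W) : smooth_closure U f -> C1D v f ('D_v f).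
Proof.
move=> /(_ 1%N)[cf Cf]; have [df _] := Cf [::] isT; have [_ ef] := Cf [:: v] isT.
by split => // z Uz; apply: derivableP; exact: df.
Qed.

(** ['D_w f] is controlled in [U] only. Its continuous extension [h] agrees with it on the open set
    [U], hence has the same derivatives there, and is continuous on the closure as [C1D] asks. *)
Lemma smooth_C1D2 (W : normedModType R) (f : V -> W) w : smooth_closure U f ->
  exists2 h : V -> W, (forall z, U z -> h z = 'D_w f z) &
   {within closure U, continuous h} /\ forall v, C1D v h ('D_v ('D_w f)).
Proof.
move=> /(_ 2%N)[_ Cf]; have [dwf [h ch hE]] := Cf [:: w] isT.
exists h => //; split => // v; have [_ evw] := Cf [:: v; w] isT.
split => // z Uz; apply: (is_derive_eq_on Uz (f := 'D_w f)); first by move=> x /hE.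
by apply: derivableP; exact: dwf.
Qed.
End C1D.

(** * Balance laws on the cylinder *)

Section Balance.
Variable R : realType.
Notation mu := (@lebesgue_measure R).
Notation mu2 := (@lebesgue_measure R \x @lebesgue_measure R)%E.
Variables (Om : set (R * R)) (T : R) (m : nat) (gam : 'I_m -> R -> R * R) (n : R * R -> R * R).
Hypothesis bnd : piecewise_C1_boundary Om gam n.
Hypothesis oOm : open Om.
Hypothesis bOm : bounded_set Om.
Hypothesis T0 : 0 < T.

Let U := cylinder Om T.
Let oU : open U := cylinder_open (T := T) oOm.

Lemma is_derive_slice_space (f : R * R * R -> R) x w t d :
  is_derive (x, t) (w, 0) f d -> is_derive x w (fun x => f (x, t)) d.
Proof.
move=> [fd dE].
have E : (fun h : R => h^-1 *: ((f \o shift (x, t)) (h *: (w, 0)) - f (x, t))) =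
    (fun h : R => h^-1 *: (((fun x => f (x, t)) \o shift x) (h *: w) - f (x, t))).
  apply/funext => h /=; congr (_ *: (f _ - _)).
  by transitivity (h *: w + x, h * 0 + t); [|rewrite mulr0 add0r].
by split; [move: fd|move: dE]; rewrite /derivable /derive E.
Qed.

Lemma is_derive_slice_time (f : R * R * R -> R) x (t d : R) :
  is_derive (x, t) (tdir R) f d -> is_derive t 1 (fun s => f (x, s)) d.
Proof.
move=> [fd dE].
have E : (fun h : R => h^-1 *: ((f \o shift (x, t)) (h *: tdir R) - f (x, t))) =
    (fun h : R => h^-1 *: (((fun s => f (x, s)) \o shift t) (h *: 1) - f (x, t))).
  apply/funext => h /=; congr (_ *: (f _ - _)).
  case: x {fd dE} => x1 x2.
  by transitivity ((h * 0 + x1, h * 0 + x2), h * 1 + t); [|rewrite mulr0 !add0r].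
by split; [move: fd|move: dE]; rewrite /derivable /derive E.
Qed.

Lemma within_slice (W : topologicalType) (K : R * R * R -> W) t : 0 <= t <= T ->
  {within closure U, continuous K} -> {within closure Om, continuous (fun x => K (x, t))}.
Proof.
move=> t0T cK; apply: (@within_comp _ _ _ _ (closure U) (fun z : R * R => (z, t)) K) => //.
  by move=> z cz; apply/(closure_cylinderP _ T0).
apply: continuous_subspaceT => z.
by have c1 : (fun _ : R * R => t) @ z --> t by [exact: cvg_cst]; exact: (cvg_pair (@cvg_id _ (nbhs z)) c1).
Qed.

(** [H] is a time slice of the extension of [df], so that the divergence theorem receives a function
    continuous on the whole of [closure Om]. *)
Lemma C1D_slice (f df : R * R * R -> R) w t : 0 < t < T -> C1D U (w, 0) f df ->
  exists H : R * R -> R, [/\ {within closure Om, continuous H},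
    forall x, Om x -> H x = df (x, t) & forall x, Om x -> is_derive x w (fun x => f (x, t)) (H x)].
Proof.
move=> t0T [cf hf [h ch hE]]; have t0T' : 0 <= t <= T by move/andP : t0T => [/ltW -> /ltW ->].
exists (fun x => h (x, t)); split.
- exact: within_slice.
- by move=> x Ox; rewrite hE.
- move=> x Ox; rewrite hE//.
  have Uxt : U (x, t) by [].
  have hfz := hf _ Uxt; exact: is_derive_slice_space.
Qed.

Lemma slice_integrable2 (K : R * R * R -> R) t : 0 <= t <= T -> {within closure U, continuous K} ->
  mu2.-integrable Om (EFin \o (fun x => K (x, t))).
Proof.
move=> t0T cK; have cKt := within_slice t0T cK.
have [M M0 HM] := compact_within_bounded (bounded_closure_compact bOm) cKt.
apply: (plane_integrable (M := M)) => //; first exact: within_closure_continuous.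
by move=> z Oz; apply: HM; exact: subset_closure.
Qed.

Lemma volume_continuous (K : R * R * R -> R) : {within closure U, continuous K} ->
  {within `[0, T], continuous (fun t => \int[mu2]_(x in Om) K (x, t))}.
Proof.
move=> cK.
have mOm := open_measurable_prod oOm.
have i1 : mu2.-integrable Om (EFin \o (fun=> 1 : R)).
  apply: (plane_integrable (M := 1)) => //; first by move=> z _; exact: cvg_cst.
  by move=> z _; rewrite normr1.
have := @param_continuous R Om T T0 bOm K cK _ _ mu2 Om id (fun=> 1) mOm (@subset_closure _ Om) i1.
rewrite (_ : (fun t => _) = (fun t => \int[mu2]_(x in Om) K (x, t))); last first.
  by apply/funext => t; apply: eq_Rintegral => x _; rewrite mulr1.
apply=> t t0T; apply: (@eq_measurable_fun _ _ _ _ _ (fun x => K (x, t))).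
  by move=> x _; rewrite mulr1.
by have /measurable_int/measurable_EFinP := slice_integrable2 t0T cK.
Qed.

(** The time derivative is dominated by a constant, a bound of the extension of [de] on the compact
    closed cylinder, which is integrable because [Om] is bounded. *)
Lemma leibniz (e de : R * R * R -> R) t : 0 < t < T -> C1D U (tdir R) e de ->
  is_derive t 1 (fun s => \int[mu2]_(x in Om) e (x, s)) (\int[mu2]_(x in Om) de (x, t)).
Proof.
move=> t0T [ce he [h ch hE]].
have mOm := open_measurable_prod oOm.
have [M M0 HM] := compact_within_bounded (compact_closure_cylinder T0 bOm) ch.
pose f s x := e (x, s).
have UI s x : `]0, T[%classic s -> Om x -> U (x, s).
  by rewrite /= in_itv/= => s0T Ox; split.
have df s x : `]0, T[%classic s -> Om x -> is_derive s 1 (f ^~ x) (de (x, s)).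
  by move=> sI Ox; have hz := he _ (UI s x sI Ox); exact: is_derive_slice_time.
have It : `]0, T[%classic t by rewrite /= in_itv.
have intf s : `]0, T[%classic s -> mu2.-integrable Om (EFin \o f s).
  rewrite /= in_itv/= => /andP[s0 sT]; apply: slice_integrable2 => //.
  by rewrite !ltW.
have derf s x : `]0, T[%classic s -> Om x -> derivable (f ^~ x) s 1.
  by move=> sI Ox; have [] := df s x sI Ox.
have intM : mu2.-integrable Om (EFin \o (fun=> M)).
  apply: (plane_integrable (M := M)) => //; first by move=> z _; exact: cvg_cst.
  by move=> z _; rewrite gtr0_norm.
have pE s x : `]0, T[%classic s -> Om x -> partial1of2 f s x = de (x, s).
  by move=> sI Ox; rewrite partial1of2E; have [_ ->] := df s x sI Ox.
have bM s x : `]0, T[%classic s -> Om x -> `|partial1of2 f s x| <= M.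
  move=> sI Ox; rewrite pE// -hE; last exact: UI.
  by apply: HM; apply: subset_closure; exact: UI.
have M0' (y : R * R) : 0 <= M by exact: ltW.
have D1 := @derivable_under_integral R _ _ mu2 f Om mOm t 0 T It intf derf (fun=> M) M0' intM bM.
have D2 := @differentiation_under_integral R _ _ mu2 f Om mOm t 0 T It intf derf (fun=> M) M0' intM bM.
split => //.
rewrite -derive1E D2; apply: eq_Rintegral => x; rewrite inE => Ox; exact: pE.
Qed.

Variables e de V1 dV1 V2 dV2 D : R * R * R -> R.
Hypothesis he : C1D U (tdir R) e de.
Hypothesis h1 : C1D U ((1, 0), 0) V1 dV1.
Hypothesis h2 : C1D U ((0, 1), 0) V2 dV2.
Hypothesis cD : {within closure U, continuous D}.
Hypothesis balance : forall z, U z -> de z = dV1 z + dV2 z + D z.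

(** Built from [V1], [V2] and [D] rather than from [de], the rate is meaningful and continuous up to
    the end times. *)
Definition balance_rate (t : R) :=
  flux gam (normal_weight1 gam n) (fun x => V1 (x, t)) +
    flux gam (normal_weight2 gam n) (fun x => V2 (x, t))
   + \int[mu2]_(x in Om) D (x, t).

Lemma balance_derive t : 0 < t < T ->
  is_derive t 1 (fun s => \int[mu2]_(x in Om) e (x, s)) (balance_rate t).
Proof.
move=> t0T; have t0T' : 0 <= t <= T by move/andP : t0T => [/ltW -> /ltW ->].
have [H1 [cH1 H1E d1]] := C1D_slice t0T h1.
have [H2 [cH2 H2E d2]] := C1D_slice t0T h2.
have [cV1 _ _] := h1; have [cV2 _ _] := h2.
rewrite /balance_rate -(divergence bnd oOm bOm (within_slice t0T' cV1) (within_slice t0T' cV2) cH1 cH2 d1 d2).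
have mOm := open_measurable_prod oOm.
have iH H : {within closure Om, continuous H} -> mu2.-integrable Om (EFin \o H).
  move=> cH; have [M M0 HM] := compact_within_bounded (bounded_closure_compact bOm) cH.
  apply: (plane_integrable (M := M)) => //; first exact: within_closure_continuous.
  by move=> z Oz; apply: HM; exact: subset_closure.
have cH12 : {within closure Om, continuous (fun z => H1 z + H2 z)}.
  by move=> z; apply: cvgD; [exact: cH1|exact: cH2].
rewrite -RintegralD//; [|exact: iH|exact: slice_integrable2].
have -> : \int[mu2]_(x in Om) (H1 x + H2 x + D (x, t)) = \int[mu2]_(x in Om) de (x, t).
  apply: eq_Rintegral => x; rewrite inE => Ox; rewrite H1E// H2E// balance//.
exact: leibniz.
Qed.

Lemma balance_law : let E := fun s => \int[mu2]_(x in Om) e (x, s) in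
  [/\ (forall t, 0 < t < T -> is_derive t 1 E (balance_rate t)),
      (r^-1 * (E (0 + r) - E 0)) @[r --> 0^'+] --> balance_rate 0 &
      (r^-1 * (E (T + r) - E T)) @[r --> 0^'-] --> balance_rate T].
Proof.
move=> E.
have [ce _ _] := he; have [cV1 _ _] := h1; have [cV2 _ _] := h2.
have cE : {within `[0, T], continuous E} := volume_continuous ce.
have cg := @arc_continuous _ _ _ _ _ bnd; have cl := arc_closure bnd.
have crate : {within `[0, T], continuous balance_rate}.
  have f1 := flux_continuous cg cl bOm (normal_weight1_bounded bnd oOm) T0 cV1.
  have f2 := flux_continuous cg cl bOm (normal_weight2_bounded bnd oOm) T0 cV2.
  have f3 := volume_continuous cD.
  by move=> t; apply: cvgD; [apply: cvgD; [exact: f1|exact: f2]|exact: f3].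
split.
- exact: balance_derive.
- exact: (right_derivative T0 cE crate balance_derive).
- exact: (left_derivative T0 cE crate balance_derive).
Qed.
End Balance.

(** * The energy of the shallow water equations *)

Lemma sum_ord2 (R : nmodType) (f : 'I_2 -> R) : \sum_(i < 2) f i = f 0 + f 1.
Proof. by rewrite 2!big_ord_recl big_ord0 addr0; congr (_ + f _); apply/val_inj. Qed.

Section PDE.
Variable R : realType.
Variables (Om : set (R * R)) (T rho mu g : R) (zeta : R * R -> R).
Variables (phi eta : R * R * R -> R) (u : R * R * R -> R * R).
Hypothesis oOm : open Om.
Hypothesis T0 : 0 < T.
Hypothesis zetaC1 : Ck_closure 1 Om zeta.
Hypothesis phi_smooth : smooth_closure (cylinder Om T) phi.
Hypothesis u_smooth : smooth_closure (cylinder Om T) u.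
Hypothesis eta_cont : {within closure (cylinder Om T), continuous eta}.
Hypothesis height : forall z, cylinder Om T z -> phi z = eta z + zeta z.1.

Let U := cylinder Om T.
Let oU : open U := cylinder_open (T := T) oOm.

(** Only continuity of [eta] is assumed; its derivatives come from [eta = phi - zeta] in the
    cylinder, [zeta] being differentiated along the spatial part of [v]. *)
Lemma C1D_eta_val v : C1D U v eta (fun z => 'D_v phi z + - 'D_(v.1) zeta z.1).
Proof.
have [_ hp ep] := smooth_C1D v phi_smooth.
have [_ Cz] := zetaC1; have [dz _] := Cz [::] isT; have [_ [k ck kE]] := Cz [:: v.1] isT.
split => //.
- move=> z Uz; apply: (is_derive_eq_on oU Uz (f := fun z => phi z - zeta z.1)).
    by move=> x /height ->; rewrite addrK.
  have hz := hp z Uz.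
  have hzeta : is_derive z v (fun z => zeta z.1) ('D_(v.1) zeta z.1).
    have := dz z.1 v.1 Uz.1 isT => d.
    have E : (fun h : R => h^-1 *: ((zeta \o shift z.1) (h *: v.1) - zeta z.1)) =
      (fun h : R => h^-1 *: (((fun z => zeta z.1) \o shift z) (h *: v) - zeta z.1)) by [].
    by split; rewrite /derivable /derive -E.
  exact: is_deriveB.
- apply: extends_to_closureD => //; exists (fun z => - k z.1); last by move=> z Uz; rewrite kE//; exact: Uz.1.
  move=> z; apply: cvgN.
  apply: (@within_comp _ _ _ _ (closure Om) (fun z : R * R * R => z.1) k) => //.
    by move=> w /(closure_cylinderP _ T0)[].
  by apply: continuous_subspaceT; case=> x t; exact: cvg_fst.
Qed.

Lemma C1D_derive (W : normedModType R) v (f df : R * R * R -> W) z : C1D U v f df -> U z -> 'D_v f z = df z.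
Proof. by move=> [_ h _] Uz; have hz := h z Uz; exact: derive_val. Qed.

Lemma C1D_eta v : C1D U v eta ('D_v eta).
Proof.
have [c h [k ck kE]] := C1D_eta_val v; split => //.
  by move=> z Uz; rewrite (C1D_derive (C1D_eta_val v) Uz); exact: h.
by exists k => // z Uz; rewrite (C1D_derive (C1D_eta_val v) Uz); exact: kE.
Qed.

(** [zeta] does not depend on time: the spatial part of [tdir] is zero. *)
Lemma eta_dt z : U z -> 'D_(tdir R) eta z = 'D_(tdir R) phi z.
Proof.
move=> Uz; rewrite (C1D_derive (C1D_eta_val (tdir R)) Uz).
have -> : 'D_(tdir R).1 zeta z.1 = 0 by exact: derive0.
by rewrite oppr0 addr0.
Qed.

(** The entries of the strain are replaced by functions continuous on the closed cylinder and
    differentiable inside in every direction, by the second order smoothness of [u]. Symmetry leaves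
    three, and [d00], [d01], [d11] take the direction as first argument. *)
Lemma strain_C1D : exists S00 S01 S11 : R * R * R -> R, exists d00 d01 d11 : R * R * R -> R * R * R -> R,
  [/\ [/\ (forall v, C1D U v S00 (d00 v)), (forall v, C1D U v S01 (d01 v)) & (forall v, C1D U v S11 (d11 v))],
      (forall z, U z -> [/\ S00 z = ('D_(xdir R 0) u z).1, S11 z = ('D_(xdir R 1) u z).2 &
                 2 * S01 z = ('D_(xdir R 1) u z).1 + ('D_(xdir R 0) u z).2]),
      (forall z, U z -> [/\ strain u z 0 0 = S00 z, strain u z 0 1 = S01 z, strain u z 1 0 = S01 z &
                         strain u z 1 1 = S11 z]) &
      (forall z, closure U z -> [/\ strain_ext Om T u z 0 0 = S00 z, strain_ext Om T u z 0 1 = S01 z,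
                         strain_ext Om T u z 1 0 = S01 z & strain_ext Om T u z 1 1 = S11 z])].
Proof.
have [h0 h0E [_ h0D]] := smooth_C1D2 oU (xdir R 0) u_smooth.
have [h1 h1E [_ h1D]] := smooth_C1D2 oU (xdir R 1) u_smooth.
have c2 v := C1D_cst U v (2^-1 : R).
have H00 v := C1D_mul (c2 v) (C1D_add (C1D_fst (h0D v)) (C1D_fst (h0D v))).
have H01 v := C1D_mul (c2 v) (C1D_add (C1D_fst (h1D v)) (C1D_snd (h0D v))).
have H11 v := C1D_mul (c2 v) (C1D_add (C1D_snd (h1D v)) (C1D_snd (h1D v))).
(* The diagonal entries keep the unsimplified form [2^-1 * (x + x)] of [strain], so that the four
   equalities hold by unfolding, up to commutativity. *)
have SE z : U z -> [/\ strain u z 0 0 = 2^-1 * ((h0 z).1 + (h0 z).1), strain u z 0 1 = 2^-1 * ((h1 z).1 + (h0 z).2),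
    strain u z 1 0 = 2^-1 * ((h1 z).1 + (h0 z).2) & strain u z 1 1 = 2^-1 * ((h1 z).2 + (h1 z).2)].
  move=> Uz; rewrite h0E// h1E//; split; rewrite mxE//.
  by rewrite addrC.
have half2 (x : R) : 2^-1 * (x + x) = x by field.
have half (x : R) : 2 * (2^-1 * x) = x by field.
exists (fun z => 2^-1 * ((h0 z).1 + (h0 z).1)), (fun z => 2^-1 * ((h1 z).1 + (h0 z).2)),
  (fun z => 2^-1 * ((h1 z).2 + (h1 z).2)).
do 3 eexists; split.
- by split; [exact: H00|exact: H01|exact: H11].
- move=> z Uz; split; first by rewrite half2 h0E.
    by rewrite half2 h1E.
  by rewrite half h0E// h1E.
- exact: SE.
- move=> z cz; have [cS00 _ _] := H00 0; have [cS01 _ _] := H01 0; have [cS11 _ _] := H11 0.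
  split; rewrite mxE.
  + by apply: (cont_extE cS00 _ cz) => w /SE[].
  + by apply: (cont_extE cS01 _ cz) => w /SE[].
  + by apply: (cont_extE cS01 _ cz) => w /SE[].
  + by apply: (cont_extE cS11 _ cz) => w /SE[].
Qed.
End PDE.

(* Momentum is multiplied by u = (a, b) and mass by rho |u|^2 / 2 + rho g eta. *)
Lemma energy_balance_algebra (F : numFieldType) (rho mu g p pt px py a at_ ax ay b bt bx by_ e ex ey
    s00 s01 s11 d00x d01x d01y d11y : F) :
  pt + ((px * a + p * ax) + (py * b + p * by_)) = 0 ->
  rho * p * (at_ + (a * ax + b * ay)) - 2 * mu * ((px * s00 + p * d00x) + (py * s01 + p * d01y))
    + rho * g * p * ex = 0 ->
  rho * p * (bt + (a * bx + b * by_)) - 2 * mu * ((px * s01 + p * d01x) + (py * s11 + p * d11y))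
    + rho * g * p * ey = 0 ->
  s00 = ax -> s11 = by_ -> 2 * s01 = ay + bx ->
  rho / 2 * (pt * (a * a + b * b) + p * ((at_ * a + a * at_) + (bt * b + b * bt)))
    + rho * g / 2 * (pt * e + e * pt) =
  (- (rho / 2) * ((px * (a * a + b * b) + p * ((ax * a + a * ax) + (bx * b + b * bx))) * a
     + (p * (a * a + b * b)) * ax)
   + - (rho * g) * ((px * e + p * ex) * a + p * e * ax)
   + 2 * mu * (px * (s00 * a + s01 * b) + p * ((d00x * a + s00 * ax) + (d01x * b + s01 * bx))))
  + (- (rho / 2) * ((py * (a * a + b * b) + p * ((ay * a + a * ay) + (by_ * b + b * by_))) * b
     + (p * (a * a + b * b)) * by_)
   + - (rho * g) * ((py * e + p * ey) * b + p * e * by_)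
   + 2 * mu * (py * (s01 * a + s11 * b) + p * ((d01y * a + s01 * ay) + (d11y * b + s11 * by_))))
  + - (2 * mu) * (p * ((s00 * s00 + s01 * s01) + (s01 * s01 + s11 * s11))).
Proof.
move=> + + + s00E s11E; rewrite -{}s00E -{}s11E => M0 M1 M2 sE.
(* The strain determines only [ay + bx]: [ay] is eliminated and [bx] stays free. *)
have {sE} ayE : ay = 2 * s01 - bx by rewrite sE addrK.
apply/eqP; rewrite -subr_eq0; apply/eqP.
transitivity (a * (rho * p * (at_ + (a * s00 + b * ay)) - 2 * mu * ((px * s00 + p * d00x) + (py * s01 + p * d01y))
    + rho * g * p * ex) +
      b * (rho * p * (bt + (a * bx + b * s11)) - 2 * mu * ((px * s01 + p * d01x) + (py * s11 + p * d11y))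
    + rho * g * p * ey) + (rho / 2 * (a ^+ 2 + b ^+ 2) + rho * g * e) * (pt + ((px * a + p * s00) + (py * b + p * s11))));
      last by rewrite M0 M1 M2 !mulr0 !addr0.
by rewrite ayE; field; rewrite ?pnatr_eq0.
Qed.

Section EnergyBalance.
Variable R : realType.
Variables (Om : set (R * R)) (T rho mu g : R) (zeta : R * R -> R).
Variables (phi eta : R * R * R -> R) (u : R * R * R -> R * R).
Variables (m : nat) (gam : 'I_m -> R -> R * R) (n : R * R -> R * R).
Hypothesis bnd : piecewise_C1_boundary Om gam n.
Hypothesis oOm : open Om.
Hypothesis bOm : bounded_set Om.
Hypothesis T0 : 0 < T.
Hypothesis zetaC1 : Ck_closure 1 Om zeta.
Hypothesis phi_smooth : smooth_closure (cylinder Om T) phi.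
Hypothesis u_smooth : smooth_closure (cylinder Om T) u.
Hypothesis eta_cont : {within closure (cylinder Om T), continuous eta}.
Hypothesis mass : forall z, cylinder Om T z ->
  dt phi z + divg (fun w => phi w *: u w) z = 0.
Hypothesis momentum : forall z, cylinder Om T z ->
  (rho * phi z) *: (dt u z + convect u z)
  - (2 * mu) *: divgM (fun w => phi w *: strain u w) z
  + (rho * g * phi z) *: grad eta z = 0.
Hypothesis height : forall z, cylinder Om T z -> phi z = eta z + zeta z.1.

Let U := cylinder Om T.
Let oU : open U := cylinder_open (T := T) oOm.
Let a z := (u z).1.
Let b z := (u z).2.

Variables (S00 S01 S11 : R * R * R -> R) (d00 d01 d11 : R * R * R -> R * R * R -> R).
Hypothesis hS00 : forall v, C1D U v S00 (d00 v).
Hypothesis hS01 : forall v, C1D U v S01 (d01 v).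
Hypothesis hS11 : forall v, C1D U v S11 (d11 v).
Hypothesis SuE : forall z, U z -> [/\ S00 z = ('D_(xdir R 0) u z).1, S11 z = ('D_(xdir R 1) u z).2 &
  2 * S01 z = ('D_(xdir R 1) u z).1 + ('D_(xdir R 0) u z).2].
Hypothesis SE : forall z, U z -> [/\ strain u z 0 0 = S00 z, strain u z 0 1 = S01 z,
  strain u z 1 0 = S01 z & strain u z 1 1 = S11 z].

Hypothesis SEcl : forall z, closure U z -> [/\ strain_ext Om T u z 0 0 = S00 z, strain_ext Om T u z 0 1 = S01 z,
  strain_ext Om T u z 1 0 = S01 z & strain_ext Om T u z 1 1 = S11 z].

Let hphi v : C1D U v phi ('D_v phi) := smooth_C1D v phi_smooth.
Let ha v : C1D U v a (fun z => ('D_v u z).1) := C1D_fst (smooth_C1D v u_smooth).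
Let hb v : C1D U v b (fun z => ('D_v u z).2) := C1D_snd (smooth_C1D v u_smooth).

Lemma mass_coord z : U z ->
  'D_(tdir R) phi z + (('D_(xdir R 0) phi z * a z + phi z * ('D_(xdir R 0) u z).1)
    + ('D_(xdir R 1) phi z * b z + phi z * ('D_(xdir R 1) u z).2)) = 0.
Proof.
move=> Uz; rewrite -(C1D_derive (C1D_mul (hphi _) (ha _)) Uz) -(C1D_derive (C1D_mul (hphi _) (hb _)) Uz).
by have := mass Uz; rewrite /divg sum_ord2.
Qed.

Lemma stress_val v i j S d z : U z -> C1D U v S d -> (forall w, U w -> strain u w i j = S w) ->
  'D_v (fun w => (phi w *: strain u w) i j) z = 'D_v phi z * S z + phi z * d z.
Proof.
move=> Uz hS SijE; have [_ h _] := C1D_mul (hphi v) hS.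
have hz : is_derive z v (fun w => (phi w *: strain u w) i j) ('D_v phi z * S z + phi z * d z).
  by apply: (is_derive_eq_on oU Uz _ (h z Uz)) => w /SijE SwE; rewrite mxE SwE.
exact: derive_val.
Qed.

Lemma momentum_coord z : U z ->
  rho * phi z * (('D_(tdir R) u z).1 + (a z * ('D_(xdir R 0) u z).1 + b z * ('D_(xdir R 1) u z).1))
   - 2 * mu * (('D_(xdir R 0) phi z * S00 z + phi z * d00 (xdir R 0) z)
        + ('D_(xdir R 1) phi z * S01 z + phi z * d01 (xdir R 1) z))
   + rho * g * phi z * 'D_(xdir R 0) eta z = 0 /\
  rho * phi z * (('D_(tdir R) u z).2 + (a z * ('D_(xdir R 0) u z).2 + b z * ('D_(xdir R 1) u z).2))
   - 2 * mu * (('D_(xdir R 0) phi z * S01 z + phi z * d01 (xdir R 0) z)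
        + ('D_(xdir R 1) phi z * S11 z + phi z * d11 (xdir R 1) z))
   + rho * g * phi z * 'D_(xdir R 1) eta z = 0.
Proof.
move=> Uz.
have e00 := stress_val Uz (hS00 (xdir R 0)) (fun w Uw => let: And4 p _ _ _ := SE Uw in p).
have e01 := stress_val Uz (hS01 (xdir R 1)) (fun w Uw => let: And4 _ p _ _ := SE Uw in p).
have e10 := stress_val Uz (hS01 (xdir R 0)) (fun w Uw => let: And4 _ _ p _ := SE Uw in p).
have e11 := stress_val Uz (hS11 (xdir R 1)) (fun w Uw => let: And4 _ _ _ p := SE Uw in p).
(* The components of the vector equation have the required shape up to conversion; [subst_flux]
   exchanges the stress derivatives without a syntactic match. *)
have subst_flux (p q r x x' y y' : R) : x = x' -> y = y' ->
    p - q * (x + y) + r = 0 -> p - q * (x' + y') + r = 0 by move=> -> ->.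
have := momentum Uz; rewrite /convect /divgM !sum_ord2 => M.
split; first exact: (subst_flux _ _ _ _ _ _ _ e00 e01 (congr1 fst M)).
exact: (subst_flux _ _ _ _ _ _ _ e10 e11 (congr1 snd M)).
Qed.

Let heta v : C1D U v eta ('D_v eta) := C1D_eta oOm T0 zetaC1 phi_smooth eta_cont height v.
Let hK v := C1D_mul (hphi v) (C1D_add (C1D_mul (ha v) (ha v)) (C1D_mul (hb v) (hb v))).
Let hPE v := C1D_mul (hphi v) (heta v).
Let hX v := C1D_mul (hphi v) (C1D_add (C1D_mul (hS00 v) (ha v)) (C1D_mul (hS01 v) (hb v))).
Let hY v := C1D_mul (hphi v) (C1D_add (C1D_mul (hS01 v) (ha v)) (C1D_mul (hS11 v) (hb v))).

Definition energy_density z := rho / 2 * (phi z * (a z * a z + b z * b z)) + rho * g / 2 * (eta z * eta z).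

(** Together with [energy_flux2], the field whose normal component collects the integrands of I1, I2
    and I3 with their constants. Products replace [enorm] and [dot], so that the rules of [C1D]
    differentiate the expression as it stands. *)
Definition energy_flux1 z := - (rho / 2) * (phi z * (a z * a z + b z * b z) * a z)
  + - (rho * g) * (phi z * eta z * a z) + 2 * mu * (phi z * (S00 z * a z + S01 z * b z)).

Definition energy_flux2 z := - (rho / 2) * (phi z * (a z * a z + b z * b z) * b z)
  + - (rho * g) * (phi z * eta z * b z) + 2 * mu * (phi z * (S01 z * a z + S11 z * b z)).

Definition dissipation z :=
  - (2 * mu) * (phi z * ((S00 z * S00 z + S01 z * S01 z) + (S01 z * S01 z + S11 z * S11 z))).

Let hdiss := C1D_scale (- (2 * mu)) (C1D_mul (hphi 0)
  (C1D_add (C1D_add (C1D_mul (hS00 0) (hS00 0)) (C1D_mul (hS01 0) (hS01 0)))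
  (C1D_add (C1D_mul (hS01 0) (hS01 0)) (C1D_mul (hS11 0) (hS11 0))))).

Lemma energy_balance :
  let E := fun s => \int[(@lebesgue_measure R \x @lebesgue_measure R)%E]_(x in Om) energy_density (x, s) in
  let rate := balance_rate Om gam n energy_flux1 energy_flux2 dissipation in
  [/\ (forall t, 0 < t < T -> is_derive t 1 E (rate t)),
      (r^-1 * (E (0 + r) - E 0)) @[r --> 0^'+] --> rate 0 &
      (r^-1 * (E (T + r) - E T)) @[r --> 0^'-] --> rate T].
Proof.
have he := C1D_add (C1D_scale (rho / 2) (hK (tdir R)))
  (C1D_scale (rho * g / 2) (C1D_mul (heta (tdir R)) (heta (tdir R)))).
have h1 := C1D_add (C1D_add (C1D_scale (- (rho / 2)) (C1D_mul (hK (xdir R 0)) (ha (xdir R 0))))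
  (C1D_scale (- (rho * g)) (C1D_mul (hPE (xdir R 0)) (ha (xdir R 0))))) (C1D_scale (2 * mu) (hX (xdir R 0))).
have h2 := C1D_add (C1D_add (C1D_scale (- (rho / 2)) (C1D_mul (hK (xdir R 1)) (hb (xdir R 1))))
  (C1D_scale (- (rho * g)) (C1D_mul (hPE (xdir R 1)) (hb (xdir R 1))))) (C1D_scale (2 * mu) (hY (xdir R 1))).
have [cD _ _] := hdiss.
apply: (balance_law bnd oOm bOm T0 he h1 h2 cD) => z Uz /=.
have [s00E s11E s01E] := SuE Uz; have [M1 M2] := momentum_coord Uz.
have := energy_balance_algebra (eta z) (mass_coord Uz) M1 M2 s00E s11E s01E.
(* The algebraic identity is stated with [pt] in place of the time derivative of [eta]. *)
rewrite (eta_dt oOm T0 zetaC1 phi_smooth eta_cont height Uz).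
exact.
Qed.

Let slice v (f df : R * R * R -> R) t : 0 <= t <= T -> C1D U v f df ->
  {within closure Om, continuous (fun x => f (x, t))}.
Proof. by move=> t0T [cf _ _]; exact: (within_slice T0 t0T cf). Qed.

Lemma energy_integralE t : 0 <= t <= T -> energy Om rho g phi eta u t =
  \int[(@lebesgue_measure R \x @lebesgue_measure R)%E]_(x in Om) energy_density (x, t).
Proof.
move=> t0T; rewrite /energy /leb2 -RintegralD.
- apply: eq_Rintegral => x _; rewrite enormE2 real_normK ?num_real// /energy_density !expr2 -[X in X + _]mulrA.
  by rewrite [X in _ + X]mulrAC.
- exact: open_measurable_prod.
- have [cK _ _] := C1D_scale (rho / 2) (hK 0).
  have -> : (fun x => rho / 2 * phi (x, t) * enorm (u (x, t)) ^+ 2) =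
    (fun x => rho / 2 * (phi (x, t) * (a (x, t) * a (x, t) + b (x, t) * b (x, t)))).
    by apply/funext => x; rewrite enormE2 !expr2 -mulrA.
  exact: (slice_integrable2 oOm bOm T0 t0T cK).
- have [cK _ _] := C1D_scale (rho * g / 2) (C1D_mul (heta 0) (heta 0)).
  have -> : (fun x => rho * g * `|eta (x, t)| ^+ 2 / 2) = (fun x => rho * g / 2 * (eta (x, t) * eta (x, t))).
    by apply/funext => x; rewrite real_normK ?num_real// expr2 mulrAC.
  exact: (slice_integrable2 oOm bOm T0 t0T cK).
Qed.

(** The end times are included, because [strain_ext] equals the continuous [S00], [S01], [S11] on
    the whole closed cylinder. *)
Lemma rate_balanceE t : 0 <= t <= T ->
  I1 rho phi u gam n t + I2 rho g phi eta u gam n t + I3 Om T mu phi u gam n t + I4 Om T mu phi u t =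
  balance_rate Om gam n energy_flux1 energy_flux2 dissipation t.
Proof.
move=> t0T.
have cA1 := slice t0T (C1D_mul (hK 0) (ha 0)); have cB1 := slice t0T (C1D_mul (hK 0) (hb 0)).
have cA2 := slice t0T (C1D_mul (hPE 0) (ha 0)); have cB2 := slice t0T (C1D_mul (hPE 0) (hb 0)).
have cA3 := slice t0T (hX 0); have cB3 := slice t0T (hY 0).
have clt x : closure Om x -> closure U (x, t) by move=> cx; apply/(closure_cylinderP _ T0).
rewrite /I1 /I2 /I3 /I4 /leb2 /balance_rate.
rewrite (line_integral_flux bnd oOm bOm cA1 cB1); first last.
  by move=> x _; rewrite enormE2 dotE !expr2 mulrDr !mulrA.
rewrite (line_integral_flux bnd oOm bOm cA2 cB2); first last.
  by move=> x _; rewrite dotE mulrDr !mulrA.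
rewrite (line_integral_flux bnd oOm bOm cA3 cB3); first last.
  move=> x /clt /SEcl[e00 e01 e10 e11]; rewrite dotE /mxapp !sum_ord2/= e00 e01 e10 e11.
  by rewrite /a /b /coord/=; ring.
have cg := @arc_continuous _ _ _ _ _ bnd; have cl := arc_closure bnd.
rewrite /energy_flux1 /energy_flux2.
rewrite (flux_lin3 cg cl bOm (normal_weight1_bounded bnd oOm) _ _ _ cA1 cA2 cA3)
  (flux_lin3 cg cl bOm (normal_weight2_bounded bnd oOm) _ _ _ cB1 cB2 cB3).
have -> : \int[(@lebesgue_measure R \x @lebesgue_measure R)%E]_(x in Om) dissipation (x, t) =
    - (2 * mu) * \int[(@lebesgue_measure R \x @lebesgue_measure R)%E]_(x in Om)
      (phi (x, t) * mxnorm2 (strain_ext Om T u (x, t))).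
  have [cD _ _] := C1D_mul (hphi 0) (C1D_add (C1D_add (C1D_mul (hS00 0) (hS00 0)) (C1D_mul (hS01 0) (hS01 0)))
    (C1D_add (C1D_mul (hS01 0) (hS01 0)) (C1D_mul (hS11 0) (hS11 0)))).
  rewrite /dissipation RintegralZl; first last.
  - exact: (slice_integrable2 oOm bOm T0 t0T cD).
  - exact: open_measurable_prod.
  congr (_ * _); apply: eq_Rintegral => x; rewrite inE => /(@subset_closure _ Om) /clt /SEcl[e00 e01 e10 e11].
  by rewrite /mxnorm2 !sum_ord2 e00 e01 e10 e11 !expr2.
congr (_ + _).
by rewrite !mulrDr; ring.
Qed.
End EnergyBalance.

Theorem theorem3p1 (R : realType) (Om : set (R * R))
    (m : nat) (gam : 'I_m -> R -> R * R) (n : R * R -> R * R)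
    (T rho mu g : R) (zeta : R * R -> R)
    (phi eta : R * R * R -> R) (u : R * R * R -> R * R)
    (domOm : bounded_domain Om)
    (bndOm : piecewise_C1_boundary Om gam n)
    (T_gt0 : 0 < T) (rho_gt0 : 0 < rho) (mu_gt0 : 0 < mu) (g_gt0 : 0 < g)
    (zetaC1 : Ck_closure 1 Om zeta)
    (zeta_gt0 : forall x, closure Om x -> 0 < zeta x)
    (phi_smooth : smooth_closure (cylinder Om T) phi)
    (u_smooth : smooth_closure (cylinder Om T) u)
    (eta_cont : {within closure (cylinder Om T), continuous eta})
    (mass : forall z, cylinder Om T z ->
       dt phi z + divg (fun w => phi w *: u w) z = 0)
    (momentum : forall z, cylinder Om T z ->
       (rho * phi z) *: (dt u z + convect u z)
       - (2 * mu) *: divgM (fun w => phi w *: strain u w) z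
       + (rho * g * phi z) *: grad eta z = 0)
    (height : forall z, cylinder Om T z -> phi z = eta z + zeta z.1) :
  let E := energy Om rho g phi eta u in
  let rate := fun t => I1 rho phi u gam n t + I2 rho g phi eta u gam n t
                     + I3 Om T mu phi u gam n t + I4 Om T mu phi u t in
  [/\ (forall t, 0 < t < T -> is_derive t 1 E (rate t)),
      (r^-1 * (E r - E 0)) @[r --> 0^'+] --> rate 0 &
      (r^-1 * (E (T + r) - E T)) @[r --> 0^'-] --> rate T].
Proof.
have [oOm _ _ bOm] := domOm.
have [S00 [S01 [S11 [d00 [d01 [d11 [[hS00 hS01 hS11] SuE SE SEcl]]]]]]] := strain_C1D oOm u_smooth.
have [D DR DL] := energy_balance bndOm oOm bOm T_gt0 zetaC1 phi_smooth u_smooth eta_cont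
  mass momentum height hS00 hS01 hS11 SuE SE.
have eE := energy_integralE rho g oOm bOm T_gt0 zetaC1 phi_smooth u_smooth eta_cont height.
have rE := rate_balanceE rho mu g bndOm oOm bOm T_gt0 zetaC1 phi_smooth u_smooth eta_cont height hS00 hS01 hS11 SEcl.
have T00 : 0 <= (0 : R) <= T by rewrite lexx ltW.
have TT : 0 <= T <= T by rewrite lexx ltW.
move=> E rate; split.
- move=> t t0T; have t0T' : 0 <= t <= T by move/andP : t0T => [/ltW -> /ltW ->].
  have tI : `]0, T[%classic t by rewrite /= in_itv.
  (* [eE] holds on [[0, T]] only, so the derivative is transferred through equality near [t], and
     the one-sided quotients below through equality for small [r] of the right sign. *)
  rewrite /rate rE//; apply: near_eq_is_derive (D t t0T).
  have := near_in_itvoo tI; apply: filterS => s; rewrite in_itv/= => /andP[s0 sT].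
  by rewrite /E eE// !ltW.
- rewrite /rate rE//; apply: cvg_trans DR; apply: near_eq_cvg.
  near=> r; rewrite /E add0r !eE//; apply/andP; split; near: r.
    exact: nbhs_right_ge.
  exact: nbhs_right_le.
- rewrite /rate rE//; apply: cvg_trans DL; apply: near_eq_cvg.
  near=> r; rewrite /E !eE//; apply/andP; split.
    rewrite -lerBlDl sub0r; near: r; apply: nbhs_left_ge; by rewrite oppr_lt0.
  rewrite gerDl; near: r; exact: nbhs_left_le.
Unshelve. all: by end_near.
Qed.
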